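(* For each $x\in\Sigma$, let $\mathbb P_x$ be the unique solution of the $(\mathfrak L,\mathcal D_S)$-martingale problem starting at $x$. Then $\mathbb P_x$ is absorbing, that is, $$\mathbb P_x\{\mathscr B_n\supseteq\mathscr B(X_t)\ \text{for all } t\ge\sigma_n\}=1\quad\text{for every } n\ge 0.$$
   Context: Markov chain. $S=\{1,\dots,p\}$, $p\ge 2$; $r:S\times S\to[0,\infty)$, $r(i,i)=0$, are the jump rates of an irreducible continuous-time Markov chain on $S$ with unique stationary probability $(m_i)_{i\in S}$. $(e_i)$ is the canonical basis of $\mathbb R^S$, $v_i:=\sum_j r(i,j)(e_j-e_i)$, and $b\ge1$ is a fixed real number. Function spaces. $\Sigma:=\{x\in\mathbb R^S:x_i\ge0,\ \sum_i x_i=1\}$, $\mathring\Sigma:=\{x\in\Sigma:x_i>0\ \forall i\}$, $T_\Sigma:=\{V\in\mathbb R^S:\sum_iV_i=0\}$; $\nabla_V f$ is the directional derivative on $\mathring\Sigma$. $C^1(\Sigma)$: functions $f\in C(\Sigma)$, continuously differentiable on $\mathring\Sigma$ (an open subset of the hyperplane $\sum_i x_i=1$), with $\nabla_Vf$ extending continuously to $\Sigma$ for all $V\in T_\Sigma$. $C^2(\Sigma)$: functions $f\in C^1(\Sigma)$, $C^2$ on $\mathring\Sigma$, with $\nabla_V\nabla_Wf$ extending continuously to $\Sigma$ for all $V,W\in T_\Sigma$. Extensions are denoted by the same symbols. Operator. $(\nabla_{b_i}F)(x):=b\,\mathbf 1\{x_i>0\}\frac{m_i}{x_i}(\nabla_{v_i}F)(x)$;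 $\mathcal D_S:=\{F\in C^2(\Sigma):\nabla_{b_i}F\text{ continuous on }\Sigma\ \forall i\in S\}$; for $F\in\mathcal D_S$, $(\mathfrak LF)(x):=\sum_{i}(\nabla_{b_i}F)(x)+\frac12\sum_{i,j}m_ir(i,j)[\nabla_{e_i-e_j}(\nabla_{e_i-e_j}F)](x)$. Martingale problem. $C(\mathbb R_+,\Sigma)$ is the space of continuous trajectories with coordinate maps $X_t$ and filtration $\mathscr F_t=\sigma(X_s:s\le t)$. A probability $\mathbb P$ on it starts at $x$ if $\mathbb P[X_0=x]=1$, and solves the $(\mathfrak L,\mathcal D_S)$-martingale problem if $H(X_t)-\int_0^t(\mathfrak LH)(X_s)ds$ is a $\mathbb P$-martingale for $(\mathscr F_t)$ for every $H\in\mathcal D_S$. For each $x\in\Sigma$ there is a unique solution starting at $x$, denoted $\mathbb P_x$. Stopping times. For $x\in\Sigma$, $\mathscr B(x):=\{j\in S:x_j>0\}$. For nonempty $B\subset S$, $h_B:=\inf\{t\ge0:\prod_{j\in B}X_t(j)=0\}$ ($\inf\varnothing=\infty$), where $X_t(j)$ is the $j$-th coordinate of $X_t$. $(\theta_t)_{t\ge0}$ is the semigroup of time translations on $C(\mathbb R_+,\Sigma)$. Set $\sigma_0=0$, $\mathscr B_0=\mathscr B(X_0)$, and for $n\ge1$, on $\{\sigma_{n-1}<\infty\}$, $\sigma_n:=\sigma_{n-1}+h_{\mathscr B_{n-1}}\circ\theta_{\sigma_{n-1}}$ and (if $\sigma_n<\infty$) $\mathscr B_n:=\{j\in S:X_{\sigma_n}(j)>0\}$;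 $\sigma_n=\infty$ on $\{\sigma_{n-1}=\infty\}$. The condition in the claim is void on $\{\sigma_n=\infty\}$. *)

(* Defs.v *)
From HB Require Import structures.
From mathcomp Require Import all_boot all_order all_algebra.
From mathcomp Require Import all_classical all_reals all_analysis.

Set Implicit Arguments.
Unset Strict Implicit.
Unset Printing Implicit Defensive.

Import Order.TTheory GRing.Theory Num.Theory numFieldNormedType.Exports.

Local Open Scope classical_set_scope.
Local Open Scope ring_scope.

Section Chain.
Context {R : realType} {n : nat}.
Implicit Types (r : 'I_n -> 'I_n -> R) (m : 'I_n -> R).

Definition is_jump_rate r := (forall i j, 0 <= r i j) /\ (forall i, r i i = 0).

Definition irreducible_rate r :=
  forall i j : 'I_n, connect (fun k l => 0 < r k l) i j.

Definition is_stationary r m :=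
  [/\ forall i, 0 <= m i, \sum_i m i = 1
    & forall j, \sum_i m i * r i j = m j * \sum_i r j i].

End Chain.

(* Functions on the simplex are represented by functions on the whole space
   'rV[R]_n; nothing below looks at their values outside the simplex. In
   particular, for x in the relative interior and V tangent, 'D_V f x only
   depends on f near x inside the simplex. *)
Section Simplex.
Context {R : realType} {n : nat}.
Implicit Types (x V W : 'rV[R]_n) (f g : 'rV[R]_n -> R).

Definition simplex : set 'rV[R]_n :=
  [set x | (forall i, 0 <= x ord0 i) /\ \sum_i x ord0 i = 1].

Definition simplex_int : set 'rV[R]_n :=
  [set x | simplex x /\ forall i, 0 < x ord0 i].

Definition tangent : set 'rV[R]_n := [set V | \sum_i V ord0 i = 0].

Definition pos_sites x : {set 'I_n} := [set j | 0 < x ord0 j].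

Definition extends_continuously f :=
  exists g, {within simplex, continuous g} /\
            forall x, simplex_int x -> g x = f x.

(* Continuous differentiability on the open subset simplex_int of the
   hyperplane \sum_i x_i = 1, whose direction space is [tangent]. *)
Definition C1_int f := forall V, tangent V ->
  (forall x, simplex_int x -> derivable f x V) /\
  {within simplex_int, continuous ('D_V f)}.

Definition C2_int f :=
  C1_int f /\ forall W, tangent W -> C1_int ('D_W f).

Definition C1_simplex f :=
  [/\ {within simplex, continuous f}, C1_int f
    & forall V, tangent V -> extends_continuously ('D_V f)].

Definition C2_simplex f :=
  [/\ C1_simplex f, C2_int f
    & forall V W, tangent V -> tangent W ->
        extends_continuously ('D_V ('D_W f))].

(* The continuous extension to the simplex of the directional derivative: as
   the interior is dense, its value at x is the limit from the interior. *)
Definition nabla V f x : R :=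
  lim ('D_V f y @[y --> within simplex_int (nbhs x)]).

End Simplex.

Section Operator.
Context {R : realType} {n : nat}.
Variables (r : 'I_n -> 'I_n -> R) (m : 'I_n -> R) (b : R).
Implicit Types (x : 'rV[R]_n) (F : 'rV[R]_n -> R).

Definition unit_vec (i : 'I_n) : 'rV[R]_n := delta_mx ord0 i.

Definition drift_dir (i : 'I_n) : 'rV[R]_n :=
  \sum_j r i j *: (unit_vec j - unit_vec i).

Definition nabla_b (i : 'I_n) F x : R :=
  b * (if 0 < x ord0 i then m i / x ord0 i * nabla (drift_dir i) F x else 0).

Definition dom_S : set ('rV[R]_n -> R) :=
  [set F | C2_simplex F /\ forall i, {within simplex, continuous (nabla_b i F)}].

Definition gen F x : R :=
  \sum_i nabla_b i F x +
  2^-1 * \sum_i \sum_j m i * r i j *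
    nabla (unit_vec i - unit_vec j) (nabla (unit_vec i - unit_vec j) F) x.

End Operator.

(* C(R_+, simplex). Time is the whole of R, and a trajectory is frozen before
   time 0, so that it is determined by its restriction to [0, +oo[. *)
Record trajectory (R : realType) (n : nat) := Trajectory {
  position :> R -> 'rV[R]_n ;
  position_continuous : {within `[0, +oo[, continuous position} ;
  position_simplex : forall t, 0 <= t -> simplex (position t) ;
  position_before : forall t, t <= 0 -> position t = position 0
}.

HB.instance Definition _ (R : realType) (n : nat) :=
  gen_eqMixin (trajectory R n).
HB.instance Definition _ (R : realType) (n : nat) :=
  gen_choiceMixin (trajectory R n).

Lemma simplex_unit_vec (R : realType) (n : nat) (i : 'I_n) :
  simplex (unit_vec i : 'rV[R]_n).
Proof.
split=> [j|]; first by rewrite mxE eqxx; case: (_ == _).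
rewrite (bigD1 i) //= mxE !eqxx big1 ?addr0 // => j /negbTE ji.
by rewrite mxE ji andbF.
Qed.

(* Measurable types are pointed in the library, hence the positive dimension. *)
Definition trajectory0 (R : realType) (n : nat) : trajectory R n.+1 :=
  @Trajectory R n.+1 (fun=> unit_vec ord0)
    (@continuous_subspaceT _ _ _ _ (fun=> cvg_cst _))
    (fun _ _ => simplex_unit_vec R ord0) (fun _ _ => erefl).

HB.instance Definition _ (R : realType) (n : nat) :=
  isPointed.Build (trajectory R n.+1) (trajectory0 R n).

Section PathSpace.
Context {R : realType} {n : nat}.

Definition borel_rV : set (set 'rV[R]_n) := <<s open >>.

Definition sigma_coord (t : R) : set (set (trajectory R n)) :=
  preimage_set_system setT
    (fun w : trajectory R n => w t) borel_rV.

Definition coord_events : set (set (trajectory R n)) :=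
  \bigcup_(s in `[0, +oo[) sigma_coord s.

Definition past (t : R) : set (set (trajectory R n)) :=
  <<s \bigcup_(s in `[0, t]) sigma_coord s >>.

End PathSpace.
Arguments coord_events : clear implicits.

Notation path_space R n := (g_sigma_algebraType (coord_events R n)).

Section Martingale.
Context d (T : measurableType d) (R : realType).

(* The last condition says that E[M t | filt s] = M s. *)
Definition is_martingale (P : probability T R) (filt : R -> set (set T))
    (M : R -> T -> R) :=
  [/\ forall t, 0 <= t -> forall B : set R, measurable B -> filt t (M t @^-1` B),
      forall t, 0 <= t -> P.-integrable setT (EFin \o M t)
    & forall s t, 0 <= s -> s <= t -> forall A, filt s A ->
        (\int[P]_(w in A) (M t w)%:E = \int[P]_(w in A) (M s w)%:E)%E].

End Martingale.

Section MartingaleProblem.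
Context {R : realType} {n : nat}.
Variables (r : 'I_n.+1 -> 'I_n.+1 -> R) (m : 'I_n.+1 -> R) (b : R).

Definition starts_at (P : probability (path_space R n.+1) R) (x : 'rV[R]_n.+1) :=
  P [set w | w 0 = x] = 1%E.

Definition solves_martingale_problem (P : probability (path_space R n.+1) R) :=
  forall H, dom_S r m b H ->
    is_martingale P past
      (fun t (w : trajectory R n.+1) =>
         H (w t) - \int[lebesgue_measure]_(s in `[0, t]) gen r m b H (w s)).

End MartingaleProblem.

Section StoppingTimes.
Context {R : realType} {n : nat}.
Implicit Types (w : R -> 'rV[R]_n) (B : {set 'I_n}).

Definition hit B w : \bar R :=
  ereal_inf [set t%:E | t in [set t | 0 <= t /\ \prod_(j in B) w t ord0 j = 0]].

Definition shift_time (s : R) w : R -> 'rV[R]_n := fun t => w (s + t).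

(* The pair (sigma_k, B_k). When sigma_k = +oo, the second component is a
   junk value. *)
Fixpoint absorption (k : nat) w : \bar R * {set 'I_n} :=
  if k is k'.+1 then
    let: (s, B) := absorption k' w in
    if s is u%:E then
      let s' := (u%:E + hit B (shift_time u w))%E in
      (s', if s' is v%:E then pos_sites (w v) else finset.set0)
    else (+oo%E, finset.set0)
  else (0%E, pos_sites (w 0)).

Definition sigma_time k w := (absorption k w).1.
Definition live_set k w := (absorption k w).2.

End StoppingTimes.

(* Main.v *)
(** For a proper subset [A] of the sites let [g] be the expected exit time from
    [A]: [g = 0] off [A] and [L g = -1] on [A]. Near the face where the masses
    of [A] vanish and the others do not, the generator applied to [p(u)], with
    [u = \sum_i g_i x_i], has singular part [- b p'(u) P + p''(u) Gamma], where
    [P] is comparable to [\sum_(k in A) 1 / x_k] and [Gamma <= u P]. As [b >= 1],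
    [p(w) = w] gives a local supermartingale, so that [u] stays at [0] once it
    has reached [0].

    Two obstacles. First, [u] is not in the domain: one uses instead a smooth
    maximum, at scale [t], of the functions obtained by making [g] harmonic on
    subsets [C] of [A], and lets [t] go to [0]; the derivatives of this maximum
    see no light site. Second, passing to the limit requires that [P] be
    integrable along the trajectory. This is proved by induction on [#|A|]: where
    [u] is bounded below, some site of [A] is heavy and [A] can be made smaller;
    where [u] is small, a convex [p] with [p' - w p'' >= min ((w / eps)^2 / 4, 1)]
    turns the singular part into a bound on the integral of [P].

    The absorption of [u] at [0] is then read off on finer and finer time grids,
    and countably many faces, rational times and thresholds suffice to conclude
    that a coordinate that vanishes stays at [0]. *)

(* Membership in [dom_S] forces the derivative along [drift_dir r k] to vanish where x_k = 0,
   whereas u has derivative L g (k) = -1 for k in A. The smooth maximum repairs this at the price of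
   second derivatives of order 1 / t; but these vanish unless some site of A has mass of order t, so
   they are at most a multiple of \sum_(k in A) 1 / x_k, uniformly in t. Hence the integrability of
   P is just what dominated convergence needs. The bound Gamma <= u P is the Dirichlet form
   identity, where stationarity enters, combined with g_k x_k <= u.

   Proving the integrability with p(w) = w would be circular, since the passage to the limit would
   already use it. So p is made to vanish for w <= a: then only the region where u is at least a / 2
   needs domination, and there the induction applies. Cutting a linear p at scale a would cost p''
   of order 1 / a; a p that is quadratic near 0 costs only a multiple of 1 / eps, which the
   vanishing measure of {0 < u < 4 a} absorbs as a tends to 0. Then eps tends to 0. *)
Require Import Defs.
From HB Require Import structures.
From mathcomp Require Import all_boot all_order all_algebra.
From mathcomp Require Import all_classical all_reals all_analysis.
From mathcomp Require Import measurable_realfun ring lra.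
Import Order.TTheory GRing.Theory Num.Theory numFieldNormedType.Exports.
Local Open Scope classical_set_scope.
Local Open Scope ring_scope.

Set Implicit Arguments.
Unset Strict Implicit.
Unset Printing Implicit Defensive.

(** * Smooth functions on the simplex *)

Section PositivePart.
Context {R : realType}.
Implicit Types x : R.

Definition pospow k x : R := Num.max x 0 ^+ k.

Lemma pospow_ge0 k x : 0 <= pospow k x.
Proof. by rewrite exprn_ge0// le_max lexx orbT. Qed.

Lemma pospow_ge k x : 0 <= x -> pospow k x = x ^+ k.
Proof. by move=> x0; rewrite /pospow max_l. Qed.

Lemma pospow_le k x : x <= 0 -> pospow k.+1 x = 0.
Proof. by move=> x0; rewrite /pospow max_r// expr0n. Qed.

Lemma continuous_pospow k : continuous (pospow k).
Proof.
move=> x; apply: (@continuous_comp _ _ _ (fun x => Num.max x 0) (fun y => y ^+ k)); last exact: exprn_continuous.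
by apply: (@continuous_max _ _ (fun x : R => x) (fun=> 0)); [exact: cvg_id|exact: cvg_cst].
Qed.

Lemma is_derive_pospow k x :
  is_derive x 1 (pospow k.+2) (k.+2%:R * pospow k.+1 x).
Proof.
have [x0|x0|->] := ltgtP x 0.
- apply: (@near_eq_is_derive _ _ _ (cst 0)).
    near=> y; rewrite /= pospow_le//; apply: ltW.
    by near: y; exact: lt_nbhsl.
  by rewrite pospow_le ?ltW// mulr0; exact: is_derive_cst.
- apply: (@near_eq_is_derive R R R (fun y : R => y ^+ k.+2)).
    near=> y; rewrite /= pospow_ge//; apply: ltW.
    by near: y; exact: lt_nbhsr.
  rewrite pospow_ge ?ltW//.
  split; first exact: exprn_derivable.
  by rewrite exp_derive /= [_%:A]mulr1.
- rewrite pospow_le// mulr0.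
  have c0 : `|h| @[h --> (0 : R)^'] --> (0 : R).
    by rewrite -[X in _ --> X](@normr0 _ R); apply: cvg_norm; exact: nbhs_dnbhs.
  suff H : (fun h : R => h^-1 *: ((pospow k.+2 \o shift 0) (h *: 1) - pospow k.+2 0))
     @ 0^' --> (0:R).
    by split; [apply/cvg_ex; exists 0|exact: cvg_lim].
  (* At the kink the difference quotient is at most |h|, as the exponent is at least 2. *)
  apply: (@squeeze_cvgr _ _ _ _ (fun h => - `|h|) (fun h => `|h|)).
  + near=> h.
    rewrite -ler_norml /= [X in pospow _ X](_ : _ = h); last by rewrite /shift /= addr0 [h *: _]mulr1.
    rewrite [X in _ - X]pospow_le// subr0.
    rewrite [X in `|X|]/(_ * _) normrM normfV ler_pdivrMl ?normr_gt0; last first.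
      by near: h; exact: nbhs_dnbhs_neq.
    rewrite ger0_norm ?pospow_ge0// -expr2.
    have [h0|h0] := leP h 0; first by rewrite pospow_le// sqr_ge0.
    rewrite (pospow_ge _ (ltW h0)) ger0_norm ?(ltW h0)//.
    rewrite exprS exprS mulrA -expr2 ler_piMr ?sqr_ge0//.
    rewrite exprn_ile1// ?(ltW h0)//; apply: ltW.
    near: h; apply: nbhs_dnbhs; exact: lt_nbhsl.
  + by rewrite -[X in _ --> X]oppr0; exact: (cvgN c0).
  + by [].
Unshelve. all: by end_near. Qed.

End PositivePart.

Lemma continuous_bigsum {R : realType} {T : topologicalType} (I : Type)
    (s : seq I) (F : I -> T -> R) :
  (forall i, continuous (F i)) -> continuous (fun x => \sum_(i <- s) F i x).
Proof.
move=> H; elim: s => [|i s IH].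
  rewrite (_ : (fun _ => _) = fun=> 0); first exact: cst_continuous.
  by apply/funext => x; rewrite big_nil.
rewrite (_ : (fun _ => _) = fun x => F i x + \sum_(i <- s) F i x).
  by move=> x; exact: (cvgD (H i x) (IH x)).
by apply/funext => x; rewrite big_cons.
Qed.

Section Continuity.
Context {R : realType} {T : topologicalType}.
Implicit Types f g : T -> R.

Lemma ctsM f g : continuous f -> continuous g -> continuous (fun x => f x * g x).
Proof. by move=> cf cg x; exact: (cvgM (cf x) (cg x)). Qed.

Lemma ctsD f g : continuous f -> continuous g -> continuous (fun x => f x + g x).
Proof. by move=> cf cg x; exact: (cvgD (cf x) (cg x)). Qed.

Lemma cts_cst (k : R) : continuous (fun _ : T => k).
Proof. exact: cst_continuous. Qed.

Lemma ctsV f : (forall x, f x != 0) -> continuous f -> continuous (fun x => (f x)^-1).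
Proof. by move=> f0 cf x; exact: (cvgV (f0 x) (cf x)). Qed.

Lemma cts_max f g :
  continuous f -> continuous g -> continuous (fun x => Num.max (f x) (g x)).
Proof. by move=> cf cg x; exact: (continuous_max (cf x) (cg x)). Qed.

End Continuity.

Lemma cts_coord {R : realType} {n : nat} (i : 'I_n) :
  continuous (fun x : 'rV[R]_n => x ord0 i).
Proof. exact: coord_continuous. Qed.

Section C2Functions.
Context {R : realType} {n : nat}.
Local Notation E := 'rV[R]_n.
Implicit Types (x V W : E) (f g : E -> R).

(** Restricting to a line makes the one-variable chain rule available for directional
    derivatives. *)
Lemma is_derive_line f x V (a : R) :
  is_derive x V f a <-> is_derive (0 : R) 1 (fun h : R => f (h *: V + x)) a.
Proof.
have e : 'D_V f x = 'D_1 (fun h : R => f (h *: V + x)) 0.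
  rewrite /derive; congr (lim _).
  set g1 := fun h => h^-1 *: _; set g2 := fun h => h^-1 *: _.
  suff -> : g1 = g2 by [].
  by rewrite funeqE /g1 /g2 => h /=; rewrite addr0 scale0r add0r [_%:A]mulr1.
split=> -[H1 H2]; split.
- by move/derivable1P : H1.
- by rewrite -e.
- exact: (proj2 (derivable1P f x V) H1).
- by rewrite e.
Qed.

Lemma is_derive_comp1 (phi : R -> R) f x V (a d : R) :
  is_derive (f x) 1 phi a -> is_derive x V f d ->
  is_derive x V (phi \o f) (a * d).
Proof.
move=> Hp /is_derive_line Hf; apply/is_derive_line.
apply: (@is_derive1_comp _ phi (fun h : R => f (h *: V + x))) => //.
by rewrite scale0r add0r.
Qed.

(** The derivatives are explicit data on the whole space, in every direction: the continuous
    extensions behind [nabla] then reduce to evaluation. In [d2f V W] the direction [V] is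
    differentiated first. *)
Definition C2 f (df : E -> E -> R) (d2f : E -> E -> E -> R) :=
  [/\ forall V x, is_derive x V f (df V x),
      forall V W x, is_derive x W (df V) (d2f V W x),
      continuous f, forall V, continuous (df V)
    & forall V W, continuous (d2f V W)].

Definition lin (g : 'I_n -> R) x : R := \sum_i g i * x ord0 i.

Implicit Types a : 'I_n -> R.

Lemma linD a x y : lin a (x + y) = lin a x + lin a y.
Proof. by rewrite /lin -big_split; apply: eq_bigr => i _; rewrite mxE mulrDr. Qed.

Lemma linZ a (k : R) x : lin a (k *: x) = k * lin a x.
Proof. by rewrite /lin mulr_sumr; apply: eq_bigr => i _; rewrite mxE mulrCA. Qed.

Lemma continuous_lin a : continuous (lin a).
Proof.
by apply: continuous_bigsum => i; apply: ctsM; [exact: cts_cst|exact: cts_coord].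
Qed.

Lemma C2_cst (k : R) : C2 (fun=> k) (fun _ _ => 0) (fun _ _ _ => 0).
Proof.
split.
- by move=> V x; exact: is_derive_cst.
- by move=> V W x; exact: is_derive_cst.
- exact: cst_continuous.
- by move=> V; exact: cst_continuous.
- by move=> V W; exact: cst_continuous.
Qed.

Lemma C2_lin a : C2 (lin a) (fun V _ => lin a V) (fun _ _ _ => 0).
Proof.
split; [| |exact: continuous_lin|by move=> V; exact: cst_continuous|by move=> V W; exact: cst_continuous].
- move=> V x.
  suff H : (fun h : R => h^-1 *: ((lin a \o shift x) (h *: V) - lin a x)) @ 0^'
     --> (lin a V : R).
    by split; [apply/cvg_ex; eexists; exact: H|exact: cvg_lim].
  apply: cvg_near_cst; near=> h; rewrite /= linD linZ addrK [_ *: _]mulKf//.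
  by near: h; exact: nbhs_dnbhs_neq.
- by move=> V W x; exact: is_derive_cst.
Unshelve. all: by end_near. Qed.

Lemma C2_add f df d2f g dg d2g : C2 f df d2f -> C2 g dg d2g ->
  C2 (fun x => f x + g x) (fun V x => df V x + dg V x)
     (fun V W x => d2f V W x + d2g V W x).
Proof.
move=> [f1 f2 f3 f4 f5] [g1 g2 g3 g4 g5]; split.
- by move=> V x; exact: (is_deriveD (f1 V x) (g1 V x)).
- by move=> V W x; exact: (is_deriveD (f2 V W x) (g2 V W x)).
- by move=> x; exact: (cvgD (f3 x) (g3 x)).
- by move=> V x; exact: (cvgD (f4 V x) (g4 V x)).
- by move=> V W x; exact: (cvgD (f5 V W x) (g5 V W x)).
Qed.

Lemma C2_mul f df d2f g dg d2g : C2 f df d2f -> C2 g dg d2g ->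
  C2 (fun x => f x * g x) (fun V x => f x * dg V x + g x * df V x)
     (fun V W x => (f x * d2g V W x + dg V x * df W x) +
                   (g x * d2f V W x + df V x * dg W x)).
Proof.
move=> [f1 f2 f3 f4 f5] [g1 g2 g3 g4 g5]; split.
- by move=> V x; exact: (is_deriveM (f1 V x) (g1 V x)).
- move=> V W x.
  exact: (is_deriveD (is_deriveM (f1 W x) (g2 V W x)) (is_deriveM (g1 W x) (f2 V W x))).
- by move=> x; exact: (cvgM (f3 x) (g3 x)).
- move=> V x.
  exact: (cvgD (cvgM (f3 x) (g4 V x)) (cvgM (g3 x) (f4 V x))).
- move=> V W x.
  exact: (cvgD (cvgD (cvgM (f3 x) (g5 V W x)) (cvgM (g4 V x) (f4 W x)))
               (cvgD (cvgM (g3 x) (f5 V W x)) (cvgM (f4 V x) (g4 W x)))).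
Qed.

Lemma C2_comp (p p1 p2 : R -> R) f df d2f :
  (forall t : R, is_derive t 1 p (p1 t)) -> (forall t : R, is_derive t 1 p1 (p2 t)) ->
  continuous p2 -> C2 f df d2f ->
  C2 (fun x => p (f x)) (fun V x => p1 (f x) * df V x)
     (fun V W x => p1 (f x) * d2f V W x + df V x * (p2 (f x) * df W x)).
Proof.
have cd (q q1 : R -> R) : (forall t : R, is_derive t 1 q (q1 t)) -> continuous q.
  move=> H t; apply: differentiable_continuous; apply/derivable1_diffP.
  by have [] := H t.
move=> H1 H2 H3 [f1 f2 f3 f4 f5].
have cc (q : R -> R) : continuous q -> continuous (fun x => q (f x)).
  by move=> cq x; apply: (@continuous_comp _ _ _ f q); [exact: f3|exact: cq].
split.
- by move=> V x; exact: is_derive_comp1.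
- move=> V W x.
  have := is_deriveM (is_derive_comp1 (H2 (f x)) (f1 W x)) (f2 V W x).
  by [].
- exact/cc/(cd _ _ H1).
- by move=> V x; exact: (cvgM (cc _ (cd _ _ H2) x) (f4 V x)).
- move=> V W x.
  exact: (cvgD (cvgM (cc _ (cd _ _ H2) x) (f5 V W x))
               (cvgM (f4 V x) (cvgM (cc _ H3 x) (f4 W x)))).
Qed.

Lemma C2_sum (I : Type) (s : seq I) (F : I -> E -> R) dF d2F :
  (forall i, C2 (F i) (dF i) (d2F i)) ->
  C2 (fun x => \sum_(i <- s) F i x) (fun V x => \sum_(i <- s) dF i V x)
     (fun V W x => \sum_(i <- s) d2F i V W x).
Proof.
move=> H; elim: s => [|i s IH].
  have := C2_cst 0; congr C2.
  - by apply/funext => x; rewrite big_nil.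
  - by apply/funext => V; apply/funext => x; rewrite big_nil.
  - by apply/funext => V; apply/funext => W; apply/funext => x; rewrite big_nil.
have := C2_add (H i) IH; congr C2.
- by apply/funext => x; rewrite big_cons.
- by apply/funext => V; apply/funext => x; rewrite big_cons.
- by apply/funext => V; apply/funext => W; apply/funext => x; rewrite big_cons.
Qed.

End C2Functions.

Section Domain.
Context {R : realType} {n : nat}.
Local Notation E := 'rV[R]_n.
Implicit Types (x V W : E) (f g : E -> R).

Lemma simplex_le1 x i : simplex x -> x ord0 i <= 1.
Proof.
by move=> [x0 <-]; rewrite (bigD1 i)//= lerDl sumr_ge0.
Qed.

Lemma continuous_bounded_simplex f : continuous f ->
  exists2 M, 0 < M & forall x, simplex x -> `|f x| <= M.
Proof.
move=> cf; pose cube : set E := [set v : E | forall i, `[0 : R, 1]%classic (v ord0 i)].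
have cc : compact cube.
  exact: (@rV_compact R n (fun=> `[0 : R, 1]%classic) (fun=> @segment_compact R 0 1)).
have cube0 : cube !=set0.
  by exists 0 => i; rewrite /= in_itv /= mxE lexx ler01.
have cn : {within cube, continuous (fun x => `|f x|)}.
  by apply: continuous_subspaceT => x; exact: (cvg_norm (cf x)).
have [c _ Hc] := EVT_max_rV cube0 cc cn.
exists (1 + `|f c|) => [|x xS]; first by rewrite ltr_pwDl.
rewrite (le_trans (Hc x _)) ?lerDr//; rewrite inE => i /=.
by rewrite in_itv /= simplex_le1// andbT; case: xS.
Qed.

(** Mixing [x] with the barycentre, with a small weight [t], makes every coordinate positive. *)
Lemma closure_simplex_int x : simplex x -> closure simplex_int x.
Proof.
move=> xS B /nbhs_ballP[e /= e0 Be].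
have n0 : (0 < n)%N.
  case: n x xS {B Be} => // x [_]; rewrite big_ord0 => /esym/eqP.
  by rewrite oner_eq0.
pose t : R := Num.min (2^-1) (e / 2).
have t0 : 0 < t by rewrite /t lt_min invr_gt0 ltr0n divr_gt0.
have t1 : t < 1 by rewrite /t gt_min invf_lt1 ?ltr1n.
have te : t < e by rewrite /t gt_min ltr_pdivrMr// ltr_pMr ?ltr1n// orbT.
pose y : E := \row_i ((1 - t) * x ord0 i + t * n%:R^-1).
have n1 : 0 < (n%:R^-1 : R) by rewrite invr_gt0 ltr0n.
have [x0 x1] := xS.
exists y; split; last first.
  apply: Be; split=> // i j; rewrite /ball /= ord1 mxE.
  have -> : x ord0 j - ((1 - t) * x ord0 j + t * n%:R^-1) = t * (x ord0 j - n%:R^-1) by ring.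
  rewrite normrM (gtr0_norm t0) (le_lt_trans _ te)// ler_piMr ?(ltW t0)//.
  have := simplex_le1 j xS; have := x0 j.
  have : (n%:R^-1 : R) <= 1 by rewrite invf_le1 ?ltr0n// ler1n.
  by rewrite ler_norml => *; apply/andP; split; lra.
have y0 i : 0 < y ord0 i.
  by rewrite mxE ltr_wpDl// ?mulr_gt0// mulr_ge0// subr_ge0 ltW.
split=> //; split=> [i|]; first exact: ltW.
rewrite (eq_bigr (fun i => (1 - t) * x ord0 i + t * n%:R^-1)) => [|i _]; last by rewrite mxE.
rewrite big_split /= -mulr_sumr x1 sumr_const card_ord mulr1.
by rewrite -[_ *+ n]mulr_natr -mulrA mulVf ?mulr1 ?subrK// pnatr_eq0 -lt0n.
Qed.

Lemma nabla_within x V f (df : E -> R) : simplex x -> continuous df ->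
  (forall y, simplex_int y -> 'D_V f y = df y) -> nabla V f x = df x.
Proof.
move=> xS cdf H; rewrite /nabla.
have pf : ProperFilter (within simplex_int (nbhs x)).
  exact/within_nbhs_proper/closure_simplex_int.
apply: cvg_lim => //.
have H2 : df y @[y --> within simplex_int (nbhs x)] --> df x.
  exact: (cvg_trans (cvg_app df (@cvg_within _ _ _ _)) (cdf x)).
apply: cvg_trans H2; apply: near_eq_cvg.
by apply: filterS (withinT _ _) => y yS; rewrite H.
Qed.

Lemma nabla_C2 x V f df d2f : C2 f df d2f -> simplex x -> nabla V f x = df V x.
Proof.
move=> [f1 _ _ f4 _] xS; apply: nabla_within => // y _.
by have [_ ->] := f1 V y.
Qed.

Lemma simplex_line x V : simplex_int x -> tangent V ->
  \forall h \near (0 : R), simplex (h *: V + x).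
Proof.
move=> [[x0 x1] xp] V0.
have H : \forall h \near (0 : R), forall i, 0 < (h *: V + x) ord0 i.
  apply: (@filter_forall R 'I_n (fun i h => 0 < (h *: V + x) ord0 i) (nbhs (0 : R)) (nbhs_filter _)) => i.
  have c : {for (0:R), continuous (fun h : R => h * V ord0 i + x ord0 i)}.
    apply: cvgD; last exact: cvg_cst.
    by apply: cvgMr_tmp; exact: cvg_id.
  have := c; rewrite /prop_for /continuous_at mul0r add0r => /cvgr_gt/(_ 0 (xp i)).
  by apply: filterS => h; rewrite !mxE.
apply: filterS H => h H; split=> [i|]; first exact: ltW.
rewrite (eq_bigr (fun i => h * V ord0 i + x ord0 i)) => [|i _]; last by rewrite !mxE.
by rewrite big_split /= -mulr_sumr V0 mulr0 add0r.
Qed.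

Lemma nabla2_C2 x V f df d2f : C2 f df d2f -> simplex x -> tangent V ->
  nabla V (nabla V f) x = d2f V V x.
Proof.
move=> Cf xS V0; have [_ f2 _ _ f5] := Cf; apply: nabla_within => // y yS.
have [_ <-] := f2 V V y; rewrite /derive; congr (lim _).
(* [nabla V f] is known to equal [df V] on the simplex only; the line through an interior point in a
   tangent direction stays there for small h. *)
have H : \forall h \near (0:R)^',
   h^-1 *: ((nabla V f \o shift y) (h *: V) - nabla V f y) =
   h^-1 *: ((df V \o shift y) (h *: V) - df V y).
  apply: nbhs_dnbhs; apply: filterS (simplex_line yS V0) => h hS /=.
  by rewrite !(nabla_C2 _ Cf)//; case: yS.
rewrite eqEsubset; split; apply: near_eq_cvg => //.
by apply: filterS H => h ->.
Qed.

Lemma tangent_unitB (i j : 'I_n) : tangent (unit_vec i - unit_vec j : E).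
Proof.
rewrite /tangent /=; under eq_bigr do rewrite !mxE /=.
rewrite big_split /= sumrN.
have H (k : 'I_n) : \sum_l (l == k)%:R = 1 :> R.
  by rewrite (bigD1 k)//= eqxx big1 ?addr0// => l /negbTE ->.
by rewrite !H subrr.
Qed.

(* As [0^-1 = 0], the terms with [x_i = 0] vanish, as they do in [gen]. *)
Definition gen2 (r : 'I_n -> 'I_n -> R) (m : 'I_n -> R) (b : R)
    (df : E -> E -> R) (d2f : E -> E -> E -> R) (x : E) : R :=
  \sum_i b * (m i / x ord0 i) * df (drift_dir r i) x +
  2^-1 * \sum_i \sum_j m i * r i j *
    d2f (unit_vec i - unit_vec j) (unit_vec i - unit_vec j) x.

(** If the derivative along [drift_dir r i] vanishes for x_i < c, then m_i / x_i may be replaced by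
    m_i / max(x_i, c), which is continuous. This is how the test functions below enter [dom_S]. *)
Lemma dom_C2 r m b f df d2f : C2 f df d2f ->
  (forall i, exists2 c, 0 < c &
     forall x, simplex x -> x ord0 i < c -> df (drift_dir r i) x = 0) ->
  [/\ dom_S r m b f, forall x, simplex x -> gen r m b f x = gen2 r m b df d2f x
  & exists2 g : E -> R, continuous g & forall x, simplex x -> gen r m b f x = g x].
Proof.
move=> Cf Hc; have [f1 f2 f3 f4 f5] := Cf.
have Df V : 'D_V f = df V by apply/funext => x; have [] := f1 V x.
have Ddf V W : 'D_W (df V) = d2f V W by apply/funext => x; have [] := f2 V W x.
have C1f : C1_int f.
  move=> V _; split=> [x _|]; first by have [] := f1 V x.
  by rewrite Df; apply: continuous_subspaceT.
have C1df W : C1_int ('D_W f).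
  rewrite Df => V _; split=> [x _|]; first by have [] := f2 W V x.
  by rewrite Ddf; apply: continuous_subspaceT.
have [|c Hc'] := @choice _ _ (fun i (c : R) => 0 < c /\
    forall x, simplex x -> x ord0 i < c -> df (drift_dir r i) x = 0).
  move=> i; by have [c ? ?] := Hc i; exists c.
pose nb i x : R := b * (m i / Num.max (x ord0 i) (c i) * df (drift_dir r i) x).
have nbc i : continuous (nb i).
  apply: ctsM; first exact: cts_cst.
  apply: ctsM => //; apply: ctsM; first exact: cts_cst.
  apply: ctsV => [x|]; first by rewrite gt_eqF// lt_max (Hc' i).1 orbT.
  by apply: cts_max; [exact: cts_coord|exact: cts_cst].
have nbE i x : simplex x -> nabla_b r m b i f x = nb i x.
  move=> xS; rewrite /nabla_b /nb (nabla_C2 _ Cf)//.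
  have [ci Hci] := Hc' i.
  have [xc|xc] := ltP (x ord0 i) (c i).
    by rewrite Hci// !mulr0; case: ifP; rewrite ?mulr0.
  by rewrite (lt_le_trans ci xc).
have nbE2 i x : simplex x -> nabla_b r m b i f x =
    b * (m i / x ord0 i) * df (drift_dir r i) x.
  move=> xS; rewrite /nabla_b (nabla_C2 _ Cf)//.
  case: ifPn => [_|]; first by rewrite !mulrA.
  rewrite -leNgt => xi; have [/(_ i) xi0 _] := xS.
  by rewrite (_ : x ord0 i = 0) ?invr0 ?(mulr0, mul0r)//; apply/eqP; rewrite eq_le xi.
have n2 i j x : simplex x ->
    nabla (unit_vec i - unit_vec j) (nabla (unit_vec i - unit_vec j) f) x =
    d2f (unit_vec i - unit_vec j) (unit_vec i - unit_vec j) x.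
  by move=> xS; rewrite (nabla2_C2 Cf)//; exact: tangent_unitB.
split.
- split.
    split=> //.
    + split=> //; first exact: continuous_subspaceT.
      move=> V _; exists (df V); split; first exact: continuous_subspaceT.
      by move=> x _; have [_ ->] := f1 V x.
    + move=> V W _ _; exists (d2f W V); split; first exact: continuous_subspaceT.
      by move=> x _; rewrite Df; have [_ ->] := f2 W V x.
  move=> i; apply: (@subspace_eq_continuous _ _ _ (nb i)).
    by move=> x; rewrite inE => xS; exact: esym (nbE i x xS).
  exact: continuous_subspaceT.
- move=> x xS; rewrite /gen /gen2; congr (_ + _ * _).
    by apply: eq_bigr => i _; rewrite nbE2.
  by apply: eq_bigr => i _; apply: eq_bigr => j _; rewrite n2.
- exists (fun x => \sum_i nb i x + 2^-1 * \sum_i \sum_j m i * r i j *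
    d2f (unit_vec i - unit_vec j) (unit_vec i - unit_vec j) x).
    apply: ctsD; first exact: continuous_bigsum.
    apply: ctsM; first exact: cts_cst.
    apply: continuous_bigsum => i; apply: continuous_bigsum => j.
    by apply: ctsM => //; exact: cts_cst.
  move=> x xS; rewrite /gen; congr (_ + _ * _).
    by apply: eq_bigr => i _; rewrite nbE.
  by apply: eq_bigr => i _; apply: eq_bigr => j _; rewrite n2.
Qed.

End Domain.

(** * The Dirichlet problem of the chain *)

Section Chain.
Context {R : realType} {n : nat}.
Variable r : 'I_n -> 'I_n -> R.
Hypothesis r0 : forall i j, 0 <= r i j.
Hypothesis irr : irreducible_rate r.
Implicit Types (h f rho : 'I_n -> R) (A C : {set 'I_n}).

Definition Lr h i : R := \sum_j r i j * (h j - h i).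

Lemma lin_unitB h i j : lin h (unit_vec i - unit_vec j) = h i - h j.
Proof.
rewrite /lin; under eq_bigr do rewrite !mxE /= mulrBr.
have H (k : 'I_n) : \sum_l h l * (l == k)%:R = h k.
  by rewrite (bigD1 k)//= eqxx mulr1 big1 ?addr0// => l /negbTE ->; rewrite mulr0.
by rewrite big_split /= sumrN !H.
Qed.

Lemma lin_drift h i : lin h (drift_dir r i) = Lr h i.
Proof.
rewrite /drift_dir /Lr.
have H (s : seq 'I_n) :
  lin h (\sum_(j <- s) r i j *: (unit_vec j - unit_vec i)) =
  \sum_(j <- s) r i j * (h j - h i).
  elim: s => [|j s IH]; last by rewrite !big_cons linD linZ lin_unitB IH.
  by rewrite !big_nil /lin big1// => k _; rewrite mxE mulr0.
exact: H.
Qed.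

Lemma finite_lower_bound (I : finType) (f : I -> R) :
  (forall i, 0 < f i) -> exists2 c, 0 < c & forall i, c <= f i.
Proof.
move=> f0; exists (\big[Num.min/1]_i f i).
  by elim/big_ind : _ => // x y x0 y0; rewrite lt_min x0.
by move=> i; exact: bigmin_le_cond.
Qed.

Lemma finite_upper_bound (I : finType) (f : I -> R) :
  exists2 K, 0 < K & forall i, f i <= K.
Proof.
exists (1 + \sum_i `|f i|); first by rewrite ltr_pwDl// sumr_ge0.
move=> i; rewrite (bigD1 i)//= addrA (le_trans (ler_norm _))//.
by rewrite addrAC lerDr addr_ge0// sumr_ge0.
Qed.

(** Where a negative minimum is attained, [Lr h <= 0] forces all neighbours to the same value, and
    irreducibility carries this value outside [C]. *)
Lemma minimum_principle C h : C != finset.setT ->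
  (forall i, i \notin C -> 0 <= h i) -> (forall i, i \in C -> Lr h i <= 0) ->
  forall i, 0 <= h i.
Proof.
move=> CT hC LC i.
have [i0 i0C] : exists i0, i0 \notin C.
  by apply/existsP; apply: contraR CT => /existsPn H; apply/eqP/setP => j;
     rewrite inE; apply/negbNE.
have [i1 _ i1min] : exists2 i1 : 'I_n, true & forall j, h i1 <= h j.
  by case: (@arg_minP _ _ _ i predT h isT) => i1 _ H; exists i1 => // j; exact: H.
rewrite (le_trans _ (i1min i))//; rewrite leNgt; apply/negP => hneg.
have step k l : h k = h i1 -> 0 < r k l -> h l = h i1.
  move=> hk rkl.
  have kC : k \in C by apply: contraLR hneg => kC; rewrite -hk -leNgt hC.
  have terms j : 0 <= r k j * (h j - h k).
    by rewrite mulr_ge0// subr_ge0 hk.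
  have : \sum_j r k j * (h j - h k) == 0.
    by rewrite eq_le LC//= sumr_ge0.
  rewrite psumr_eq0// => /allP/(_ l (mem_index_enum _))/=.
  by rewrite mulf_eq0 gt_eqF//= subr_eq0 hk => /eqP.
have /connectP[p] := irr i1 i0.
have : h i1 = h i1 by [].
move: {1 3 4}i1 => k; elim: p k => [|l p IH] k hk /=.
  by move=> _ e; move: hneg; rewrite -hk -e ltNge hC.
move=> /andP[rkl pth] e.
by apply: (IH l (step _ _ hk rkl)).
Qed.

(** The linear system is square, and the minimum principle applied to u and to -u shows that its
    kernel is trivial. *)
Lemma dirichlet C f rho : C != finset.setT -> exists h,
  (forall i, i \notin C -> h i = f i) /\ (forall i, i \in C -> Lr h i = rho i).
Proof.
move=> CT.
pose M : 'M[R]_n := \matrix_(j, i)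
  (if i \in C then r i j - (i == j)%:R * \sum_k r i k else (i == j)%:R).
have ME (u : 'rV_n) i : (u *m M) ord0 i =
    if i \in C then Lr (u ord0) i else u ord0 i.
  have S (a : 'I_n -> R) : \sum_j a j * (i == j)%:R = a i.
    rewrite (bigD1 i)//= eqxx mulr1 big1 ?addr0// => j.
    by rewrite eq_sym => /negbTE ->; rewrite mulr0.
  rewrite mxE; under eq_bigr do rewrite mxE.
  case: ifPn => iC; last exact: S.
  rewrite /Lr (eq_bigr (fun j => u ord0 j * r i j -
     (u ord0 j * \sum_k r i k) * (i == j)%:R)) => [|j _]; last by ring.
  rewrite sumrB S mulr_sumr -sumrB; apply: eq_bigr => j _; ring.
have Mu : M \in unitmx.
  rewrite -row_free_unit -kermx_eq0; apply/rowV0P => u /sub_kermxP uM.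
  have uE i : (if i \in C then Lr (u ord0) i else u ord0 i) = 0.
    by rewrite -ME uM mxE.
  have u1 : forall i, 0 <= u ord0 i.
    apply: (minimum_principle CT) => i iC; have := uE i.
      by rewrite (negbTE iC) => ->.
    by rewrite iC => ->.
  have u2 : forall i, 0 <= - u ord0 i.
    apply: (@minimum_principle C (fun i => - u ord0 i)) => // i iC; have := uE i.
      by rewrite (negbTE iC) => ->; rewrite oppr0.
    rewrite iC => e; rewrite /Lr; under eq_bigr do rewrite -opprD mulrN.
    by rewrite sumrN -/(Lr (u ord0) i) e oppr0.
  apply/rowP => i; rewrite mxE; apply/eqP; rewrite eq_le u1 andbT.
  by rewrite -oppr_ge0.
pose v : 'rV[R]_n := \row_i (if i \in C then rho i else f i).
exists ((v *m invmx M) ord0); split=> i iC;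
  have := ME (v *m invmx M) i; rewrite mulmxKV// mxE.
  by rewrite (negbTE iC).
by rewrite iC.
Qed.

(** A zero of [h] in [C] would be a minimum, where [Lr h] is nonnegative. *)
Lemma superharmonic_gt0 C h : C != finset.setT ->
  (forall i, i \notin C -> 0 <= h i) -> (forall i, i \in C -> Lr h i < 0) ->
  forall i, i \in C -> 0 < h i.
Proof.
move=> CT hC LC i iC.
have h0 : forall i, 0 <= h i.
  by apply: (minimum_principle CT) => // j jC; rewrite ltW// LC.
rewrite lt_neqAle h0 andbT; apply/eqP => hi.
have := LC _ iC; rewrite ltNge => /negP; apply.
by apply: sumr_ge0 => j _; rewrite -hi subr0 mulr_ge0.
Qed.

Lemma LrB h f i : Lr (fun j => h j - f j) i = Lr h i - Lr f i.
Proof. by rewrite /Lr -sumrB; apply: eq_bigr => j _; ring. Qed.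

(* [g C] is the expected hitting time of the complement of [A], made harmonic
   on [C]: this is the function [u] of the simplex with the sites of [C]
   traced out. *)
Lemma trace_family A : A != finset.setT -> exists g : {set 'I_n} -> 'I_n -> R,
  exists c K : R, [/\ 0 < c, 0 < K &
  forall C, C \subset A ->
  [/\ forall i, 0 <= g C i <= K, forall i, i \notin A -> g C i = 0,
      forall i, i \in A :\: C -> c <= g C i
    & [/\ forall i, i \in C -> Lr (g C) i = 0,
      forall i, i \in A :\: C -> Lr (g C) i <= -1,
      forall j, j \in C -> forall i, g C i + c * (i == j)%:R <= g (C :\ j) i
    & (forall i, i \notin C -> g C i = g finset.set0 i) /\
      (forall i, g C i <= g finset.set0 i)]]].
Proof.
move=> AT.
have [g0 [g0A Lg0]] := @dirichlet A (fun=> 0) (fun=> -1) AT.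
have CT C : C \subset A -> C != finset.setT.
  by move=> CA; apply: contra AT => /eqP e; move: CA; rewrite e finset.subTset.
have [g Hg] := @choice _ _ (fun (C : {set 'I_n}) h => C \subset A ->
   (forall i, i \notin C -> h i = g0 i) /\ (forall i, i \in C -> Lr h i = 0))
  (fun C => match boolP (C \subset A) with
    | AltTrue CA => let: ex_intro h Hh := @dirichlet C g0 (fun=> 0) (CT C CA)
                    in ex_intro _ h (fun=> Hh)
    | AltFalse CA => ex_intro _ g0 (fun H => False_ind _ (negP CA H)) end).
have g0_ge0 : forall i, 0 <= g0 i.
  apply: (minimum_principle AT) => i iA; first by rewrite g0A.
  by rewrite Lg0// lerN10.
have g0_gt0 : forall i, i \in A -> 0 < g0 i.
  apply: (superharmonic_gt0 AT) => i iA; first by rewrite g0A.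
  by rewrite Lg0// ltrN10.
have g_ge0 C : C \subset A -> forall i, 0 <= g C i.
  move=> CA; have [g1 g2] := Hg C CA.
  apply: (minimum_principle (CT _ CA)) => i iC; first by rewrite g1.
  by rewrite g2.
have g_le C : C \subset A -> forall i, i \in C -> 0 < g0 i - g C i.
  move=> CA; have [g1 g2] := Hg C CA.
  apply: (superharmonic_gt0 (h := fun i => g0 i - g C i) (CT _ CA)) => i iC.
    by rewrite g1// subrr.
  by rewrite LrB g2// subr0 Lg0 ?ltrN10// (fintype.subsetP CA).
have [K K0 HK] := finite_upper_bound g0.
(* [c1] bounds the exit time from below on [A], [c2] the gain at [j] when [j] is removed from [C];
   both are minima over finite sets. *)
have [|c1 c10 Hc1] := @finite_lower_bound _ (fun i => if i \in A then g0 i else 1).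
  by move=> i; case: ifP => // iA; exact: g0_gt0.
have [|c2 c20 Hc2] := @finite_lower_bound _ (fun p : {set 'I_n} * 'I_n =>
     if (p.1 \subset A) && (p.2 \in p.1) then g0 p.2 - g p.1 p.2 else 1).
  by move=> p; case: ifP => // /andP[pA p2]; exact: g_le.
exists g, (Num.min c1 c2), K; split=> //; first by rewrite lt_min c10.
move=> C CA; have [g1 g2] := Hg C CA.
have [s1 s2] := Hg finset.set0 (finset.sub0set _).
have gle i : g C i <= g0 i.
  have [iC|iC] := boolP (i \in C); first by rewrite -subr_ge0 ltW// g_le.
  by rewrite g1.
split.
- by move=> i; rewrite g_ge0//= (le_trans (gle i)).
- move=> i iA; rewrite g1 ?g0A//.
  by apply: contra iA => /(fintype.subsetP CA).
- move=> i; rewrite inE => /andP[iC iA]; rewrite g1//.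
  by have := Hc1 i; rewrite iA; apply: le_trans; rewrite ge_min lexx.
- split=> //.
  (* At [i] the value is that of [g0], while the other values are at most those of [g0]: the
     generator can only decrease. *)
  + move=> i; rewrite inE => /andP[iC iA].
    rewrite -(Lg0 _ iA); apply: ler_sum => j _; apply: ler_wpM2l => //.
    by rewrite (g1 i)// lerB.
  + move=> j jC.
    have DA : C :\ j \subset A by apply: fintype.subset_trans CA; exact: finset.subsetDl.
    have [d1 d2] := Hg _ DA.
    have cj : Num.min c1 c2 <= g0 j - g C j.
      have := Hc2 (C, j); rewrite /= CA jC /=; apply: le_trans.
      by rewrite ge_min lexx orbT.
    have dj : g (C :\ j) j = g0 j by rewrite d1// !inE eqxx.
    (* The difference is harmonic on [C :\ j] and nonnegative elsewhere. *)
    have dge : forall i, 0 <= g (C :\ j) i - g C i.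
      apply: (minimum_principle (h := fun i => g (C :\ j) i - g C i) (CT _ DA)) => i iD.
        have [->|ij] := eqVneq i j.
          by rewrite dj subr_ge0.
        have iC : i \notin C by move: iD; rewrite !inE ij.
        by rewrite d1// g1// subrr.
      rewrite LrB d2// g2 ?subr0//.
      by move: iD; rewrite inE => /andP[].
    move=> i; have [->|ij] := eqVneq i j.
      by rewrite mulr1 dj -lerBrDl.
    by rewrite mulr0 addr0 -subr_ge0.
  + by split=> [i iC|i]; [rewrite g1// s1// inE|rewrite s1// inE].
Qed.

(** These functions build the localization: [lin h] dominates x_k on the simplex and, [h] being
    harmonic on [A], it has no derivative along the drift at the sites of [A]. *)
Lemma harmonic_coord A k : A != finset.setT -> k \notin A -> exists h,
  [/\ forall i, 0 <= h i, h k = 1, forall i, i \notin A -> i != k -> h i = 0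
    & forall i, i \in A -> Lr h i = 0].
Proof.
move=> AT kA.
have [h [h1 h2]] := @dirichlet A (fun i => (i == k)%:R) (fun=> 0) AT.
exists h; split=> //.
- apply: (minimum_principle AT) => i iA; first by rewrite h1// ler0n.
  by rewrite h2.
- by rewrite h1// eqxx.
- by move=> i iA /negbTE ik; rewrite h1// ik.
Qed.

Variable m : 'I_n -> R.
Hypothesis st : is_stationary r m.

(** By stationarity a zero of [m] propagates backwards along positive rates, hence everywhere,
    against the total mass 1. *)
Lemma stationary_gt0 i : 0 < m i.
Proof.
have [m0 m1 mr] := st.
rewrite lt_neqAle m0 andbT; apply/negP => /eqP mi.
suff H j : m j = 0.
  by move: m1; under eq_bigr do rewrite H; rewrite big1// => /esym/eqP; rewrite oner_eq0.
have step k l : 0 < r k l -> m l = 0 -> m k = 0.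
  move=> rkl ml.
  have : \sum_i m i * r i l == 0 by rewrite mr ml mul0r.
  rewrite psumr_eq0 => [|a _]; last by rewrite mulr_ge0.
  move=> /allP/(_ k (mem_index_enum _))/=.
  by rewrite mulf_eq0 (gt_eqF rkl) orbF => /eqP.
have /connectP[p] := irr j i.
elim: p j => [|l p IH] j /=; first by move=> _ <-.
by move=> /andP[rjl pth] e; apply: (step _ _ rjl); exact: IH.
Qed.

(** Stationarity equates the sums of m_i r_ij h_j^2 and of m_i r_ij h_i^2. The right-hand side has
    no term at the sites where [h] vanishes or is harmonic. *)
Lemma dirichlet_form h :
  2^-1 * \sum_i \sum_j m i * r i j * (h i - h j) ^+ 2 = - \sum_i m i * h i * Lr h i.
Proof.
have [m0 m1 mr] := st.
have E : \sum_i \sum_j m i * r i j * h j ^+ 2 = \sum_i \sum_j m i * r i j * h i ^+ 2.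
  rewrite exchange_big /=; apply: eq_bigr => j _.
  by rewrite -!mulr_suml mr mulr_sumr.
rewrite -sumrN.
rewrite [RHS](_ : _ = \sum_i \sum_j m i * r i j * h i ^+ 2 -
    \sum_i \sum_j m i * r i j * (h i * h j)); last first.
  rewrite -sumrB; apply: eq_bigr => i _; rewrite -sumrB /Lr mulr_sumr -sumrN.
  by apply: eq_bigr => j _; ring.
rewrite [X in _ * X](_ : _ = \sum_i \sum_j m i * r i j * h i ^+ 2 +
   \sum_i \sum_j m i * r i j * h j ^+ 2 -
    2 * \sum_i \sum_j m i * r i j * (h i * h j)); last first.
  rewrite mulr_sumr -big_split -sumrB /=; apply: eq_bigr => i _.
  rewrite mulr_sumr -big_split -sumrB /=; apply: eq_bigr => j _; ring.
by rewrite E; field.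
Qed.

End Chain.

(** * Smooth maximum *)

Section SmoothPositivePart.
Context {R : realType}.
Implicit Types t : R.

(* A C2 version of [fun t => Num.max t 0], exact outside [-1, 1]: its second
   derivative is the hat function. *)
Definition sp t : R :=
  6^-1 * (pospow 3 (t + 1) + - 2 * pospow 3 t + pospow 3 (t - 1)).
Definition sp1 t : R :=
  2^-1 * (pospow 2 (t + 1) + - 2 * pospow 2 t + pospow 2 (t - 1)).
Definition sp2 t : R := pospow 1 (t + 1) + - 2 * pospow 1 t + pospow 1 (t - 1).

Lemma is_derive_pospow_shift k (c : R) t :
  is_derive t 1 (fun t => pospow k.+2 (t + c)) (k.+2%:R * pospow k.+1 (t + c)).
Proof.
have := @is_derive1_comp _ (pospow k.+2) (fun t => t + c) t _ _
  (is_derive_pospow k (t + c)) (is_derive_eq (is_deriveD (is_derive_id t 1) (is_derive_cst c t 1)) (addr0 1)).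
by rewrite mulr1.
Qed.

Lemma is_derive_sp_gen k (a : R) t : is_derive t 1
  (fun t => a * (pospow k.+2 (t + 1) + - 2 * pospow k.+2 t + pospow k.+2 (t - 1)))
  (a * k.+2%:R * (pospow k.+1 (t + 1) + - 2 * pospow k.+1 t + pospow k.+1 (t - 1))).
Proof.
have H := is_deriveZ a (is_deriveD (is_deriveD (is_derive_pospow_shift k 1 t)
  (is_deriveZ (- 2) (is_derive_pospow k t))) (is_derive_pospow_shift k (- 1) t)).
apply: (is_derive_eq H).
rewrite -![_ *: _]/(_ * _); ring.
Qed.

Lemma is_derive_sp t : is_derive t 1 sp (sp1 t).
Proof.
apply: (is_derive_eq (is_derive_sp_gen 1 6^-1 t)); rewrite /sp1.
by congr (_ * _); field.
Qed.

Lemma is_derive_sp1 t : is_derive t 1 sp1 (sp2 t).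
Proof.
apply: (is_derive_eq (is_derive_sp_gen 0 2^-1 t)).
by rewrite mulVf ?mul1r// pnatr_eq0.
Qed.

Lemma continuous_sp2 : continuous sp2.
Proof.
have H (c : R) : continuous (fun t => pospow 1 (t + c)).
  move=> t; apply: (@continuous_comp _ _ _ (fun t => t + c) (pospow 1)).
    by apply: ctsD; [move=> ?; exact: cvg_id|exact: cts_cst].
  exact: continuous_pospow.
apply: ctsD; last exact: H.
apply: ctsD; first exact: H.
by apply: ctsM; [exact: cts_cst|exact: continuous_pospow].
Qed.

Lemma sp_cases t :
  [\/ t <= -1 /\ [/\ sp t = 0, sp1 t = 0 & sp2 t = 0],
      -1 <= t <= 0 /\ [/\ sp t = (t + 1) ^+ 3 / 6, sp1 t = (t + 1) ^+ 2 / 2 & sp2 t = t + 1],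
      0 <= t <= 1 /\ [/\ sp t = t + (1 - t) ^+ 3 / 6, sp1 t = 1 - (1 - t) ^+ 2 / 2 & sp2 t = 1 - t]
    | 1 <= t /\ [/\ sp t = t, sp1 t = 1 & sp2 t = 0]].
Proof.
have [t1|t1] := leP t (-1).
  constructor 1; split=> //; rewrite /sp /sp1 /sp2 !pospow_le; try lra.
  by split; field.
have [t2|t2] := leP t 0.
  constructor 2; split; first by rewrite andbT ltW.
  rewrite /sp /sp1 /sp2 !(pospow_ge _ (_ : 0 <= t + 1)); try lra.
  by rewrite !(@pospow_le _ _ t) ?(@pospow_le _ _ (t - 1)); try lra; split; field.
have [t3|t3] := leP t 1.
  constructor 3; split; first by rewrite andbT ltW.
  rewrite /sp /sp1 /sp2 !(pospow_ge _ (_ : 0 <= t + 1)); try lra.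
  rewrite !(pospow_ge _ (_ : 0 <= t)); try lra.
  by rewrite !(@pospow_le _ _ (t - 1)); try lra; split; field.
constructor 4; split; first exact: ltW.
rewrite /sp /sp1 /sp2 !pospow_ge; try lra.
by split; field.
Qed.

Lemma sp1_itv t : 0 <= sp1 t <= 1.
Proof. by case: (sp_cases t) => -[h [_ -> _]]; nra. Qed.

Lemma sp2_itv t : 0 <= sp2 t <= 1.
Proof. by case: (sp_cases t) => -[h [_ _ ->]]; lra. Qed.

Lemma sp_ge t : Num.max t 0 <= sp t.
Proof.
rewrite ge_max; apply/andP; case: (sp_cases t) => -[h [-> _ _]]; split; try lra.
- have : 0 <= (t + 1) ^+ 3 by apply: exprn_ge0; lra.
  by lra.
- have : 0 <= (t + 1) ^+ 3 by apply: exprn_ge0; lra.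
  by lra.
- have : 0 <= (1 - t) ^+ 3 by apply: exprn_ge0; lra.
  by lra.
- have : 0 <= (1 - t) ^+ 3 by apply: exprn_ge0; lra.
  by lra.
Qed.

Lemma sp_le t : sp t <= Num.max t 0 + 1.
Proof.
have m1 : t <= Num.max t 0 by rewrite le_max lexx.
have m2 : 0 <= Num.max t 0 by rewrite le_max lexx orbT.
case: (sp_cases t) => -[h [-> _ _]]; [lra| | |lra].
- have : (t + 1) ^+ 3 <= 1 by apply: exprn_ile1; lra.
  by lra.
- have : (1 - t) ^+ 3 <= 1 by apply: exprn_ile1; lra.
  by lra.
Qed.

Lemma sp_le2 t : -1 < t -> sp t <= t + 2.
Proof.
move=> t1; rewrite (le_trans (sp_le _))// -lerBrDr ge_max.
by apply/andP; split; lra.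
Qed.

Lemma sp1_gt0 t : 0 < sp1 t -> -1 < t.
Proof. by case: (sp_cases t) => -[h [_ -> _]]; try lra; move=> ?; rewrite ltNge; apply/negP; nra. Qed.

Lemma sp1_lt1 t : sp1 t < 1 -> t < 1.
Proof. by case: (sp_cases t) => -[h [_ -> _]]; try lra; move=> ?; rewrite ltNge; apply/negP; nra. Qed.

Lemma sp2_neq0 t : sp2 t != 0 -> -1 < t < 1.
Proof.
case: (sp_cases t) => -[h [_ _ ->]]; rewrite ?eqxx// => /eqP h2; apply/andP; split;
  rewrite lt_neqAle; apply/andP; split; try lra; apply/eqP => e; apply: h2; lra.
Qed.

End SmoothPositivePart.

Section SmoothMax.
Context {R : realType} {n : nat}.
Local Notation E := 'rV[R]_n.
Implicit Types (x V W : E) (f : E -> R).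

Lemma C2_eq f df d2f (f' : E -> R) df' d2f' : C2 f df d2f ->
  (forall x, f x = f' x) -> (forall V x, df V x = df' V x) ->
  (forall V W x, d2f V W x = d2f' V W x) -> C2 f' df' d2f'.
Proof.
move=> Cf /funext <- H1 H2.
rewrite (_ : df' = df); last by apply/funext => V; apply/funext => x.
by rewrite (_ : d2f' = d2f)//; apply/funext => V; apply/funext => W; apply/funext => x.
Qed.

Lemma C2_scale (k : R) f df d2f : C2 f df d2f ->
  C2 (fun x => k * f x) (fun V x => k * df V x) (fun V W x => k * d2f V W x).
Proof.
by move=> Cf; apply: (C2_eq (C2_mul (C2_cst k) Cf)) => *; rewrite ?mul0r ?mulr0 ?addr0.
Qed.

Lemma C2_affine (a : 'I_n -> R) (k : R) :
  C2 (fun x => lin a x + k) (fun V _ => lin a V) (fun _ _ _ => 0).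
Proof. by apply: (C2_eq (C2_add (C2_lin a) (C2_cst k))) => *; rewrite ?addr0. Qed.

(** Iterates [f + t * sp ((a0 - f) / t)], a smooth maximum of two functions with error of order t.
    The weights [pi] exhibit the gradient as an average over nearly maximal indices; by the last
    clause, curvature requires two such indices. [K] is fixed before the scale and the offsets. *)
Lemma smooth_max (I : eqType) (s : seq I) (g : I -> 'I_n -> R) :
  s != [::] -> uniq s -> exists2 K : R, 0 < K &
  forall (t : R) (k : I -> R), 0 < t -> exists f df d2f, C2 f df d2f /\
  forall x, let a i := lin (g i) x + k i in let N V := \sum_(i <- s) `|lin (g i) V| in
  [/\ forall i, i \in s -> a i <= f x,
      exists2 i, i \in s & f x <= a i + K * t,
      exists pi : I -> R, [/\ forall i, 0 <= pi i, \sum_(i <- s) pi i = 1,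
         forall V, df V x = \sum_(i <- s) pi i * lin (g i) V
       & forall i, i \in s -> 0 < pi i -> f x <= a i + K * t],
      forall V W, `|d2f V W x| <= K / t * (N V * N W)
    & (forall i j, i \in s -> j \in s -> f x <= a i + K * t -> f x <= a j + K * t -> i = j) ->
      forall V W, d2f V W x = 0].
Proof.
elim: s => // i0 [_ _ _|i1 s' IH _ /andP[i0s us]].
  exists 1 => // t k t0.
  exists (fun x => lin (g i0) x + k i0), (fun V _ => lin (g i0) V), (fun _ _ _ => 0).
  split; first exact: C2_affine.
  move=> x a N; split.
  - by move=> i; rewrite inE => /eqP ->.
  - by exists i0; rewrite ?inE// lerDl mulr_ge0 ?ltW.
  - exists (fun=> 1); split=> //.
    + by rewrite big_seq1.
    + by move=> V; rewrite big_seq1 mul1r.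
    + by move=> i; rewrite inE => /eqP -> _; rewrite lerDl mulr_ge0 ?ltW.
  - by move=> V W; rewrite normr0 /N !big_seq1 !mulr_ge0// invr_ge0 ltW.
  - by [].
set s := i1 :: s' in IH i0s us *.
have [K K0 HK] := IH isT us.
exists (K + 2) => [|t k t0]; first by rewrite addr_gt0.
have [f [df [d2f [Cf Hf]]]] := HK t k t0.
pose a0 x := lin (g i0) x + k i0.
pose h x := t^-1 * (a0 x - f x).
pose dh V x := t^-1 * (lin (g i0) V - df V x).
have Ch : C2 h dh (fun V W x => - t^-1 * d2f V W x).
  apply: (C2_eq (C2_scale t^-1 (C2_add (C2_affine (g i0) (k i0)) (C2_scale (- 1) Cf)))) => *;
    rewrite /h /dh /a0; ring.
exists (fun x => f x + t * sp (h x)),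
  (fun V x => (1 - sp1 (h x)) * df V x + sp1 (h x) * lin (g i0) V),
  (fun V W x => (1 - sp1 (h x)) * d2f V W x +
     sp2 (h x) / t * ((lin (g i0) V - df V x) * (lin (g i0) W - df W x))).
split.
  apply: (C2_eq (C2_add Cf (C2_scale t
    (C2_comp is_derive_sp is_derive_sp1 continuous_sp2 Ch)))) => *;
    rewrite // /dh; field; exact: lt0r_neq0.
move=> x a N.
have [f1 [i2 i2s f2] [pi [pi0 pi1 pidf pif]] f4 f5] := Hf x.
set F := f x + t * sp (h x).
have ha : t * h x = a0 x - f x by rewrite /h mulrA mulfV ?mul1r// lt0r_neq0.
have Fge : f x <= F.
  by rewrite lerDl mulr_ge0 ?(ltW t0)// (le_trans _ (sp_ge _))// le_max lexx orbT.
have Fge0 : a0 x <= F.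
  rewrite -lerBlDl -ha ler_wpM2l ?(ltW t0)// (le_trans _ (sp_ge _))// le_max lexx//.
(* The old maximum matters only for h < 1 and the new function only for h > -1; in both cases the
   loss is at most 2 t, whence the increment of [K] by 2. *)
have Fle : h x < 1 -> F <= f x + 2 * t.
  move=> h1; rewrite lerD2l mulrC ler_wpM2r ?(ltW t0)// (le_trans (sp_le _))//.
  by have [_|_] := leP (h x) 0; lra.
have Fle0 : -1 < h x -> F <= a0 x + 2 * t.
  move=> h1; have h2 : sp (h x) <= h x + 2.
    exact: sp_le2.
  have -> : a0 x = f x + t * h x by rewrite ha addrC subrK.
  by rewrite /F -addrA lerD2l mulrC (mulrC t) -mulrDl ler_wpM2r ?(ltW t0).
have th := sp1_itv (h x).
have K2 : f x <= F + 0 -> K * t <= (K + 2) * t by nra.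
have dfN V : `|df V x| <= \sum_(i <- s) `|lin (g i) V|.
  rewrite pidf (le_trans (ler_norm_sum _ _ _))//.
  rewrite big_seq [leRHS]big_seq; apply: ler_sum => i iS.
  rewrite normrM ger0_norm// ler_piMl// -pi1 (big_rem i)//= lerDl sumr_ge0//.
have NE V : N V = `|lin (g i0) V| + \sum_(i <- s) `|lin (g i) V|.
  by rewrite /N big_cons.
have Ns0 V : 0 <= \sum_(i <- s) `|lin (g i) V| by exact: sumr_ge0.
split.
- by move=> i; rewrite inE => /orP[/eqP ->//|/f1]; move=> /le_trans; apply.
- have [h1|h1] := ltP (h x) 1.
    exists i2; first by rewrite inE i2s orbT.
    by rewrite (le_trans (Fle h1))// /a; nra.
  exists i0; first by rewrite inE eqxx.
  by rewrite (le_trans (Fle0 _)) ?(lt_le_trans _ h1)//; rewrite /a /a0; nra.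
- exists (fun i => if i == i0 then sp1 (h x) else (1 - sp1 (h x)) * pi i); split.
  + by case/andP: th => th1 th2 i; case: ifP => _ //; rewrite mulr_ge0// subr_ge0.
  + rewrite big_cons eqxx big_seq.
    rewrite (eq_bigr (fun i => (1 - sp1 (h x)) * pi i)) => [|i iS].
      by rewrite -big_seq -mulr_sumr pi1 mulr1 addrC subrK.
    by case: eqP => // e; move: i0s; rewrite -e iS.
  + move=> V; rewrite big_cons eqxx pidf mulr_sumr addrC; congr (_ + _).
    apply: eq_big_seq => i iS.
    by case: eqP => [e|_]; [move: i0s; rewrite -e iS|rewrite mulrA].
  + move=> i; rewrite inE; case: eqP => [-> _|_ /= iS].
      by move=> /sp1_gt0 /Fle0 /le_trans; apply; rewrite /a /a0; nra.
    move=> h1.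
    have h2 : sp1 (h x) < 1.
      by rewrite ltNge; apply/negP => h2; move: h1; have := pi0 i; nra.
    have h3 : 0 < pi i.
      by rewrite lt_neqAle pi0 andbT; apply/eqP => e; move: h1; rewrite -e mulr0 ltxx.
    rewrite (le_trans (Fle (sp1_lt1 h2)))//.
    by have := pif i iS h3; rewrite /a; nra.
- move=> V W.
  have e2 := sp2_itv (h x).
  have ti0 : 0 <= t^-1 by rewrite invr_ge0 ltW.
  have B1 : `|(1 - sp1 (h x)) * d2f V W x| <= K / t * (N V * N W).
    rewrite normrM; apply: (@le_trans _ _ (1 * `|d2f V W x|)).
      by case/andP: th => th1 th2; rewrite ler_wpM2r// ger0_norm ?subr_ge0// gerBl.
    rewrite mul1r (le_trans (f4 V W))// ler_wpM2l ?(ltW (divr_gt0 K0 t0))//.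
    by rewrite !NE ler_pM// lerDr.
  have B2 U : `|lin (g i0) U - df U x| <= N U.
    by rewrite NE (le_trans (ler_normB _ _))// lerD2l.
  have N0 U : 0 <= N U by exact: sumr_ge0.
  have B3 : `|sp2 (h x) / t * ((lin (g i0) V - df V x) * (lin (g i0) W - df W x))|
      <= 1 / t * (N V * N W).
    rewrite normrM ler_pM//; last by rewrite normrM ler_pM.
    rewrite normrM (ger0_norm ti0) ler_wpM2r// ger0_norm; by case/andP: e2.
  rewrite (le_trans (ler_normD _ _))// (le_trans (lerD B1 B3))//.
  by rewrite -mulrDl -mulrDl ler_wpM2r ?mulr_ge0// ler_wpM2r// lerD2l ler1n.
- move=> uq V W.
  have near i : i \in s -> h x < 1 -> f x <= lin (g i) x + k i + K * t -> F <= a i + (K + 2) * t.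
    by move=> iS h1 H; rewrite (le_trans (Fle h1))// /a; nra.
  (* If [sp2] is nonzero, then |h| < 1, so [i0] and [i2] are both nearly maximal. *)
  have -> : sp2 (h x) = 0.
    apply/eqP; apply: contraT => /sp2_neq0 /andP[h1 h2].
    have e : i0 = i2.
      apply: uq; [by rewrite inE eqxx|by rewrite inE i2s orbT| |exact: near].
      by rewrite (le_trans (Fle0 h1))// /a /a0; nra.
    by move: i0s; rewrite e i2s.
  rewrite mul0r mul0r addr0.
  have [h1|h1] := ltP (sp1 (h x)) 1.
    rewrite f5 ?mulr0// => i j iS jS fi fj.
    by apply: uq; [rewrite inE iS orbT|rewrite inE jS orbT|apply: near => //; exact: sp1_lt1..].
  by rewrite (_ : 1 - sp1 (h x) = 0) ?mul0r//; lra.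
Qed.

End SmoothMax.

(** * Approximation of u at scale t by functions whose drift derivative vanishes at light sites *)

Section Regularization.
Context {R : realType} {n : nat}.
Variable r : 'I_n -> 'I_n -> R.
Hypothesis r0 : forall i j, 0 <= r i j.
Hypothesis irr : irreducible_rate r.
Local Notation E := 'rV[R]_n.
Implicit Types (x V W : E) (A C : {set 'I_n}).

Lemma ler_lin (g h : 'I_n -> R) x : simplex x -> (forall i, g i <= h i) -> lin g x <= lin h x.
Proof. by move=> [x0 _] gh; apply: ler_sum => i _; rewrite ler_wpM2r. Qed.

Lemma lin_ge0 (g : 'I_n -> R) x : simplex x -> (forall i, 0 <= g i) -> 0 <= lin g x.
Proof. by move=> [x0 _] g0; apply: sumr_ge0 => i _; rewrite mulr_ge0. Qed.

Lemma lin_ge_term (g : 'I_n -> R) k x : simplex x -> (forall i, 0 <= g i) ->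
  g k * x ord0 k <= lin g x.
Proof.
move=> [x0 _] g0; rewrite /lin (bigD1 k)//= lerDl.
by apply: sumr_ge0 => i _; rewrite mulr_ge0.
Qed.

Definition zeros A x : {set 'I_n} := [set k in A | x ord0 k == 0].

(* The heights [kap l] are chosen so that, at scale [t], the maximum of
   [u_C + kap #|C| t] over [C] is attained exactly at the set of those sites of
   [A] whose mass is small compared with [t]: adding a light site to [C] always
   pays, and so does removing a heavy one. *)
Lemma regularization A : A != finset.setT ->
  exists g : {set 'I_n} -> 'I_n -> R, exists c c1 c2 K : R,
  [/\ [/\ 0 < c, 0 < c1, 0 < c2 & 0 < K],
      forall C, C \subset A ->
        [/\ forall i, 0 <= g C i <= K, forall i, i \notin A -> g C i = 0,
          forall i, i \in A :\: C -> c <= g C i,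
          forall i, i \in C -> Lr r (g C) i = 0
        & forall i, i \in A :\: C -> Lr r (g C) i <= -1],
      forall C, C \subset A -> forall i, i \notin C -> g C i = g finset.set0 i
    & forall t : R, 0 < t -> exists f df d2f, C2 f df d2f /\
      forall x, simplex x ->
      [/\ lin (g finset.set0) x <= f x <= lin (g finset.set0) x + K * t,
         forall k, k \in A -> x ord0 k <= c1 * t -> df (drift_dir r k) x = 0,
         (forall i, `|df (drift_dir r i) x| <= K) /\
           (forall i j, `|df (unit_vec i - unit_vec j) x| <= K),
         (forall i j, `|d2f (unit_vec i - unit_vec j) (unit_vec i - unit_vec j) x| <= K / t) /\
         ((forall k, k \in A -> x ord0 k <= c1 * t \/ c2 * t < x ord0 k) ->
           forall V W, d2f V W x = 0)
       & (forall k, k \in A -> x ord0 k = 0 \/ c2 * t < x ord0 k) ->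
         forall V, df V x = lin (g (zeros A x)) V]].
Proof.
move=> AT.
have [g [c [K1 [c0 K10 Hg]]]] := trace_family r0 irr AT.
pose s := enum (powerset A).
have sE C : (C \in s) = (C \subset A) by rewrite mem_enum inE.
have s0 : s != [::].
  by apply/eqP => e; have := sE finset.set0; rewrite e finset.sub0set.
have [K K0 HK] := smooth_max g s0 (enum_uniq _).
(* The increment pays for the tolerance [K], for the loss [K1 * (1 + n%:R * ((kap l + K) / c))]
   caused by adding a light site to a set of light sites, and for a strict gap of 1. *)
pose kap l : R := iter l (fun y => y + (K + K1 * (1 + n%:R * ((y + K) / c)) + 1)) 0.
have kapS l : kap l.+1 = kap l + (K + K1 * (1 + n%:R * ((kap l + K) / c)) + 1).
  by rewrite /kap iterS.
have incr_ge0 y : 0 <= y -> 0 <= K + K1 * (1 + n%:R * ((y + K) / c)) + 1.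
  move=> y0; rewrite !addr_ge0 ?(ltW K0)// mulr_ge0 ?(ltW K10)// addr_ge0//.
  by rewrite mulr_ge0// divr_ge0 ?addr_ge0// ltW.
have kap0 l : 0 <= kap l by elim: l => // l IH; rewrite kapS addr_ge0// incr_ge0.
have kap_le l k : (l <= k)%N -> kap l <= kap k.
  move=> /subnK <-; elim: (k - l)%N => // j IH.
  by rewrite addSn kapS (le_trans IH)// lerDl incr_ge0.
(* Removing [j] from [C] gains c x_j and costs at most (kap n + K) t, so a nearly maximal [C]
   contains no site heavier than [c2 * t]. *)
pose c2 := (kap n + K) / c.
have c20 : 0 < c2 by rewrite divr_gt0// ltr_wpDl.
have [K3 K30 HK3] := finite_upper_bound (fun p : {set 'I_n} * 'I_n =>
  `|lin (g p.1) (drift_dir r p.2)|).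
have [K4 K40 HK4] := finite_upper_bound (fun p : {set 'I_n} * ('I_n * 'I_n) =>
  `|lin (g p.1) (unit_vec p.2.1 - unit_vec p.2.2)|).
have [K5 K50 HK5] := finite_upper_bound (fun p : 'I_n * 'I_n =>
  \sum_(C <- s) `|lin (g C) (unit_vec p.1 - unit_vec p.2)|).
pose KK := K1 + K + kap n + K3 + K4 + K * (K5 * K5).
have KKs : [/\ K1 <= KK, kap n + K <= KK, K3 <= KK, K4 <= KK & K * (K5 * K5) <= KK].
  have h := kap0 n; have h2 : 0 <= K * (K5 * K5) by rewrite !mulr_ge0 ?ltW.
  by rewrite /KK; split; lra.
have [KK1 KK2 KK3 KK4 KK5] := KKs.
exists g, c, 1, c2, KK; split.
- by split=> //; rewrite (lt_le_trans K10).
- move=> C CA; have [g1 g2 g3 [g4 g5 _ _]] := Hg C CA; split=> // i.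
  by have /andP[-> /=] := g1 i => /le_trans; apply.
- by move=> C CA; have [_ _ _ [_ _ _ []]] := Hg C CA.
move=> t t0; have [f [df [d2f [Cf Hf]]]] := HK t (fun C => kap #|C| * t) t0.
exists f, df, d2f; split=> // x xS; have [x0 x1] := xS.
have [f1 [C0 C0s f2] [pi [pi0 pi1 pidf pif]] f4 f5] := Hf x.
have cardC C : (#|C| <= n)%N by rewrite -[leqRHS]card_ord max_card.
pose near C := f x <= lin (g C) x + kap #|C| * t + K * t.
have heavy C j : C \subset A -> near C -> j \in C -> x ord0 j <= (kap #|C| + K) / c * t.
  move=> CA nC jC; have [_ _ _ [_ _ /(_ j jC) gj _]] := Hg C CA.
  have DA : C :\ j \subset A by apply: fintype.subset_trans CA; exact: finset.subsetDl.
  have := f1 (C :\ j); rewrite sE => /(_ DA) H.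
  have H2 : lin (g C) x + c * x ord0 j <= lin (g (C :\ j)) x.
    rewrite (_ : _ + _ = lin (fun i => g C i + c * (i == j)%:R) x); first exact: ler_lin.
    rewrite /lin; under [RHS]eq_bigr do rewrite mulrDl.
    rewrite big_split /=; congr (_ + _).
    by rewrite (bigD1 j)//= eqxx mulr1 big1 ?addr0// => i /negbTE ->; rewrite mulr0 mul0r.
  have H3 := kap0 #|C :\ j|.
  have H4 : 0 <= kap #|C :\ j| * t by rewrite mulr_ge0// ltW.
  rewrite mulrAC ler_pdivlMr// mulrC mulrDl.
  by move: nC; rewrite /near => nC; lra.
have heavy2 C j : C \subset A -> near C -> j \in C -> x ord0 j <= c2 * t.
  move=> CA nC jC; rewrite (le_trans (heavy C j CA nC jC))// ler_wpM2r ?(ltW t0)//.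
  by rewrite ler_wpM2r ?invr_ge0 ?(ltW c0)// lerD2r kap_le.
(* Otherwise adding [k] to [C] would lose less than the jump of [kap], and exceed the maximum. *)
have light C k : C \subset A -> near C -> k \in A -> x ord0 k <= 1 * t -> k \in C.
  move=> CA nC kA; rewrite mul1r => xk; apply: contraT => kC.
  have DA : k |: C \subset A by rewrite finset.subUset finset.sub1set kA.
  have := f1 (k |: C); rewrite sE => /(_ DA) H.
  have [gC _ _ [_ _ _ [gC0 _]]] := Hg C CA.
  have [gD _ _ [_ _ _ [gD0 _]]] := Hg _ DA.
  have H2 : lin (g C) x - lin (g (k |: C)) x <= K1 * (t + n%:R * ((kap #|C| + K) / c) * t).
    rewrite -sumrB.
    apply: (@le_trans _ _ (\sum_(i in k |: C) K1 * x ord0 i)).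
      rewrite [leRHS]big_mkcond; apply: ler_sum => i _.
      rewrite -mulrBl; case: ifPn => iD.
        rewrite ler_wpM2r//; have /andP[_ h1] := gC i; have /andP[h2 _] := gD i.
        by rewrite lerBlDr (le_trans h1)// lerDl.
      rewrite gD0// gC0 ?subrr ?mul0r//.
      by apply: contra iD; rewrite !inE orbC => ->.
    rewrite -mulr_sumr ler_wpM2l ?(ltW K10)// big_setU1//= lerD//.
    apply: (@le_trans _ _ (\sum_(i in C) (kap #|C| + K) / c * t)).
      by apply: ler_sum => i iC; exact: heavy.
    rewrite sumr_const -[_ *+ _]mulr_natl -[leRHS]mulrA.
    rewrite ler_wpM2r ?ler_nat ?cardC// mulr_ge0 ?(ltW t0)// divr_ge0 ?(ltW c0)//.
    by rewrite addr_ge0// ltW.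
  move: H nC; rewrite /near cardsU1 kC add1n kapS => H nC.
  have : 1 * t <= 0 by move: H nC H2; nra.
  by rewrite mul1r leNgt t0.
have pinear C : C \subset A -> 0 < pi C -> near C.
  by move=> CA pC; apply: pif => //; rewrite sE.
have dfb V M : (forall C, C \subset A -> `|lin (g C) V| <= M) -> `|df V x| <= M.
  move=> H; rewrite pidf (le_trans (ler_norm_sum _ _ _))//.
  rewrite -[M]mul1r -pi1 mulr_suml.
  rewrite big_seq [leRHS]big_seq; apply: ler_sum => C Cs.
  by rewrite normrM ger0_norm// ler_wpM2l// H// -sE.
have dfe V M : (forall C, C \subset A -> near C -> lin (g C) V = M) -> df V x = M.
  move=> H; rewrite pidf -[M]mul1r -pi1 mulr_suml; apply: eq_big_seq => C; rewrite sE => CA.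
  have [pC|pC] := ltP 0 (pi C); first by rewrite H// pinear.
  by rewrite (_ : pi C = 0) ?mul0r//; apply/eqP; rewrite eq_le pC pi0.
have [gs0 _ _ _] := Hg finset.set0 (finset.sub0set _).
split.
- have := f1 finset.set0; rewrite sE finset.sub0set => /(_ isT); rewrite cards0 mul0r addr0 => -> /=.
  rewrite (le_trans f2)// -addrA -mulrDl lerD//.
    move: C0s; rewrite sE => C0A; have [_ _ _ [_ _ _ [_ H]]] := Hg _ C0A.
    exact: ler_lin.
  rewrite ler_wpM2r ?(ltW t0)// (le_trans _ KK2)// lerD2r kap_le//.
- move=> k kA xk; apply: dfe => C CA nC; rewrite lin_drift.
  by have [_ _ _ [-> //]] := Hg C CA; exact: light xk.
- split=> [i|i j]; apply: dfb => C CA.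
    by rewrite (le_trans (HK3 (C, i))).
  by rewrite (le_trans (HK4 (C, (i, j)))).
- split=> [i j|H V W].
    rewrite (le_trans (f4 _ _))// (mulrAC K) ler_wpM2r ?invr_ge0 ?(ltW t0)//.
    rewrite (le_trans _ KK5)// ler_wpM2l ?(ltW K0)//.
    by rewrite ler_pM ?sumr_ge0// (HK5 (i, j)).
  apply: f5 => C D; rewrite !sE => CA DA nC nD.
  (* When no site has intermediate mass, a nearly maximal set can only be the set of light sites. *)
  have uq C' : C' \subset A -> near C' -> C' = [set k in A | x ord0 k <= 1 * t].
    move=> CA' nC'; apply/setP => k; rewrite !inE; apply/idP/idP => [kC|/andP[kA]].
      have kA : k \in A by exact: (fintype.subsetP CA').
      by rewrite kA /=; case: (H k kA) => //; rewrite ltNge (heavy2 _ _ CA' nC' kC).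
    exact: light.
  by rewrite (uq _ CA nC) (uq _ DA nD).
- move=> H V; apply: dfe => C CA nC; congr (lin (g _) V).
  apply/setP => k; rewrite !inE; apply/idP/idP => [kC|/andP[kA /eqP xk]].
    have kA : k \in A by exact: (fintype.subsetP CA).
    rewrite kA /=; case: (H k kA) => [->//|]; by rewrite ltNge (heavy2 _ _ CA nC kC).
  by apply: (light _ _ CA nC kA); rewrite xk mul1r ltW.
Qed.

End Regularization.

(** * One-variable calculus: the smooth step and the ramp *)

Section C2Real.
Context {R : realType}.
Implicit Types (p q : R -> R) (t : R).

Definition C2R p p1 p2 := [/\ forall t, is_derive t 1 p (p1 t),
  forall t, is_derive t 1 p1 (p2 t) & continuous p2].

Lemma derive_continuous p p1 : (forall t, is_derive t 1 p (p1 t)) -> continuous p.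
Proof.
move=> H t; apply: differentiable_continuous; apply/derivable1_diffP.
by have [] := H t.
Qed.

Lemma C2R_continuous p p1 p2 : C2R p p1 p2 -> [/\ continuous p, continuous p1 & continuous p2].
Proof. by move=> [H1 H2 H3]; split=> //; exact: derive_continuous. Qed.

Lemma C2R_mul p p1 p2 q q1 q2 : C2R p p1 p2 -> C2R q q1 q2 ->
  C2R (fun t => p t * q t) (fun t => p1 t * q t + p t * q1 t)
      (fun t => p2 t * q t + 2 * (p1 t * q1 t) + p t * q2 t).
Proof.
move=> Hp Hq; have [cp cp1 cp2] := C2R_continuous Hp.
have [cq cq1 cq2] := C2R_continuous Hq.
move: Hp Hq => [p0 pp1 _] [q0 qq1 _]; split.
- move=> t; apply: (is_derive_eq (is_deriveM (p0 t) (q0 t))).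
  by rewrite -![_ *: _]/(_ * _); ring.
- move=> t.
  apply: (is_derive_eq (is_deriveD (is_deriveM (pp1 t) (q0 t)) (is_deriveM (p0 t) (qq1 t)))).
  by rewrite -![_ *: _]/(_ * _); ring.
- apply: ctsD; last exact: ctsM.
  apply: ctsD; first exact: ctsM.
  by apply: ctsM; [exact: cts_cst|exact: ctsM].
Qed.

Lemma C2R_affine p p1 p2 (k c : R) : C2R p p1 p2 ->
  C2R (fun t => p (k * t + c)) (fun t => k * p1 (k * t + c)) (fun t => k ^+ 2 * p2 (k * t + c)).
Proof.
move=> [H1 H2 H3].
have L t : is_derive t 1 (fun t => k * t + c) k.
  apply: (is_derive_eq (is_deriveD (is_deriveZ k (is_derive_id t 1)) (is_derive_cst c t 1))).
  by rewrite addr0 -[LHS]/(_ * _) mulr1.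
split.
- move=> t; rewrite mulrC.
  exact: (@is_derive1_comp _ p (fun t => k * t + c) t _ _ (H1 _) (L t)).
- move=> t; rewrite expr2 -mulrA (mulrC k (p2 _)).
  exact: (is_deriveZ k (@is_derive1_comp _ p1 (fun t => k * t + c) t _ _ (H2 _) (L t))).
- apply: ctsM; first exact: cts_cst.
  move=> t; apply: (@continuous_comp _ _ _ (fun t => k * t + c) p2); last exact: H3.
  by apply: (derive_continuous L).
Qed.

Lemma C2R_add p p1 p2 q q1 q2 : C2R p p1 p2 -> C2R q q1 q2 ->
  C2R (fun t => p t + q t) (fun t => p1 t + q1 t) (fun t => p2 t + q2 t).
Proof.
move=> [p0 pp1 cp] [q0 qq1 cq]; split.
- by move=> t; exact: is_deriveD.
- by move=> t; exact: is_deriveD.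
- exact: ctsD.
Qed.

Lemma C2R_scale p p1 p2 (k : R) : C2R p p1 p2 ->
  C2R (fun t => k * p t) (fun t => k * p1 t) (fun t => k * p2 t).
Proof.
move=> [p0 pp1 cp]; split.
- by move=> t; exact: is_deriveZ.
- by move=> t; exact: is_deriveZ.
- by apply: ctsM => //; exact: cts_cst.
Qed.

Lemma C2R_cst (k : R) : C2R (fun=> k) (fun=> 0) (fun=> 0).
Proof.
by split=> [t|t|]; [exact: is_derive_cst|exact: is_derive_cst|exact: cts_cst].
Qed.

Lemma C2R_id : C2R id (fun=> 1) (fun=> 0).
Proof.
by split=> [t|t|]; [exact: is_derive_id|exact: is_derive_cst|exact: cts_cst].
Qed.

Lemma C2R_sp : C2R sp sp1 sp2.
Proof. by split; [exact: is_derive_sp|exact: is_derive_sp1|exact: continuous_sp2]. Qed.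

Lemma C2R_pospow3 : C2R (pospow 3) (fun t => 3 * pospow 2 t) (fun t => 3 * (2 * pospow 1 t)).
Proof.
split=> [t|t|]; first exact: is_derive_pospow.
  exact/is_deriveZ/is_derive_pospow.
by apply: ctsM; [exact: cts_cst|apply: ctsM; [exact: cts_cst|exact: continuous_pospow]].
Qed.

Lemma mean_value p p1 t : (forall t, is_derive t 1 p (p1 t)) ->
  exists z, p (t + 1) - p t = p1 z.
Proof.
move=> H; have t1 : t < t + 1 by rewrite ltrDl.
have [|z _ ->] := MVT t1 (fun x _ => H x).
  by apply: continuous_subspaceT; exact: derive_continuous H.
by exists z; rewrite addrC addKr mulr1.
Qed.

(** A smooth step, equal to 0 up to 1 and to 1 from 4 on. *)
Definition st t : R := sp (t - 2) - sp (t - 3).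
Definition st1 t : R := sp1 (t - 2) - sp1 (t - 3).
Definition st2 t : R := sp2 (t - 2) - sp2 (t - 3).

Lemma C2R_st : C2R st st1 st2.
Proof.
have H := C2R_add (C2R_affine 1 (- 2) C2R_sp) (C2R_scale (- 1) (C2R_affine 1 (- 3) C2R_sp)).
have e (p : R -> R) (k : R) : (fun t => k * p (1 * t - 2) + - 1 * (k * p (1 * t - 3))) =
    (fun t => k * (p (t - 2) - p (t - 3))).
  by apply/funext => t; rewrite !mul1r; ring.
have := H; rewrite -[X in C2R X]/(fun t => _).
by rewrite /st /st1 /st2; congr C2R; apply/funext => t; rewrite ?expr1n !mul1r mulN1r.
Qed.

Lemma st_le1 t : t <= 1 -> [/\ st t = 0, st1 t = 0 & st2 t = 0].
Proof.
move=> t1; rewrite /st /st1 /st2.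
have H s : s <= -1 -> [/\ sp s = 0, sp1 s = 0 & sp2 s = 0 :> R].
  move=> s1; rewrite /sp /sp1 /sp2 !pospow_le; try lra.
  by split; field.
have [|-> -> ->] := H (t - 2); first by lra.
have [|-> -> ->] := H (t - 3); first by lra.
by rewrite subrr.
Qed.

Lemma st_ge4 t : 4 <= t -> [/\ st t = 1, st1 t = 0 & st2 t = 0].
Proof.
move=> t1; rewrite /st /st1 /st2.
have H s : 1 <= s -> [/\ sp s = s, sp1 s = 1 & sp2 s = 0 :> R].
  move=> s1; rewrite /sp /sp1 /sp2 !pospow_ge; try lra.
  by split; field.
have [|-> -> ->] := H (t - 2); first by lra.
have [|-> -> ->] := H (t - 3); first by lra.
by rewrite !subrr; split=> //; ring.
Qed.

Lemma st_itv t : [/\ 0 <= st t <= 1, 0 <= st1 t <= 1 & `|st2 t| <= 1].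
Proof.
have e : t - 2 = (t - 3) + 1 by ring.
rewrite /st /st1 /st2 e.
(* Unit increments of [sp] and [sp1] are values of [sp1] and [sp2], which lie in [0, 1]. *)
have [z1 ->] := mean_value (t - 3) is_derive_sp.
have [z2 ->] := mean_value (t - 3) is_derive_sp1.
split; [exact: sp1_itv|exact: sp2_itv|].
have := sp2_itv (t - 3); have := sp2_itv (t - 3 + 1).
by rewrite ler_norml; lra.
Qed.

(** [ramp2] is the positive part of 1 - t / 2, so that [ramp1 t - t * ramp2 t] equals min(t^2 / 4,
    1) for t >= 0: the ramp is quadratic at 0 and affine from 2 on. *)
Definition ramp t : R := 2^-1 * t ^+ 2 + - 12^-1 * t ^+ 3 + 12^-1 * pospow 3 (t - 2).
Definition ramp1 t : R := t + - 4^-1 * t ^+ 2 + 4^-1 * pospow 2 (t - 2).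
Definition ramp2 t : R := 1 + - 2^-1 * t + 2^-1 * pospow 1 (t - 2).

Lemma C2R_ramp : C2R ramp ramp1 ramp2.
Proof.
have H2 : C2R (fun t : R => t ^+ 2) (fun t => 2 * t) (fun=> 2).
  have := C2R_mul C2R_id C2R_id; congr C2R; apply/funext => t /=; ring.
have H3 : C2R (fun t : R => t ^+ 3) (fun t => 3 * t ^+ 2) (fun t => 6 * t).
  have := C2R_mul H2 C2R_id; congr C2R; apply/funext => t /=; ring.
have := C2R_add (C2R_add (C2R_scale 2^-1 H2) (C2R_scale (- 12^-1) H3))
  (C2R_scale 12^-1 (C2R_affine 1 (- 2) C2R_pospow3)).
by congr C2R; apply/funext => t; rewrite /ramp /ramp1 /ramp2 ?expr1n !mul1r //; field.
Qed.

Lemma ramp_prop t : 0 <= t ->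
  [/\ 0 <= ramp t <= t, ramp t <= 2^-1 * t ^+ 2, 0 <= ramp1 t <= 1, ramp1 t <= t
    & 0 <= ramp2 t <= 1 /\ Num.min (4^-1 * t ^+ 2) 1 <= ramp1 t - t * ramp2 t].
Proof.
move=> t0; have [t2|t2] := leP t 2.
  rewrite /ramp /ramp1 /ramp2 !pospow_le ?subr_le0//.
  have h : Num.min (4^-1 * t ^+ 2) 1 <= 4^-1 * t ^+ 2 by rewrite ge_min lexx.
  have h3 : t ^+ 3 = t * t ^+ 2 by rewrite exprS.
  have h2 : t ^+ 2 = t * t by rewrite expr2.
  have h5 : 0 <= t * t * (2 - t) by rewrite !mulr_ge0// subr_ge0.
  by rewrite h3 h2 in h *; split; try split; try (apply/andP; split); nra.
rewrite /ramp /ramp1 /ramp2 !(pospow_ge _ (_ : 0 <= t - 2)) ?subr_ge0 ?(ltW t2)//.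
have h : Num.min (4^-1 * t ^+ 2) 1 <= 1 by rewrite ge_min lexx orbT.
by split; try split; try (apply/andP; split); nra.
Qed.

Lemma ramp_ge2 t : 2 <= t -> [/\ ramp t = t - 2 / 3, ramp1 t = 1 & ramp2 t = 0].
Proof.
move=> t2; rewrite /ramp /ramp1 /ramp2 !(pospow_ge _ (_ : 0 <= t - 2)) ?subr_ge0//.
by split; field.
Qed.

End C2Real.

(** * Local test functions *)

Section LocalTest.
Context {R : realType} {n : nat}.
Variables (r : 'I_n -> 'I_n -> R) (m : 'I_n -> R) (b : R).
Hypothesis r0 : forall i j, 0 <= r i j.
Hypothesis irr : irreducible_rate r.
Hypothesis stm : is_stationary r m.
Hypothesis b1 : 1 <= b.
Local Notation E := 'rV[R]_n.
Implicit Types (x V W : E) (A C : {set 'I_n}).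

(* Since [0^-1 = 0], the empty sites of [A] do not contribute. *)
Definition pot A x : R := \sum_(k in A) (x ord0 k)^-1.

Definition away A (d : R) x := forall k, k \notin A -> d <= x ord0 k.

(* For test functions [p (lin ga x) * kap x], where [kap] localizes to masses
   bounded below outside [A], the limit of the generator is
   [p * a0 + p' * a1 + p'' * a2], and [- b * P] is the singular part of the
   drift of [lin ga]; [1 <= b] is what allows [- P] in the bound on [a1]. *)
Definition local_data A (d : R) (ga : 'I_n -> R) (kap a0 a1 a2 P : E -> R)
    (eta K c d' : R) : Prop :=
  [/\ [/\ 0 < eta, 0 < K, 0 < c & 0 < d' <= d],
      [/\ forall i, 0 <= ga i <= K, forall i, i \notin A -> ga i = 0
        & forall i, i \in A -> c <= ga i],
      continuous kap /\ (forall x, simplex x -> 0 <= kap x <= 1 /\ (away A d x -> kap x = 1))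
    & forall x, simplex x -> away A d' x ->
        [/\ c * pot A x <= P x, a1 x <= - (kap x * P x) + K,
           0 <= a2 x <= kap x * (lin ga x * P x), a2 x <= K
         & `|a0 x| <= K /\ (lin ga x = 0 -> a1 x = 0 /\ a2 x = 0)]].

Lemma pot_ge0 A x : simplex x -> 0 <= pot A x.
Proof. by move=> [x0 _]; apply: sumr_ge0 => k _; rewrite invr_ge0. Qed.

Lemma inv_le_pot A x k : simplex x -> k \in A -> (x ord0 k)^-1 <= pot A x.
Proof.
move=> [x0 _] kA; rewrite /pot (bigD1 k)//= lerDl.
by apply: sumr_ge0 => j _; rewrite invr_ge0.
Qed.

Lemma bounded_family (I : finType) (f : I -> E -> R) : (forall i, continuous (f i)) ->
  exists2 M, 0 < M & forall i x, simplex x -> `|f i x| <= M.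
Proof.
move=> cf.
have [M HM] := @choice _ _ (fun i M => 0 < M /\ forall x, simplex x -> `|f i x| <= M)
  (fun i => let: ex_intro2 M h1 h2 := continuous_bounded_simplex (cf i) in
     ex_intro _ M (conj h1 h2)).
have [N N0 HN] := finite_upper_bound M.
by exists N => // i x sx; exact: le_trans ((HM i).2 x sx) (HN i).
Qed.

Let m0 i : 0 < m i. Proof. exact: (stationary_gt0 r0 irr stm). Qed.
Let m1 : \sum_i m i = 1. Proof. by case: stm. Qed.
Let b0 : 0 < b. Proof. exact: lt_le_trans b1. Qed.

(** [S] and [Q] are the singular first-order part and the second-order part of the generator, as
    functions of the directional derivatives. *)
Let S x (y : 'I_n -> R) : R := \sum_i b * (m i / x ord0 i) * y i.
Let Q (z : 'I_n -> 'I_n -> R) : R := 2^-1 * \sum_i \sum_j m i * r i j * z i j.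
Let rho : R := 2^-1 * \sum_i \sum_j m i * r i j.

Let rho0 : 0 <= rho.
Proof.
rewrite mulr_ge0// sumr_ge0// => i _; rewrite sumr_ge0// => j _.
by rewrite mulr_ge0// ltW.
Qed.

Let Q_bound z (Y : R) : (forall i j, `|z i j| <= Y) -> `|Q z| <= rho * Y.
Proof.
move=> H; rewrite /Q /rho normrM ger0_norm// -mulrA ler_wpM2l//.
rewrite (le_trans (ler_norm_sum _ _ _))// mulr_suml; apply: ler_sum => i _.
rewrite (le_trans (ler_norm_sum _ _ _))// mulr_suml; apply: ler_sum => j _.
have h : 0 <= m i * r i j by rewrite mulr_ge0// ltW.
by rewrite normrM (ger0_norm h) ler_wpM2l.
Qed.

(** The weights m_i sum to 1, so it is enough to bound 1 / x_i over the sites that contribute. *)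
Let S_sum x y (w Y : R) : simplex x -> 0 <= Y -> (forall i, `|y i| <= Y) ->
  (forall i, y i != 0 -> (x ord0 i)^-1 <= w) -> 0 <= w -> `|S x y| <= b * w * Y.
Proof.
move=> [x0 _] Y0 H Hw w0; rewrite /S (le_trans (ler_norm_sum _ _ _))//.
rewrite -[b * w * Y]mul1r -m1 mulr_suml; apply: ler_sum => i _.
rewrite normrM normrM normrM (gtr0_norm b0) (gtr0_norm (m0 i)) ger0_norm ?invr_ge0//.
rewrite mulrCA -!mulrA [b * (_ * _)]mulrCA.
rewrite ler_wpM2l ?(ltW (m0 i))// mulrCA ler_wpM2l ?(ltW b0)//.
have [->|yi] := eqVneq (y i) 0; first by rewrite normr0 mulr0 mulr_ge0.
by rewrite ler_pM ?invr_ge0// Hw.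
Qed.

Let sum7 (x1 x2 x3 x4 x5 x6 x7 : R) :
  0 < x1 -> 0 < x2 -> 0 <= x3 -> 0 <= x4 -> 0 <= x5 -> 0 <= x6 -> 0 <= x7 ->
  let s := x1 + x2 + x3 + x4 + x5 + x6 + x7 in
  [/\ 0 < s, x1 <= s, x2 <= s & [/\ x3 <= s, x4 <= s, x5 <= s, x6 <= s & x7 <= s]].
Proof. by move=> ? ? ? ? ? ? ? s; rewrite /s; split; try split; lra. Qed.

(** The test functions are p(f) kap, with f the regularization of u at scale t; the [y] of the
    conclusion is f x. At the sites of [A] the drift derivative of f vanishes for small mass and
    that of kap vanishes always; at the other sites the whole product vanishes for small mass,
    because either kap = 0 or f >= eta. *)
Lemma local_test A (d : R) : A != finset.setT -> 0 < d ->
  exists (ga : 'I_n -> R) (kap a0 a1 a2 P : E -> R) (eta K c d' : R),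
  local_data A d ga kap a0 a1 a2 P eta K c d' /\
    (forall p p1 p2, C2R p p1 p2 ->
      (forall w, eta <= w -> [/\ p w = 0, p1 w = 0 & p2 w = 0]) ->
      forall t, 0 < t -> exists F G : E -> R,
      [/\ dom_S r m b F, continuous F, continuous G,
        forall x, simplex x -> gen r m b F x = G x
      & forall x, simplex x -> exists2 y, lin ga x <= y <= lin ga x + K * t &
        [/\ F x = p y * kap x,
           `|G x| <= K * (`|p y| + `|p1 y| + `|p2 y|) * (1 + pot A x),
           away A d' x \/ (F x = 0 /\ G x = 0)
         & (forall k, k \in A -> x ord0 k = 0 \/ K * t < x ord0 k) ->
           G x = p y * a0 x + p1 y * a1 x + p2 y * a2 x]]).
Proof.
move=> AT d0.
have [g [c [c1 [c2 [K0 [[c0 c10 c20 K00] Hg gout Hf]]]]]] := regularization r0 irr AT.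
have [h Hh] := @choice _ _ (fun k (h : 'I_n -> R) => k \notin A ->
  [/\ forall i, 0 <= h i, h k = 1, forall i, i \notin A -> i != k -> h i = 0
    & forall i, i \in A -> Lr r h i = 0])
  (fun k => match boolP (k \notin A) with
    | AltTrue kA => let: ex_intro h H := harmonic_coord r0 irr AT kA in ex_intro _ h (fun=> H)
    | AltFalse kA => ex_intro _ (fun=> 0) (fun H => False_ind _ (negP kA H)) end).
have [Kh Kh0 HKh] := finite_upper_bound (fun q : 'I_n * 'I_n => h q.1 q.2).
pose s := enum (~: A).
have sE k : (k \in s) = (k \notin A) by rewrite mem_enum inE.
(* On the simplex, [e k] is nonpositive once x_k >= d, and it is at least 1 / 2 when
   [lin (h k) x <= d / 2]; the factor 8 below then makes [U] nonpositive. Cubes of positive parts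
   are C2. *)
pose e k x := lin (fun i => - d^-1 * h k i) x + 1.
have eE k x : e k x = 1 - lin (h k) x / d.
  rewrite /e addrC /lin mulr_suml -sumrN; congr (_ + _).
  by apply: eq_bigr => i _; ring.
have [p30 p31 p32] := @C2R_pospow3 R.
have CU := C2_add (C2_cst 1) (C2_scale (- 8) (C2_sum s (fun k =>
  C2_comp p30 p31 p32 (C2_affine (fun i => - d^-1 * h k i) 1)))).
set U := (fun x : E => 1 + _) in CU.
set dU := (fun V x => _) in CU.
set d2U := (fun V W x => _) in CU.
have Ckap := C2_comp p30 p31 p32 CU.
pose kap x := pospow 3 (U x).
pose dkap V x := 3 * pospow 2 (U x) * dU V x.
pose d2kap V W x := 3 * pospow 2 (U x) * d2U V W x +
  dU V x * (3 * (2 * pospow 1 (U x)) * dU W x).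
have {}Ckap : C2 kap dkap d2kap := Ckap.
have [_ _ ckap cdkap cd2kap] := Ckap.
have UE x : U x = 1 - 8 * \sum_(k <- s) pospow 3 (e k x) by rewrite /U mulNr.
have U1 x : U x <= 1.
  by rewrite UE gerBl mulr_ge0// sumr_ge0// => k _; exact: pospow_ge0.
have kap01 x : 0 <= kap x <= 1.
  rewrite pospow_ge0 /= /kap /pospow exprn_ile1 ?le_max ?lexx ?orbT//.
  by rewrite ge_max U1 ler01.
have lh k x : simplex x -> k \notin A -> x ord0 k <= lin (h k) x.
  move=> [x0 _] kA; have [h0 h1 h2 h3] := Hh k kA.
  by rewrite /lin (bigD1 k)//= h1 mul1r lerDl sumr_ge0// => i _; rewrite mulr_ge0.
have kap1 x : simplex x -> away A d x -> kap x = 1.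
  move=> xS xd; rewrite /kap UE big_seq big1 ?mulr0 ?subr0.
    by rewrite pospow_ge// expr1n.
  move=> k; rewrite sE => kA; rewrite pospow_le// eE subr_le0 ler_pdivlMr// mul1r.
  by rewrite (le_trans (xd k kA))// lh.
have kap0 x : U x <= 0 -> [/\ kap x = 0, forall V, dkap V x = 0 & forall V W, d2kap V W x = 0].
  move=> u0; split=> [|V|V W]; rewrite /kap /dkap /d2kap !pospow_le//.
    by rewrite mulr0 mul0r.
  by rewrite !(mulr0, mul0r) addr0.
have dkapA i x : i \in A -> dkap (drift_dir r i) x = 0.
  move=> iA; rewrite /dkap (_ : dU _ _ = 0) ?mulr0//.
  rewrite /dU big_seq big1 ?mulr0 ?addr0// => k; rewrite sE => kA.
  rewrite (_ : lin (fun l => - d^-1 * h k l) (drift_dir r i) =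
    - d^-1 * lin (h k) (drift_dir r i)); last first.
    by rewrite /lin mulr_sumr; apply: eq_bigr => j _; rewrite mulrA.
  by rewrite lin_drift; have [_ _ _ ->] := Hh k kA; rewrite ?mulr0.
(* If u < eta, the sites of [A] contribute at most d / 4 to [lin (h k)]; where [U] is positive the
   latter exceeds d / 2, so x_k > d / 4, the value of [d']. *)
pose eta := c * d / (4 * Kh).
have eta0 : 0 < eta by rewrite divr_gt0// mulr_gt0.
pose d' := d / 4.
have d'0 : 0 < d' by rewrite divr_gt0.
have [ga1 ga2 ga3 _ _] := Hg finset.set0 (finset.sub0set _).
have gax x k : simplex x -> k \in A -> c * x ord0 k <= lin (g finset.set0) x.
  move=> [x0 _] kA; rewrite /lin (bigD1 k)//= -[leLHS]addr0 lerD//.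
    by rewrite ler_wpM2r// ga3// finset.setD0.
  by rewrite sumr_ge0// => i _; rewrite mulr_ge0//; case/andP: (ga1 i).
have caway x : simplex x -> 0 < U x -> lin (g finset.set0) x < eta -> away A d' x.
  move=> xS u0 ue k kA; have [x0 x1] := xS; have [h0 h1 h2 h3] := Hh k kA.
  have H : lin (h k) x <= x ord0 k + Kh * (lin (g finset.set0) x / c).
    rewrite /lin (bigD1 k)//= h1 mul1r lerD2l mulr_suml mulr_sumr.
    rewrite [leRHS](bigD1 k)//= ga2// !mul0r mulr0 add0r.
    apply: ler_sum => i ik; have [iA|iA] := boolP (i \in A).
      rewrite ler_pM ?(HKh (k, i))// mulrAC ler_peMl// ler_pdivlMr// mul1r ga3//.
      by rewrite finset.setD0.
    by rewrite h2// ga2// !mul0r mulr0.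
  have H2 : d / 2 < lin (h k) x.
    rewrite ltNge; apply/negP => H2.
    move: u0; rewrite ltNge => /negP; apply.
    rewrite UE subr_le0 (bigD1_seq k) ?enum_uniq ?sE//= mulrDr.
    rewrite -[X in X <= _]addr0 lerD//; last first.
      by rewrite mulr_ge0// sumr_ge0// => i _; exact: pospow_ge0.
    have H3 : 2^-1 <= e k x.
      rewrite eE lerBrDr -lerBrDl; have -> : 1 - 2^-1 = 2^-1 :> R by field.
      by rewrite ler_pdivrMr// mulrC.
    rewrite pospow_ge; last by rewrite (le_trans _ H3).
    have : 2^-1 ^+ 3 <= e k x ^+ 3 by apply: lerXn2r; rewrite ?nnegrE// (le_trans _ H3).
    by rewrite exprVn; lra.
  have H4 : Kh * (lin (g finset.set0) x / c) <= d / 4.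
    rewrite mulrA ler_pdivrMr// mulrC.
    move: (ltW ue); rewrite /eta ler_pdivlMr ?mulr_gt0// => ?; lra.
  by rewrite /d'; lra.
have [Kd Kd0 HKd] : exists2 M : R, 0 < M & forall x, simplex x ->
    [/\ forall i, `|dkap (drift_dir r i) x| <= M,
       forall i j, `|dkap (unit_vec i - unit_vec j) x| <= M
     & forall i j, `|d2kap (unit_vec i - unit_vec j) (unit_vec i - unit_vec j) x| <= M].
  have [N1 N10 HN1] := bounded_family (f := fun i => dkap (drift_dir r i)) (fun=> cdkap _).
  have [N2 N20 HN2] := bounded_family (f := fun q : 'I_n * 'I_n =>
    dkap (unit_vec q.1 - unit_vec q.2)) (fun=> cdkap _).
  have [N3 N30 HN3] := bounded_family (f := fun q : 'I_n * 'I_n =>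
    d2kap (unit_vec q.1 - unit_vec q.2) (unit_vec q.1 - unit_vec q.2)) (fun=> cd2kap _ _).
  exists (N1 + N2 + N3) => [|x xS]; first by rewrite !addr_gt0.
  split=> [i|i j|i j].
  - by rewrite (le_trans (HN1 i x xS))// -addrA lerDl addr_ge0// ltW.
  - by rewrite (le_trans (HN2 (i, j) x xS))// addrAC lerDr addr_ge0// ltW.
  - by rewrite (le_trans (HN3 (i, j) x xS))// lerDr addr_ge0// ltW.
have [Kz Kz0 HKz] : exists2 M : R, 0 < M & forall C, C \subset A ->
    (forall i, `|lin (g C) (drift_dir r i)| <= M) /\
    (forall i j, `|lin (g C) (unit_vec i - unit_vec j)| <= M).
  have [N1 N10 HN1] := finite_upper_bound (fun q : {set 'I_n} * 'I_n =>
    `|lin (g q.1) (drift_dir r q.2)|).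
  have [N2 N20 HN2] := finite_upper_bound (fun q : {set 'I_n} * ('I_n * 'I_n) =>
    `|lin (g q.1) (unit_vec q.2.1 - unit_vec q.2.2)|).
  exists (N1 + N2) => [|C CA]; first by rewrite addr_gt0.
  split=> [i|i j].
    by rewrite (le_trans (HN1 (C, i)))// lerDl ltW.
  by rewrite (le_trans (HN2 (C, (i, j))))// lerDr ltW.
have [mm mm0 Hmm] := finite_lower_bound m0.
(* The limit objects: as t tends to 0, the sites traced out are the empty sites of [A]. *)
pose Z x := zeros A x.
have ZA x : Z x \subset A by apply/fintype.subsetP => k; rewrite inE => /andP[].
pose gz x := g (Z x).
pose P x := \sum_(i in A) m i / x ord0 i * - Lr r (gz x) i.
pose a0 x := S x (fun i => dkap (drift_dir r i) x) +
  Q (fun i j => d2kap (unit_vec i - unit_vec j) (unit_vec i - unit_vec j) x).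
pose a1 x := kap x * S x (fun i => lin (gz x) (drift_dir r i)) +
  Q (fun i j => 2 * (dkap (unit_vec i - unit_vec j) x * lin (gz x) (unit_vec i - unit_vec j))).
pose a2 x := kap x * Q (fun i j => lin (gz x) (unit_vec i - unit_vec j) ^+ 2).
have nn (y z : R) : 0 <= y -> 0 < z -> 0 <= y * z by move=> y0 z0; rewrite mulr_ge0// ltW.
have bd0 : 0 < b * d'^-1 by rewrite mulr_gt0// invr_gt0.
have bd1 : 0 < b * (d'^-1 + 1) by rewrite mulr_gt0// addr_gt0// invr_gt0.
(* [k1], [k2], [k3] bound [a0], the regular part of [a1], and [a2]; [k4] and [k5] bound the
   coefficients of p' and p'' before the limit, [k4] up to the factor [1 + pot A x]. *)
pose k1 := b * d'^-1 * Kd + rho * Kd.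
pose k2 := b * d'^-1 * Kz + rho * (2 * (Kd * Kz)).
pose k3 := rho * (Kz * Kz).
pose k4 := b * (d'^-1 + 1) * K0 + rho * (2 * (Kd * K0) + K0 * c2).
pose k5 := rho * (K0 * K0).
pose K := K0 + c2 + k1 + k2 + k3 + k4 + k5.
have k10 : 0 <= k1 by apply: addr_ge0; apply: nn => //; exact: ltW.
have k20 : 0 <= k2.
  by apply: addr_ge0; apply: nn => //; [exact: ltW|rewrite !mulr_gt0].
have k30 : 0 <= k3 by apply: nn => //; rewrite mulr_gt0.
have k40 : 0 <= k4.
  by apply: addr_ge0; apply: nn => //; [exact: ltW|rewrite addr_gt0// !mulr_gt0].
have k50 : 0 <= k5 by apply: nn => //; rewrite mulr_gt0.
have [Kpos K0K c2K [k1K k2K k3K k4K k5K]] := sum7 K00 c20 k10 k20 k30 k40 k50.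
rewrite -/K in Kpos K0K c2K k1K k2K k3K k4K k5K; clearbody K.
exists (g finset.set0), kap, a0, a1, a2, P, eta, K, (Num.min c mm), d'.
split; first split.
- by split=> //; [rewrite lt_min c0|rewrite d'0 ler_pdivrMr// ler_peMr ?(ltW d0)// ler1n].
- split=> // [i|i iA].
    by have /andP[-> /=] := ga1 i => /le_trans; apply.
  by rewrite (le_trans _ (ga3 i _)) ?ge_min ?lexx// finset.setD0.
- by split=> // x xS; split; [exact: kap01|exact: kap1].
- move=> x xS xd; have [x0 x1] := xS.
  have [z1 z2 z3 z4 z5] := Hg _ (ZA x).
  have /andP[kx0 kx1] := kap01 x.
  have Lle i : i \in A -> 0 <= - Lr r (gz x) i.
    move=> iA; have [iZ|iZ] := boolP (i \in Z x); first by rewrite z4// oppr0.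
    by rewrite oppr_ge0 (le_trans (z5 i _)) ?lerN10// inE iZ.
  have Lge i : i \in A -> x ord0 i != 0 -> 1 <= - Lr r (gz x) i.
    by move=> iA xi; rewrite lerNr z5// !inE iA (negbTE xi).
  have PE : \sum_(i in A) b * (m i / x ord0 i) * lin (gz x) (drift_dir r i) = - (b * P x).
    rewrite /P mulr_sumr -sumrN; apply: eq_bigr => i _.
    by rewrite lin_drift; ring.
  have P0 : 0 <= P x.
    by apply: sumr_ge0 => i iA; rewrite mulr_ge0 ?Lle// divr_ge0// ltW.
  (* Tracing out [Z x] changes g at empty sites only. *)
  have uz : lin (g finset.set0) x = lin (gz x) x.
    apply: eq_bigr => i _; have [iZ|iZ] := boolP (i \in Z x).
      by move: iZ; rewrite inE => /andP[_ /eqP ->]; rewrite !mulr0.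
    by rewrite /gz gout.
  have inv i : i \notin A -> (x ord0 i)^-1 <= d'^-1.
    by move=> iA; rewrite lef_pV2 ?posrE ?xd// (lt_le_trans d'0)// xd.
  have [zz1 zz2] := HKz _ (ZA x).
  have [kd1 kd2 kd3] := HKd _ xS.
  (* The Dirichlet form identity puts Gamma in the shape of [P], with the extra factor g_i in each
     term. *)
  have a2E : a2 x = kap x * \sum_(i in A) m i * gz x i * - Lr r (gz x) i.
    rewrite /a2 /Q; under eq_bigr do under eq_bigr do rewrite lin_unitB.
    rewrite (dirichlet_form stm) -sumrN [in RHS]big_mkcond; congr (_ * _).
    apply: eq_bigr => i _; case: ifPn => iA; first by rewrite mulrN.
    by rewrite /gz z2// mulr0 mul0r oppr0.
  split.
  + rewrite /pot mulr_sumr; apply: ler_sum => i iA.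
    have [->|xi] := eqVneq (x ord0 i) 0; first by rewrite invr0 !(mulr0, mul0r).
    rewrite -mulrA [m i * _]mulrCA mulrC ler_wpM2l ?invr_ge0//.
    rewrite -[Num.min _ _]mulr1 ler_pM ?le_min ?(ltW c0) ?(ltW mm0)// ?Lge//.
    by rewrite ge_min (Hmm i) orbT.
  + rewrite /a1 /S (bigID (fun i => i \in A))/= PE mulrDr -addrA.
    apply: lerD.
      by rewrite mulrN lerN2 ler_wpM2l// ler_peMl.
    apply: (@le_trans _ _ (b * d'^-1 * Kz + rho * (2 * (Kd * Kz)))); last first.
      exact: k2K.
    apply: lerD.
      rewrite (le_trans (ler_norm _))// normrM ger0_norm//.
      apply: (@le_trans _ _ (1 * (b * d'^-1 * Kz))); last by rewrite mul1r.
      apply: ler_pM => //.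
      rewrite [X in `|X|](_ : _ = S x (fun i => if i \in A then 0 else lin (gz x) (drift_dir r i))).
        apply: S_sum => //; try exact: ltW.
        - by move=> i; case: ifP => // _; rewrite normr0 ltW.
        - by move=> i; case: ifPn => [_|iA _]; [rewrite eqxx|exact: inv].
        - by rewrite invr_ge0 ltW.
      rewrite /S big_mkcond; by apply: eq_bigr => i _; case: (i \in A); rewrite /= ?mulr0.
    rewrite (le_trans (ler_norm _))//; apply: Q_bound => i j.
    rewrite normrM ger0_norm// ler_wpM2l// normrM ler_pM//.
  + rewrite a2E; apply/andP; split.
      rewrite mulr_ge0// sumr_ge0// => i iA; rewrite mulr_ge0 ?Lle//.
      by rewrite mulr_ge0 ?(ltW (m0 i))//; case/andP: (z1 i).
    (* g_i x_i is one of the terms of u, so m_i g_i <= (m_i / x_i) u at occupied sites; at empty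
       ones g is harmonic. *)
    rewrite ler_wpM2l// /P mulr_sumr; apply: ler_sum => i iA.
    have [xi|xi] := eqVneq (x ord0 i) 0.
      by rewrite z4 ?oppr0 ?mulr0// inE iA xi eqxx.
    rewrite mulrA ler_wpM2r ?Lle// mulrCA ler_wpM2l ?(ltW (m0 i))//.
    have xip : 0 < x ord0 i by rewrite lt_neqAle eq_sym xi x0.
    rewrite ler_pdivlMr// uz /lin (bigD1 i)//= lerDl sumr_ge0// => j _.
    by rewrite mulr_ge0//; case/andP: (z1 j).
  + rewrite (le_trans (ler_norm _))// /a2 normrM ger0_norm//.
    apply: (@le_trans _ _ (1 * (rho * (Kz * Kz)))); last by rewrite mul1r.
    apply: ler_pM => //; apply: Q_bound => i j.
    by rewrite normrX expr2 ler_pM.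
  + split.
      rewrite /a0 (le_trans (ler_normD _ _))//.
      apply: (@le_trans _ _ k1) => //.
      apply: lerD; last exact: Q_bound.
      apply: S_sum => //; try exact: ltW.
        by move=> i; have [/dkapA ->|/inv//] := boolP (i \in A); rewrite eqxx.
      by rewrite invr_ge0 ltW.
    move=> u0.
    (* At u = 0 all of [A] is empty, and tracing out the whole of [A] leaves g = 0. *)
    have ZxA : Z x = A.
      apply/setP => k; rewrite !inE andb_idr// => kA.
      have := gax x k xS kA; rewrite u0 pmulr_rle0// => H.
      by rewrite eq_le H x0.
    have gA i : gz x i = 0.
      rewrite /gz ZxA; have [y1 y2 _ y4 _] := Hg A (subxx _).
      have [/(_ i)/andP[yi _]] := Hg A (subxx _) => _ _ _ _.
      apply/eqP; rewrite eq_le yi andbT -oppr_ge0.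
      apply: (minimum_principle r0 irr (C := A) (h := fun i => - g A i)) => // j jA.
        by rewrite y2// oppr0.
      have -> : Lr r (fun l => - g A l) j = - Lr r (g A) j.
        by rewrite /Lr -sumrN; apply: eq_bigr => l _; ring.
      by rewrite y4// oppr0.
    have linz V : lin (gz x) V = 0 by rewrite /lin big1// => i _; rewrite gA mul0r.
    rewrite /a1 /a2 /S /Q; split.
      rewrite big1 ?mulr0 ?add0r => [|i _]; last by rewrite linz mulr0.
      by rewrite big1 ?mulr0// => i _; rewrite big1// => j _; rewrite linz !mulr0.
    rewrite [X in _ * (_ * X)]big1 ?mulr0// => i _.
    by rewrite big1// => j _; rewrite linz expr0n mulr0.
move=> p p1 p2 [Hp0 Hp1 Hp2] pout t t0.
have [f [df [d2f [Cf Hfx]]]] := Hf t t0.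
have CF := C2_mul (C2_comp Hp0 Hp1 Hp2 Cf) Ckap.
have support x : simplex x -> away A d' x \/ (U x <= 0 \/ eta <= f x).
  move=> xS; have [u0|u0] := ltP 0 (U x); last by right; left.
  have [ue|ue] := ltP (f x) eta; last by right; right.
  left; apply: caway => //; apply: le_lt_trans ue.
  by have [/andP[]] := Hfx x xS.
have [|dF genF [G cG GE]] := dom_C2 (r := r) m b CF.
  move=> i; have [iA|iA] := boolP (i \in A).
    exists (c1 * t); first by rewrite mulr_gt0.
    move=> x xS xi; have [_ /(_ i iA (ltW xi)) -> _ _ _] := Hfx x xS.
    by rewrite dkapA// !mulr0 addr0.
  exists d' => // x xS xi.
  have [xd|[u0|ue]] := support x xS.
  - by have := xd i iA; rewrite leNgt xi.
  - by have [-> -> _] := kap0 x u0; rewrite mulr0 mul0r addr0.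
  - by have [-> -> _] := pout _ ue; rewrite !(mul0r, mulr0) addr0.
exists (fun x => p (f x) * kap x), G; split=> //.
- by have [_ _ cF _ _] := CF.
move=> x xS; have [x0 x1] := xS.
have [fu fA [fd1 fd2] [fdd fdd0] fz] := Hfx x xS.
have /andP[kx0 kx1] := kap01 x.
have [kd1 kd2 kd3] := HKd _ xS.
exists (f x).
  case/andP: fu => -> /= /le_trans; apply; rewrite lerD2l ler_wpM2r ?(ltW t0)//.
pose a1t := kap x * S x (fun i => df (drift_dir r i) x) +
  Q (fun i j => 2 * (dkap (unit_vec i - unit_vec j) x * df (unit_vec i - unit_vec j) x) +
      kap x * d2f (unit_vec i - unit_vec j) (unit_vec i - unit_vec j) x).
pose a2t := kap x * Q (fun i j => df (unit_vec i - unit_vec j) x ^+ 2).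
have GxE : G x = p (f x) * a0 x + p1 (f x) * a1t + p2 (f x) * a2t.
  rewrite -GE// genF// /gen2 /a1t /a2t /a0 /S /Q.
  rewrite [X in X + _](_ : _ = p (f x) * (\sum_i b * (m i / x ord0 i) * dkap (drift_dir r i) x) +
    p1 (f x) * (kap x * \sum_i b * (m i / x ord0 i) * df (drift_dir r i) x)).
    rewrite [X in _ + 2^-1 * X](_ : _ =
      p (f x) * (\sum_i \sum_j m i * r i j * d2kap (unit_vec i - unit_vec j) (unit_vec i - unit_vec j) x) +
      p1 (f x) * (\sum_i \sum_j m i * r i j * (2 * (dkap (unit_vec i - unit_vec j) x * df (unit_vec i - unit_vec j) x) +
      kap x * d2f (unit_vec i - unit_vec j) (unit_vec i - unit_vec j) x)) +
      p2 (f x) * (kap x * \sum_i \sum_j m i * r i j * df (unit_vec i - unit_vec j) x ^+ 2)).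
      by ring.
    rewrite !mulr_sumr -!big_split /=; apply: eq_bigr => i _.
    rewrite !mulr_sumr -!big_split /=; apply: eq_bigr => j _.
    by ring.
  rewrite !mulr_sumr -!big_split /=; apply: eq_bigr => i _.
  by ring.
have zero : U x <= 0 \/ eta <= f x -> p (f x) * kap x = 0 /\ G x = 0.
  case=> [u0|ue].
    have [k0 dk0 d2k0] := kap0 x u0; rewrite k0 mulr0; split=> //.
    have S0 (y : 'I_n -> R) : (forall i, y i = 0) -> S x y = 0.
      by move=> H; rewrite /S big1// => i _; rewrite H mulr0.
    have Q0 (z : 'I_n -> 'I_n -> R) : (forall i j, z i j = 0) -> Q z = 0.
      by move=> H; rewrite /Q big1 ?mulr0// => i _; rewrite big1// => j _; rewrite H mulr0.
    rewrite GxE /a0 /a1t /a2t k0 !mul0r S0// Q0// Q0 ?addr0 ?mulr0 ?addr0//.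
    by move=> i j; rewrite dk0 mul0r mulr0 add0r mul0r.
  by have [e0 e1 e2] := pout _ ue; rewrite GxE e0 e1 e2 !mul0r !addr0.
have V0 := pot_ge0 A xS.
split=> //.
- have [xd|/zero[_ ->]] := support x xS; last first.
    rewrite normr0; apply: mulr_ge0; last exact: addr_ge0.
    by apply: mulr_ge0; [exact: ltW|rewrite !addr_ge0].
  have inv i : i \notin A -> (x ord0 i)^-1 <= d'^-1.
    by move=> iA; rewrite lef_pV2 ?posrE ?xd// (lt_le_trans d'0)// xd.
  have B0 : `|a0 x| <= k1.
    rewrite /a0 (le_trans (ler_normD _ _))//.
    apply: lerD; last exact: Q_bound.
    apply: S_sum => //; try exact: ltW.
      by move=> i; have [/dkapA ->|/inv//] := boolP (i \in A); rewrite eqxx.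
    by rewrite invr_ge0 ltW.
  (* Where this is nonzero, some x_k lies between c1 t and c2 t, so K0 / t <= K0 c2 / x_k. *)
  have d2b i j : `|d2f (unit_vec i - unit_vec j) (unit_vec i - unit_vec j) x| <= K0 * c2 * pot A x.
    have [->|nz] := eqVneq (d2f (unit_vec i - unit_vec j) (unit_vec i - unit_vec j) x) 0.
      by rewrite normr0 !mulr_ge0// ltW.
    have [k kA xk] : exists2 k, k \in A & c1 * t < x ord0 k <= c2 * t.
      apply: contrapT => H; move/eqP: nz; apply; apply: fdd0 => k kA.
      have [h1|h1] := leP (x ord0 k) (c1 * t); first by left.
      have [h2|h2] := ltP (c2 * t) (x ord0 k); first by right.
      by case: H; exists k => //; rewrite h1.
    case/andP: xk => xk1 xk2.
    have xk0 : 0 < x ord0 k by rewrite (lt_trans _ xk1)// mulr_gt0.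
    rewrite (le_trans (fdd i j))// -mulrA ler_wpM2l ?(ltW K00)//.
    apply: (@le_trans _ _ (c2 * (x ord0 k)^-1)).
      by rewrite ler_pdivlMr// mulrC ler_pdivrMr.
    by rewrite ler_wpM2l ?(ltW c20)// inv_le_pot.
  have B1 : `|a1t| <= k4 * (1 + pot A x).
    rewrite /a1t (le_trans (ler_normD _ _))// /k4 mulrDl; apply: lerD.
      rewrite normrM ger0_norm//.
      apply: (@le_trans _ _ (1 * (b * (d'^-1 + pot A x) * K0))).
        apply: ler_pM => //; apply: S_sum => //; try exact: ltW.
          move=> i _; have [iA|/inv H] := boolP (i \in A).
            by rewrite (le_trans (inv_le_pot xS iA))// lerDr invr_ge0 ltW.
          by rewrite (le_trans H)// lerDl.
        by rewrite addr_ge0// invr_ge0 ltW.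
      rewrite mul1r [leRHS]mulrAC ler_wpM2r ?(ltW K00)// -mulrA ler_wpM2l ?(ltW b0)//.
      have h0 : 0 <= d'^-1 by rewrite invr_ge0 ltW.
      have -> : (d'^-1 + 1) * (1 + pot A x) = d'^-1 + pot A x + (1 + d'^-1 * pot A x) by ring.
      by rewrite lerDl addr_ge0// mulr_ge0.
    rewrite -mulrA; apply: Q_bound => i j.
    rewrite (le_trans (ler_normD _ _))// [leRHS]mulrDl; apply: lerD.
      apply: (@le_trans _ _ (2 * (Kd * K0))).
        by rewrite normrM ger0_norm// ler_wpM2l// normrM ler_pM.
      by rewrite ler_peMr ?lerDl// !mulr_ge0// ltW.
    rewrite normrM ger0_norm//.
    apply: (@le_trans _ _ (1 * (K0 * c2 * pot A x))); first by apply: ler_pM.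
    by rewrite mul1r ler_wpM2l ?mulr_ge0 ?(ltW K00) ?(ltW c20)// lerDr.
  have B2 : `|a2t| <= k5.
    rewrite /a2t normrM ger0_norm//.
    apply: (@le_trans _ _ (1 * (rho * (K0 * K0)))); last by rewrite mul1r.
    apply: ler_pM => //; apply: Q_bound => i j.
    by rewrite normrX expr2 ler_pM.
  rewrite GxE.
  apply: (@le_trans _ _ ((`|p (f x)| + `|p1 (f x)| + `|p2 (f x)|) * (K * (1 + pot A x)))); last first.
    by rewrite mulrA [_ * K]mulrC.
  rewrite !mulrDl (le_trans (ler_normD _ _))//.
  apply: lerD.
    rewrite (le_trans (ler_normD _ _))//; apply: lerD; rewrite normrM ler_wpM2l//.
      rewrite (le_trans B0)//; apply: (@le_trans _ _ K) => //.
      by rewrite ler_peMr ?(ltW Kpos)// lerDl.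
    rewrite (le_trans B1)// ler_wpM2r ?addr_ge0//.
  rewrite normrM ler_wpM2l// (le_trans B2)//.
  apply: (@le_trans _ _ K) => //.
  by rewrite ler_peMr ?(ltW Kpos)// lerDl.
- by have [|/zero] := support x xS; [left|right].
- move=> H.
  have H2 k : k \in A -> x ord0 k = 0 \/ c2 * t < x ord0 k.
    move=> /H[->|H3]; [by left|right]; apply: le_lt_trans H3.
    by rewrite ler_wpM2r ?(ltW t0).
  have d2z V W : d2f V W x = 0.
    apply: fdd0 => k /H2[->|]; [left|by right].
    by rewrite mulr_ge0// ltW.
  rewrite GxE /a1t /a2t /a1 /a2 /gz; congr (_ + _ * (_ * _ + _) + _ * (_ * _)).
  + by apply: eq_bigr => i _; rewrite fz.
  + congr (_ * _); apply: eq_bigr => i _; apply: eq_bigr => j _.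
    by rewrite d2z mulr0 addr0 fz.
  + by congr (_ * _); apply: eq_bigr => i _; apply: eq_bigr => j _; rewrite fz.
Qed.

End LocalTest.

(** * Pointwise limits of the local test functions *)

Section LimitTest.
Context {R : realType} {n : nat}.
Variables (r : 'I_n -> 'I_n -> R) (m : 'I_n -> R) (b : R).
Hypothesis r0 : forall i j, 0 <= r i j.
Hypothesis irr : irreducible_rate r.
Hypothesis stm : is_stationary r m.
Hypothesis b1 : 1 <= b.
Local Notation E := 'rV[R]_n.
Implicit Types (x : E) (A : {set 'I_n}).

Definition awayb A (d : R) x := [forall k, (k \notin A) ==> (d <= x ord0 k)].

Lemma awayP A d x : reflect (away A d x) (awayb A d x).
Proof.
apply: (iffP forallP) => H k; first by move=> kA; move: (H k); rewrite kA.
by apply/implyP => kA; exact: H.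
Qed.

(** The scales tend to 0 with [K * t <= e], which keeps [y] within [e] of u. For a fixed [x], each
    mass of [A] is eventually 0 or above [K * t], so the exact formula for the generator applies
    from some index on. *)
Lemma limit_test A (d : R) : A != finset.setT -> 0 < d ->
  exists (ga : 'I_n -> R) (kap a0 a1 a2 P : E -> R) (eta K c d' : R),
  local_data A d ga kap a0 a1 a2 P eta K c d' /\
    (forall p p1 p2, C2R p p1 p2 ->
      (forall w, eta <= w -> [/\ p w = 0, p1 w = 0 & p2 w = 0]) ->
      forall e, 0 < e -> exists (F G : nat -> E -> R) (L : E -> R),
      [/\ forall i, [/\ dom_S r m b (F i), continuous (F i), continuous (G i)
            & forall x, simplex x -> gen r m b (F i) x = G i x],
        forall i x, simplex x -> exists2 y, lin ga x <= y <= lin ga x + e &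
        [/\ `|F i x| <= `|p y|,
           `|G i x| <= K * (`|p y| + `|p1 y| + `|p2 y|) * (1 + pot A x)
         & away A d' x \/ (F i x = 0 /\ G i x = 0)],
        forall x, simplex x -> F^~ x @ \oo --> p (lin ga x) * kap x /\
           G^~ x @ \oo --> L x,
        forall x, simplex x ->
           `|L x| <= K * (`|p (lin ga x)| + `|p1 (lin ga x)| + `|p2 (lin ga x)|) * (1 + pot A x)
      & forall x, L x = if awayb A d' x then
           p (lin ga x) * a0 x + p1 (lin ga x) * a1 x + p2 (lin ga x) * a2 x else 0]).
Proof.
move=> AT d0.
have [ga [kap [a0 [a1 [a2 [P [eta [K [c [d' [HD H5]]]]]]]]]]] :=
  local_test r0 irr stm b1 AT d0.
exists ga, kap, a0, a1, a2, P, eta, K, c, d'; split=> // p p1 p2 Cp pv e e0.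
have [[_ K0 _ _] _ H3 _] := HD.
have [cp cp1 cp2] := C2R_continuous Cp.
pose t i : R := e / K * i.+1%:R^-1.
have t0 i : 0 < t i by rewrite mulr_gt0 ?invr_gt0 ?ltr0n ?divr_gt0.
have Kt i : K * t i = e * i.+1%:R^-1.
  by rewrite /t mulrA mulrCA divff ?mulr1// gt_eqF.
have tc : (fun i => K * t i) @ \oo --> (0 : R).
  rewrite (_ : (fun i => _) = (fun i => e * i.+1%:R^-1)); last by apply/funext.
  rewrite -(mulr0 e); apply: cvgM; first exact: cvg_cst.
  exact: cvg_harmonic.
have [FG HFG] := @choice _ _ (fun i (FG : (E -> R) * (E -> R)) =>
  [/\ dom_S r m b FG.1, continuous FG.1, continuous FG.2,
        forall x, simplex x -> gen r m b FG.1 x = FG.2 x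
      & forall x, simplex x -> exists2 y, lin ga x <= y <= lin ga x + K * t i &
        [/\ FG.1 x = p y * kap x,
           `|FG.2 x| <= K * (`|p y| + `|p1 y| + `|p2 y|) * (1 + pot A x),
           away A d' x \/ (FG.1 x = 0 /\ FG.2 x = 0)
         & (forall k, k \in A -> x ord0 k = 0 \/ K * t i < x ord0 k) ->
           FG.2 x = p y * a0 x + p1 y * a1 x + p2 y * a2 x]])
  (fun i => let: ex_intro F (ex_intro G H) := H5 p p1 p2 Cp pv (t i) (t0 i) in
     ex_intro _ (F, G) H).
have xlim x : simplex x ->
   (fun i => (FG i).1 x) @ \oo --> p (lin ga x) * kap x /\
   (fun i => (FG i).2 x) @ \oo --> (if awayb A d' x then
           p (lin ga x) * a0 x + p1 (lin ga x) * a1 x + p2 (lin ga x) * a2 x else 0) /\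
   `|if awayb A d' x then
           p (lin ga x) * a0 x + p1 (lin ga x) * a1 x + p2 (lin ga x) * a2 x else 0| <=
   K * (`|p (lin ga x)| + `|p1 (lin ga x)| + `|p2 (lin ga x)|) * (1 + pot A x).
  move=> sx.
  have [y Hy] := @choice _ _ (fun i y => lin ga x <= y <= lin ga x + K * t i /\
        [/\ (FG i).1 x = p y * kap x,
           `|(FG i).2 x| <= K * (`|p y| + `|p1 y| + `|p2 y|) * (1 + pot A x),
           away A d' x \/ ((FG i).1 x = 0 /\ (FG i).2 x = 0)
         & (forall k, k \in A -> x ord0 k = 0 \/ K * t i < x ord0 k) ->
           (FG i).2 x = p y * a0 x + p1 y * a1 x + p2 y * a2 x])
    (fun i => let: And5 _ _ _ _ h := HFG i in let: ex_intro2 y h1 h2 := h x sx in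
       ex_intro _ y (conj h1 h2)).
  have yc : y @ \oo --> lin ga x.
    apply: (@squeeze_cvgr _ _ _ _ (fun=> lin ga x) (fun i => lin ga x + K * t i)).
    - by near=> i; exact: (Hy i).1.
    - exact: cvg_cst.
    - by rewrite -[X in _ --> X](addr0 (lin ga x)); apply: cvgD => //; exact: cvg_cst.
  have py : p \o y @ \oo --> p (lin ga x) by apply: continuous_cvg => //; exact: cp.
  have py1 : p1 \o y @ \oo --> p1 (lin ga x) by apply: continuous_cvg => //; exact: cp1.
  have py2 : p2 \o y @ \oo --> p2 (lin ga x) by apply: continuous_cvg => //; exact: cp2.
  have G2 : (fun i => (FG i).2 x) @ \oo --> (if awayb A d' x then
           p (lin ga x) * a0 x + p1 (lin ga x) * a1 x + p2 (lin ga x) * a2 x else 0).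
    case: ifPn => [aw|/awayP naw]; last first.
      apply: cvg_near_cst; near=> i.
      by have [_ [_ _ [//|[]]]] := Hy i.
    have h : \forall i \near \oo, (forall k, k \in A -> x ord0 k = 0 \/ K * t i < x ord0 k).
      have h k : \forall i \near \oo, x ord0 k = 0 \/ K * t i < x ord0 k.
        have : 0 <= x ord0 k by case: sx.
        rewrite le_eqVlt => /predU1P[<-|xk]; first by near=> i; left.
        by near=> i; right; near: i; exact: (cvgr_lt _ tc).
      have := @filter_forall nat 'I_n (fun k i => x ord0 k = 0 \/ K * t i < x ord0 k) _ _ h.
      by move=> h'; near=> i; move=> k _; move: k; near: i; exact: h'.
    apply: (@cvg_trans _ ((fun i => (p \o y) i * a0 x + (p1 \o y) i * a1 x + (p2 \o y) i * a2 x) @ \oo)).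
      apply: near_eq_cvg; near=> i.
      have [_ [_ _ _ ->//]] := Hy i.
      by near: i.
    by do !apply: cvgD; apply: cvgM => //; exact: cvg_cst.
  split; [|split=> //].
    rewrite (_ : (fun i => _) = (fun i => (p \o y) i * kap x)); last first.
      by apply/funext => i /=; have [_ []] := Hy i.
    by apply: cvgM => //; exact: cvg_cst.
  apply: (@ler_cvg_to _ \oo _ _ (fun i => `|(FG i).2 x|)
    (fun i => K * (`|(p \o y) i| + `|(p1 \o y) i| + `|(p2 \o y) i|) * (1 + pot A x))).
  - exact: cvg_norm G2.
  - apply: cvgM; last exact: cvg_cst.
    apply: cvgM; first exact: cvg_cst.
    by do !apply: cvgD; apply: cvg_norm.
  - by near=> i; have [_ []] := Hy i.
exists (fun i => (FG i).1), (fun i => (FG i).2), (fun x => if awayb A d' x then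
           p (lin ga x) * a0 x + p1 (lin ga x) * a1 x + p2 (lin ga x) * a2 x else 0); split=> //.
- by move=> i; have [] := HFG i.
- move=> i x sx; have [_ _ _ _ /(_ x sx)[y /andP[y1 y2] [F1 G1 aw _]]] := HFG i.
  exists y.
    rewrite y1 (le_trans y2)// lerD2l Kt ler_piMr ?(ltW e0)//.
    by rewrite invf_le1 ?ltr0n ?ler1n.
  split=> //; rewrite F1 normrM ler_piMr//.
  by have [_ /(_ x sx)[/andP[k0 k1] _]] := H3; rewrite ger0_norm.
- by move=> x sx; have [? []] := xlim x sx.
- by move=> x sx; have [_ []] := xlim x sx.
Unshelve. all: by end_near. Qed.

End LimitTest.

(** * Profiles for the coercive estimate *)

Section Profile.
Context {R : realType}.

Lemma C2R_dilate (p p1 p2 : R -> R) (k : R) : C2R p p1 p2 ->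
  C2R (fun t => p (k * t)) (fun t => k * p1 (k * t)) (fun t => k ^+ 2 * p2 (k * t)).
Proof.
by move=> /(C2R_affine k 0); congr C2R; apply/funext => t; rewrite addr0.
Qed.

Lemma cutoff (eta : R) : 0 < eta -> exists z z1 z2 : R -> R, [/\ C2R z z1 z2,
    forall w, eta <= w -> [/\ z w = 0, z1 w = 0 & z2 w = 0],
    forall w, w <= eta / 4 -> [/\ z w = 1, z1 w = 0 & z2 w = 0]
  & forall w, [/\ 0 <= z w <= 1, `|z1 w| <= 4 / eta & `|z2 w| <= 16 / eta ^+ 2]].
Proof.
move=> n0.
have Cz := C2R_add (C2R_cst 1) (C2R_scale (- 1) (C2R_dilate (4 / eta) C2R_st)).
exists (fun w => 1 + - 1 * st (4 / eta * w)), (fun w => 0 + - 1 * (4 / eta * st1 (4 / eta * w))),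
  (fun w => 0 + - 1 * ((4 / eta) ^+ 2 * st2 (4 / eta * w))); split=> // w.
- move=> ew; have [|-> -> ->] := @st_ge4 _ (4 / eta * w).
    by rewrite -mulrA ler_peMr// mulrC ler_pdivlMr ?mul1r.
  by split; ring.
- move=> ew; have [|-> -> ->] := @st_le1 _ (4 / eta * w).
    by rewrite -ler_pdivlMl ?divr_gt0// mulr1 invf_div.
  by split; ring.
have [/andP[h0 h1] /andP[h2 h3] h4] := st_itv (4 / eta * w).
have ai : 0 <= 4 / eta by rewrite divr_ge0 ?(ltW n0).
split.
- by apply/andP; split; lra.
- by rewrite add0r mulN1r normrN normrM (ger0_norm ai) (ger0_norm h2) ler_piMr.
- rewrite add0r mulN1r normrN normrM ger0_norm ?exprn_ge0//.
  have -> : 16 / eta ^+ 2 = (4 / eta) ^+ 2 by field; rewrite gt_eqF.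
  by rewrite ler_piMr// exprn_ge0.
Qed.

(* [p w = eps * ramp (w / eps) * st (w / a) * (1 - st (4 * w / eta))]: the first
   factor yields the coercivity, the second one removes a neighbourhood of [0]
   and the third one localizes. *)
Lemma profile (eta eps a : R) : 0 < eta -> 0 < eps <= eta / 8 -> 0 < a <= eta / 16 ->
  exists (p p1 p2 : R -> R) (M : R), [/\ C2R p p1 p2,
    forall w, 0 <= w -> 0 <= p w <= eta /\ `|p w| + `|p1 w| + `|p2 w| <= M,
    forall w, w <= a \/ eta <= w -> [/\ p w = 0, p1 w = 0 & p2 w = 0],
    forall w, 0 <= w <= 4 * a -> 0 <= p1 w <= 5 /\ p2 w <= 17 / eps
  & (forall w, 4 * a <= w <= eta / 4 ->
       p1 w = ramp1 (eps^-1 * w) /\ p2 w = eps^-1 * ramp2 (eps^-1 * w)) /\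
    (forall w, eta / 4 <= w -> `|p w| + `|p1 w| + `|p2 w| <= eta + 5 + 24 / eta)].
Proof.
move=> n0 /andP[e0 en] /andP[a0 an].
pose f w := eps * ramp (eps^-1 * w).
pose f1 w := eps * (eps^-1 * ramp1 (eps^-1 * w)).
pose f2 w := eps * (eps^-1 ^+ 2 * ramp2 (eps^-1 * w)).
pose s w := st (a^-1 * w).
pose s1 w := a^-1 * st1 (a^-1 * w).
pose s2 w := a^-1 ^+ 2 * st2 (a^-1 * w).
have [z [z1 [z2 [Cz sz0 sz1 bz]]]] := cutoff n0.
have Cf : C2R f f1 f2 by apply: C2R_scale; apply: C2R_dilate; exact: C2R_ramp.
have Cs : C2R s s1 s2 by apply: C2R_dilate; exact: C2R_st.
have := C2R_mul (C2R_mul Cf Cs) Cz.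
set p := (fun t => f t * s t * z t).
set p1 := (X in C2R _ X _); set p2 := (X in C2R _ _ X) => Cp.
have ss0 w : w <= a -> [/\ s w = 0, s1 w = 0 & s2 w = 0].
  move=> wa; have [|h1 h2 h3] := @st_le1 _ (a^-1 * w).
    by rewrite ler_pdivrMl// mulr1.
  by rewrite /s /s1 /s2 h1 h2 h3; split; ring.
have ss1 w : 4 * a <= w -> [/\ s w = 1, s1 w = 0 & s2 w = 0].
  move=> wa; have [|h1 h2 h3] := @st_ge4 _ (a^-1 * w).
    by rewrite ler_pdivlMl// mulrC.
  by rewrite /s /s1 /s2 h1 h2 h3; split; ring.
have sf w : 2 * eps <= w -> [/\ f w = w - 2 / 3 * eps, f1 w = 1 & f2 w = 0].
  move=> wa; have [|h1 h2 h3] := @ramp_ge2 _ (eps^-1 * w).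
    by rewrite ler_pdivlMl// mulrC.
  rewrite /f /f1 /f2 h1 h2 h3; split; last by ring.
    by field; rewrite gt_eqF.
  by field; rewrite gt_eqF.
have bf w : 0 <= w -> [/\ 0 <= f w <= w, f w <= 2^-1 * w ^+ 2 / eps, 0 <= f1 w <= 1,
     f1 w <= w / eps & 0 <= f2 w <= eps^-1].
  move=> w0; have [|/andP[r1 r2] r3 /andP[r4 r5] r6 [/andP[r7 r8] _]] := @ramp_prop _ (eps^-1 * w).
    by rewrite mulr_ge0 ?invr_ge0 ?(ltW e0).
  have -> : f1 w = ramp1 (eps^-1 * w) by rewrite /f1 mulrA divff ?mul1r// gt_eqF.
  have -> : f2 w = eps^-1 * ramp2 (eps^-1 * w) by rewrite /f2; field; rewrite gt_eqF.
  split; rewrite /f.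
  - by rewrite mulr_ge0 ?(ltW e0)//= mulrC -ler_pdivlMr// [w / _]mulrC.
  - rewrite -ler_pdivlMl// (le_trans r3)//.
    by rewrite le_eqVlt; apply/orP; left; apply/eqP; field; rewrite gt_eqF.
  - by rewrite r4.
  - by rewrite [w / _]mulrC.
  - by rewrite mulr_ge0 ?invr_ge0 ?(ltW e0)//= ler_piMr// invr_ge0 ltW.
have bs w : [/\ 0 <= s w <= 1, 0 <= s1 w <= a^-1 & `|s2 w| <= a^-1 ^+ 2].
  have [h1 /andP[h2 h3] h4] := st_itv (a^-1 * w).
  have ai : 0 <= a^-1 by rewrite invr_ge0 ltW.
  split=> //; first by rewrite mulr_ge0//= ler_piMr.
  by rewrite normrM ger0_norm ?exprn_ge0// ler_piMr// exprn_ge0.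
have A0 w : w <= a \/ eta <= w -> [/\ p w = 0, p1 w = 0 & p2 w = 0].
  by move=> [/ss0|/sz0] [h1 h2 h3]; rewrite /p /p1 /p2 h1 h2 h3; split; ring.
have P0 w : 0 <= w -> 0 <= p w <= eta.
  move=> w0; have [wn|wn] := leP w eta; last by have [|-> _ _] := A0 w; [right; exact: ltW|rewrite lexx ltW].
  have [/andP[h1 h2] _ _ _ _] := bf w w0.
  have [/andP[h3 h4] _ _] := bs w; have [/andP[h5 h6] _ _] := bz w.
  apply/andP; split; first exact: mulr_ge0 (mulr_ge0 h1 h3) h5.
  by rewrite (le_trans _ wn)// (le_trans _ h2)// /p -mulrA ler_piMr// mulr_ile1.
(* 5 = 1 + 4 and 17 = 1 + 2 * 4 + 8 add up the Leibniz terms, by w / a <= 4. As the ramp is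
   quadratic near 0, the bound on p'' does not involve [a]. *)
have C w : 0 <= w <= 4 * a -> 0 <= p1 w <= 5 /\ `|p2 w| <= 17 / eps.
  move=> /andP[w0 w4].
  have [|h1 h2 h3] := sz1 w; first by lra.
  have [/andP[k0 k1] k2 /andP[k3 k4] k5 /andP[k6 k7]] := bf w w0.
  have [/andP[l0 l1] /andP[l2 l3] l4] := bs w.
  rewrite /p1 /p2 h1 h2 h3 !mulr1 !mulr0 !addr0.
  have wa : w / a <= 4 by rewrite ler_pdivrMr.
  have wa0 : 0 <= w / a by rewrite divr_ge0 ?(ltW a0).
  have fs : 0 <= f w * s1 w <= 4.
    by rewrite (mulr_ge0 k0 l2) /= (le_trans _ wa)// ler_pM.
  have ei : 0 <= eps^-1 by rewrite invr_ge0 ltW.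
  split.
    case/andP: fs => fs0 fs4; rewrite (addr_ge0 (mulr_ge0 k3 l0) fs0) /=.
    have -> : 5 = 1 + 4 :> R by ring.
    exact: lerD (mulr_ile1 k3 l0 k4 l1) fs4.
  have e1 : 0 <= f2 w * s w <= eps^-1.
    by rewrite (mulr_ge0 k6 l0) /= (le_trans _ k7)// ler_piMr.
  have e2 : 0 <= f1 w * s1 w <= 4 / eps.
    rewrite (mulr_ge0 k3 l2) /= (le_trans (ler_pM k3 l2 k5 l3))//.
    by rewrite mulrAC ler_wpM2r.
  have e3 : `|f w * s2 w| <= 8 / eps.
    rewrite normrM (ger0_norm k0) (le_trans (ler_pM k0 _ k2 l4))//.
    have -> : 2^-1 * w ^+ 2 / eps * a^-1 ^+ 2 = (w / a) ^+ 2 / 2 / eps.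
      by field; rewrite !gt_eqF.
    rewrite ler_wpM2r//.
    have : (w / a) ^+ 2 <= 4 ^+ 2 by rewrite lerXn2r ?nnegrE.
    by lra.
  rewrite (le_trans (ler_normD _ _))// (le_trans (lerD (ler_normD _ _) (lexx _)))//.
  move: e1 e2 e3 => /andP[e1 e1'] /andP[e2 e2'] e3.
  rewrite (ger0_norm e1) (ger0_norm (mulr_ge0 (ler0n _ 2) e2)).
  have -> : 17 / eps = eps^-1 + 2 * (4 / eps) + 8 / eps by ring.
  by rewrite !lerD// ler_wpM2l.
have I w : 4 * a <= w <= eta / 4 ->
       p1 w = ramp1 (eps^-1 * w) /\ p2 w = eps^-1 * ramp2 (eps^-1 * w).
  move=> /andP[/ss1[h1 h2 h3] /sz1[k1 k2 k3]].
  rewrite /p1 /p2 h1 h2 h3 k1 k2 k3 !mulr1 !mulr0 !addr0.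
  by rewrite /f1 /f2; split; field; rewrite gt_eqF.
(* Since 2 eps and 4 a are at most eta / 4, the ramp is affine and the inner step constant here: the
   bound depends on [eta] only. *)
have J w : eta / 4 <= w -> `|p w| + `|p1 w| + `|p2 w| <= eta + 5 + 24 / eta.
  move=> w4; have [wn|wn] := leP eta w.
    have [|-> -> ->] := A0 w; first by right.
    by rewrite !normr0 !addr0 !addr_ge0 ?divr_ge0 ?(ltW n0).
  have w0 : 0 <= w by rewrite (le_trans _ w4)// divr_ge0 ?(ltW n0).
  have /andP[q0 q1] := P0 w w0.
  have [|g1 g2 g3] := sf w; first by lra.
  have [|h1 h2 h3] := ss1 w; first by lra.
  have [/andP[k0 k1] k2 k3] := bz w.
  rewrite (ger0_norm q0) /p1 /p2 g2 g3 h1 h2 h3.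
  rewrite !mulr1 !mulr0 !addr0 !mul0r !add0r !mul1r.
  have [/andP[fw0 fw1] _ _ _ _] := bf w w0.
  have fz1 : `|f w * z1 w| <= 4.
    rewrite normrM (ger0_norm fw0) (le_trans (ler_pM fw0 _ fw1 k2))//.
    by rewrite mulrCA ler_piMr// ler_pdivrMr// mul1r ltW.
  have fz2 : `|f w * z2 w| <= 16 / eta.
    rewrite normrM (ger0_norm fw0) (le_trans (ler_pM fw0 _ fw1 k3))//.
    have -> : w * (16 / eta ^+ 2) = (16 / eta) * (w / eta) by field; rewrite gt_eqF.
    by rewrite ler_piMr ?divr_ge0 ?(ltW n0)// ler_pdivrMr// mul1r ltW.
  have -> : eta + 5 + 24 / eta = eta + (1 + 4) + (2 * (4 / eta) + 16 / eta) by ring.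
  apply: lerD; [apply: lerD => //|].
    by rewrite (le_trans (ler_normD _ _))// lerD// ger0_norm.
  by rewrite (le_trans (ler_normD _ _))// lerD// normrM ger0_norm// ler_wpM2l.
exists p, p1, p2, (eta + 5 + 24 / eta + 17 / eps); split=> //.
- move=> w w0; split; first exact: P0.
  have [w4|w4] := leP (eta / 4) w.
    by rewrite (le_trans (J w w4))// lerDl divr_ge0 ?(ltW e0).
  have [wa|wa] := leP w (4 * a).
    have [|/andP[h1 h2] h3] := C w; first by rewrite w0.
    have /andP[h4 h5] := P0 w w0.
    have : 0 <= 24 / eta by rewrite divr_ge0 ?(ltW n0).
    by rewrite (ger0_norm h1) (ger0_norm h4) => h6; lra.
  have [|-> ->] := I w; first by rewrite !ltW.
  have [|_ _ /andP[g1 g2] _ [/andP[g3 g4] _]] := @ramp_prop _ (eps^-1 * w).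
    by rewrite mulr_ge0 ?invr_ge0 ?(ltW e0).
  have /andP[h4 h5] := P0 w w0.
  have ei : 0 < eps^-1 by rewrite invr_gt0.
  have h7 : 0 <= eps^-1 * ramp2 (eps^-1 * w) <= eps^-1.
    by rewrite mulr_ge0 ?(ltW ei)//= ler_piMr// ltW.
  have h6 : 0 <= 24 / eta by rewrite divr_ge0 ?(ltW n0).
  rewrite (ger0_norm h4) (ger0_norm g1) ger0_norm; last by case/andP: h7.
  by case/andP: h7; lra.
- by move=> w /C[h1 h2]; split=> //; rewrite (le_trans (ler_norm _)).
Qed.

End Profile.

(** * Integrability of the singular drift *)

Section RealIntegrals.
Context d (Z : measurableType d) (R : realType).
Variables (mu : {measure set Z -> \bar R}) (D : set Z).
Hypothesis mD : measurable D.
Implicit Types f g : Z -> R.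

Lemma integrable_EFin f : measurable_fun D f ->
  (\int[mu]_(x in D) `|(f x)%:E| < +oo)%E -> mu.-integrable D (EFin \o f).
Proof. by move=> mf h; apply/integrableP; split=> //; exact/measurable_EFinP. Qed.

Lemma integrable_measurable f : mu.-integrable D (EFin \o f) -> measurable_fun D f.
Proof. by move=> /integrableP[/measurable_EFinP]. Qed.

Lemma integrable_cst (k : R) : (mu D < +oo)%E -> mu.-integrable D (EFin \o (fun=> k)).
Proof.
move=> h; apply: integrable_EFin; first exact: measurable_cst.
have := integral_cst mu mD (`|k|%:E); rewrite /cst /= => ->.
by rewrite lte_mul_pinfty ?lee_fin.
Qed.

Lemma integrable_add f g : mu.-integrable D (EFin \o f) -> mu.-integrable D (EFin \o g) ->
  mu.-integrable D (EFin \o (fun x => f x + g x)).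
Proof. by move=> hf hg; exact: (integrableD mD hf hg). Qed.

Lemma integrable_scale (k : R) f : mu.-integrable D (EFin \o f) ->
  mu.-integrable D (EFin \o (fun x => k * f x)).
Proof. by move=> hf; exact: (integrableZl mD k hf). Qed.

Lemma integrable_bigsum I (s : seq I) (Q : pred I) (f : I -> Z -> R) :
  (forall i, Q i -> mu.-integrable D (EFin \o f i)) ->
  mu.-integrable D (EFin \o (fun x => \sum_(i <- s | Q i) f i x)).
Proof.
move=> H; have := integrable_sum mD s H.
by congr (mu.-integrable _ _); apply/funext => x /=; rewrite sumEFin.
Qed.

Lemma integrable_le f g : measurable_fun D f -> (forall x, D x -> `|f x| <= g x) ->
  mu.-integrable D (EFin \o g) -> mu.-integrable D (EFin \o f).
Proof.
move=> mf fg; apply: le_integrable => //; first exact/measurable_EFinP.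
by move=> x Dx /=; rewrite lee_fin (le_trans (fg x Dx))// ler_norm.
Qed.

Lemma dominated_Rintegral (f : nat -> Z -> R) g h :
  (forall i, measurable_fun D (f i)) ->
  (forall x, D x -> f^~ x @ \oo --> g x) ->
  (forall i x, D x -> `|f i x| <= h x) -> mu.-integrable D (EFin \o h) ->
  mu.-integrable D (EFin \o g) /\
  (fun i => \int[mu]_(x in D) f i x) @ \oo --> \int[mu]_(x in D) g x.
Proof.
move=> mf fg fh ih.
have mg : measurable_fun D g by apply: (measurable_fun_cvg mf fg).
have ig : mu.-integrable D (EFin \o g).
  apply: integrable_le ih => // x Dx.
  by apply: (@cvgr_to_le _ _ _ _ _ _ _ (cvg_norm (fg x Dx))); near=> i; exact: fh.
split=> //.
have [] := @dominated_convergence _ _ _ mu D mD (fun i => EFin \o f i) (EFin \o g) (EFin \o h).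
- by move=> i; exact/measurable_EFinP.
- exact/measurable_EFinP.
- by apply/aeW => x Dx; apply: cvg_EFin; [exact: nearW|exact: fg].
- exact: ih.
- by apply/aeW => x i Dx /=; rewrite lee_fin fh.
move=> _ _ H; apply: fine_cvg; rewrite fineK; last exact: integrable_fin_num.
exact: H.
Unshelve. all: by end_near. Qed.

Lemma fatou_Rintegral (f : nat -> Z -> R) g (C : R) :
  (forall i, mu.-integrable D (EFin \o f i)) ->
  (forall i x, D x -> 0 <= f i x) ->
  (forall x, D x -> f^~ x @ \oo --> g x) ->
  (forall i, \int[mu]_(x in D) f i x <= C) -> mu.-integrable D (EFin \o g).
Proof.
move=> If f0 fg fC.
have mf i : measurable_fun D (f i) := integrable_measurable (If i).
have mg : measurable_fun D g by apply: (measurable_fun_cvg mf fg).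
have g0 x : D x -> 0 <= g x.
  by move=> Dx; apply: (@cvgr_to_ge _ _ _ _ _ _ _ (fg x Dx)); near=> i; exact: f0.
apply: integrable_EFin => //.
have := @fatou _ _ _ mu D mD (fun i => EFin \o f i)
  (fun i => proj2 (measurable_EFinP _ _) (mf i)) (fun i x Dx => f0 i x Dx).
rewrite (eq_integral (fun x => `|(g x)%:E|%E)); last first.
  move=> x /set_mem Dx; rewrite gee0_abs ?lee_fin ?g0//.
  by apply: (cvg_limn_einf_sup _).1; apply: cvg_EFin; [exact: nearW|exact: fg].
move=> /le_lt_trans; apply; rewrite limn_einf_lim.
apply: (@le_lt_trans _ _ C%:E); last exact: ltry.
apply: lime_le; first exact: is_cvg_einfs.
near=> i; apply: (@le_trans _ _ (\int[mu]_(x in D) (f i x)%:E)%E).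
  by apply: ereal_inf_lbound; exists i => //=.
by rewrite -(fineK (integrable_fin_num mD (If i))) lee_fin; exact: fC.
Unshelve. all: by end_near. Qed.

End RealIntegrals.

Section Measurability.
Context d (Z : measurableType d) (R : realType).
Implicit Types f : Z -> R.

Lemma measurable_continuous_comp (h : R -> R) f : continuous h ->
  measurable_fun setT f -> measurable_fun setT (fun z => h (f z)).
Proof. by move=> /continuous_measurable_fun ch mf; exact: (measurableT_comp ch mf). Qed.

Lemma measurable_funV f : measurable_fun setT f -> measurable_fun setT (fun z => (f z)^-1).
Proof.
(* x / (x^2 + 1 / (i + 1)) is continuous and tends to x^-1, also at 0, where x^-1 is 0. *)
move=> mf; pose h (i : nat) (x : R) := x * (x ^+ 2 + i.+1%:R^-1)^-1.
apply: (@measurable_fun_cvg _ _ _ _ (fun i z => h i (f z))).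
  move=> i; apply: measurable_continuous_comp mf.
  apply: ctsM; [by move=> x; exact: cvg_id|apply: ctsV => [x|]].
    by rewrite gt_eqF// ltr_wpDl ?sqr_ge0// invr_gt0.
  by apply: ctsD; [exact: exprn_continuous|exact: cts_cst].
rewrite /h => z _; have [->|x0] := eqVneq (f z) 0.
  by rewrite invr0; under eq_fun do rewrite mul0r; exact: cvg_cst.
have -> : (f z)^-1 = f z * ((f z) ^+ 2 + 0)^-1 by field; rewrite x0.
apply: cvgM; first exact: cvg_cst.
apply: cvgV; first by rewrite addr0 expf_neq0.
by apply: cvgD; [exact: cvg_cst|exact: cvg_harmonic].
Qed.

Lemma measurable_forall (I : finType) (c : I -> Z -> bool) :
  (forall i, measurable_fun setT (c i)) -> measurable_fun setT (fun z => [forall i, c i z]).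
Proof.
move=> H; apply: (@measurable_fun_bool _ _ _ _ true); rewrite setTI.
rewrite (_ : _ @^-1` _ = \bigcap_(i in setT) (c i @^-1` [set true])).
  apply: fin_bigcap_measurable; first exact: finite_finset.
  by move=> i _; rewrite -[X in measurable X]setTI; exact: H.
by apply/seteqP; split=> [z /forallP h i _|z h]; [exact: h|apply/forallP => i; exact: h].
Qed.

End Measurability.

Section Observables.
Context d (Z : measurableType d) (R : realType) (n : nat).
Variable X : Z -> 'rV[R]_n.
Hypothesis mX : forall g : 'rV[R]_n -> R, continuous g -> measurable_fun setT (g \o X).
Implicit Types (A : {set 'I_n}).

Lemma measurable_coordX k : measurable_fun setT (fun z => X z ord0 k).
Proof. by apply: (mX (g := fun x => x ord0 k)); exact: cts_coord. Qed.

Lemma measurable_linX (a : 'I_n -> R) : measurable_fun setT (fun z => lin a (X z)).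
Proof. by apply: (mX (g := lin a)); exact: continuous_lin. Qed.

Lemma measurable_potX A : measurable_fun setT (fun z => pot A (X z)).
Proof.
rewrite /pot; under eq_fun do rewrite big_mkcond.
apply: measurable_sum => k; case: (k \in A); last exact: measurable_cst.
by apply: measurable_funV; exact: measurable_coordX.
Qed.

Lemma measurable_awayX A (e : R) : measurable_fun setT (fun z => awayb A e (X z)).
Proof.
apply: measurable_forall => k; case: (k \notin A) => /=.
  by apply: measurable_fun_ler; [exact: measurable_cst|exact: measurable_coordX].
exact: measurable_cst.
Qed.

End Observables.

Section Integrability.
Context d (Z : measurableType d) (R : realType) (n : nat).
Variables (r : 'I_n -> 'I_n -> R) (m : 'I_n -> R) (b : R).
Hypothesis r0 : forall i j, 0 <= r i j.
Hypothesis irr : irreducible_rate r.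
Hypothesis stm : is_stationary r m.
Hypothesis b1 : 1 <= b.
Local Notation E := 'rV[R]_n.
Implicit Types (x : E) (A : {set 'I_n}).

Definition local_pot A (e : R) x : R := if awayb A e x then pot A x else 0.

Lemma local_pot_ge0 A e x : simplex x -> 0 <= local_pot A e x.
Proof. by move=> sx; rewrite /local_pot; case: ifP => // _; exact: pot_ge0. Qed.

(** If u >= a, some site of [A] has mass at least a / (K (n + 1)), where n + 1 makes the
    contradiction strict. Taking it out of [A] costs a bounded term and leaves a smaller set for the
    induction; summing over all sites of [A] avoids choosing one. *)
Lemma pot_heavy A (ga : 'I_n -> R) (K d' a : R) x : simplex x ->
  (forall i, 0 <= ga i <= K) -> (forall i, i \notin A -> ga i = 0) ->
  0 < K -> 0 < d' -> 0 < a -> away A d' x -> a <= lin ga x ->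
  pot A x <= \sum_(k in A) ((a / (K * n.+1%:R))^-1 +
     local_pot (A :\ k) (Num.min d' (a / (K * n.+1%:R))) x).
Proof.
move=> sx gaK gaA K0 d0 a0 aw al; set a' := a / _.
have a'0 : 0 < a' by rewrite divr_gt0 ?mulr_gt0 ?ltr0n.
have [x0 _] := sx.
have [k kA kx] : exists2 k, k \in A & a' <= x ord0 k.
  apply: contrapT => H.
  have h k : k \in A -> x ord0 k <= a'.
    by move=> kA; rewrite leNgt; apply/negP => /ltW ?; apply: H; exists k.
  suff : lin ga x < a by rewrite ltNge al.
  apply: (@le_lt_trans _ _ (\sum_(i < n) K * a')).
    apply: ler_sum => i _; have /andP[g0 g1] := gaK i.
    have [iA|/gaA ->] := boolP (i \in A); last by rewrite mul0r mulr_ge0 ?ltW.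
    by apply: ler_pM => //; exact: h.
  rewrite sumr_const card_ord -mulr_natr /a'.
  have -> : K * (a / (K * n.+1%:R)) * n%:R = a * (n%:R / n.+1%:R).
    by field; rewrite !gt_eqF//= ltr0n.
  by rewrite gtr_pMr// ltr_pdivrMr ?ltr0n// mul1r ltr_nat.
have awk : awayb (A :\ k) (Num.min d' a') x.
  apply/awayP => j; rewrite !inE negb_and negbK ge_min => /orP[/eqP ->|/aw ->//].
  by rewrite kx orbT.
rewrite [leRHS](bigD1 k)//= {1}/local_pot awk.
have -> : pot A x = (x ord0 k)^-1 + pot (A :\ k) x.
  rewrite /pot (bigD1 k)//=; congr (_ + _); apply: eq_bigl => i.
  by rewrite !inE andbC.
rewrite -[leLHS]addr0; apply: lerD; first apply: lerD => //.
  by rewrite lef_pV2 ?posrE// (lt_le_trans a'0).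
by apply: sumr_ge0 => i _; rewrite addr_ge0 ?local_pot_ge0// invr_ge0 ltW.
Qed.

Variables (mu : {measure set Z -> \bar R}) (D : set Z) (X : Z -> E).
Hypothesis mD : measurable D.
Hypothesis muD : (mu D < +oo)%E.
Hypothesis sX : forall z, simplex (X z).
Hypothesis mX : forall g : E -> R, continuous g -> measurable_fun setT (g \o X).

Lemma measurable_local_pot A e : measurable_fun setT (fun z => local_pot A e (X z)).
Proof.
apply: measurable_fun_ifT; first exact: measurable_awayX.
  exact: measurable_potX.
exact: measurable_cst.
Qed.

Let mDf (f : Z -> R) : measurable_fun setT f -> measurable_fun D f.
Proof. exact: measurable_funTS. Qed.

Definition heavy A (ga : 'I_n -> R) (d' a : R) x : R :=
  if awayb A d' x && (a <= lin ga x) then 1 + pot A x else 0.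

Lemma measurable_heavy A ga d' a : measurable_fun setT (fun z => heavy A ga d' a (X z)).
Proof.
apply: measurable_fun_ifT.
- apply: measurable_and; first exact: measurable_awayX.
  by apply: measurable_fun_ler; [exact: measurable_cst|exact: measurable_linX].
- by apply: measurable_funD; [exact: measurable_cst|exact: measurable_potX].
- exact: measurable_cst.
Qed.

Lemma heavy_ge0 A ga d' a x : simplex x -> 0 <= heavy A ga d' a x.
Proof. by move=> sx; rewrite /heavy; case: ifP => // _; rewrite addr_ge0 ?pot_ge0. Qed.

Lemma integrable_heavy A ga (K d' a : R) :
  (forall k e, k \in A -> 0 < e ->
     mu.-integrable D (EFin \o (fun z => local_pot (A :\ k) e (X z)))) ->
  (forall i, 0 <= ga i <= K) -> (forall i, i \notin A -> ga i = 0) ->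
  0 < K -> 0 < d' -> 0 < a ->
  mu.-integrable D (EFin \o (fun z => heavy A ga d' a (X z))).
Proof.
move=> IH gaK gaA K0 d0 a0.
have a'0 : 0 < a / (K * n.+1%:R) by rewrite divr_gt0 ?mulr_gt0 ?ltr0n.
apply: (@integrable_le _ _ _ _ _ _ _ (fun z => 1 + \sum_(k in A) ((a / (K * n.+1%:R))^-1 +
     local_pot (A :\ k) (Num.min d' (a / (K * n.+1%:R))) (X z)))).
- exact: mD.
- exact/mDf/measurable_heavy.
- move=> z _; rewrite ger0_norm ?heavy_ge0// /heavy; case: ifPn => [/andP[/awayP aw al]|_].
    by rewrite lerD2l; exact: pot_heavy.
  by rewrite addr_ge0// sumr_ge0// => k _; rewrite addr_ge0 ?local_pot_ge0// invr_ge0 ltW.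
- apply: integrable_add => //; first exact: integrable_cst.
  apply: integrable_bigsum => // k kA; apply: integrable_add => //.
    exact: integrable_cst.
  by apply: IH => //; rewrite lt_min d0 a'0.
Qed.

(** All that this section uses of the martingale problem: for an occupation measure, the integral is
    a difference of two expectations of [F]. *)
Hypothesis OI : forall F G (M : R), dom_S r m b F -> continuous F -> continuous G ->
  (forall x, simplex x -> gen r m b F x = G x) ->
  (forall x, simplex x -> `|F x| <= M) ->
  `|\int[mu]_(z in D) G (X z)| <= 2 * M.

Lemma limit_occupation (F G : nat -> E -> R) (L H : E -> R) (M : R) :
  (forall i, [/\ dom_S r m b (F i), continuous (F i), continuous (G i)
            & forall x, simplex x -> gen r m b (F i) x = G i x]) ->
  (forall i x, simplex x -> `|F i x| <= M) ->
  (forall x, simplex x -> G^~ x @ \oo --> L x) ->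
  (forall i x, simplex x -> `|G i x| <= H x) ->
  mu.-integrable D (EFin \o (fun z => H (X z))) ->
  mu.-integrable D (EFin \o (fun z => L (X z))) /\ `|\int[mu]_(z in D) L (X z)| <= 2 * M.
Proof.
move=> HFG FM GL GH iH.
have [|||//|iL cL] := @dominated_Rintegral _ _ _ mu _ mD (fun i z => G i (X z))
  (fun z => L (X z)) (fun z => H (X z)).
- by move=> i; apply: mDf; apply: mX; have [] := HFG i.
- by move=> z _; exact: GL.
- by move=> i z _; exact: GH.
split=> //; apply: (@cvgr_to_le _ _ _ _ _ _ _ (cvg_norm cL)); near=> i.
by have [h1 h2 h3 h4] := HFG i; apply: OI h4 _ => // x; exact: FM.
Unshelve. all: by end_near. Qed.

(** The sets where 0 < f < 1 / (i + 1) decrease to the empty set, and [D] has finite measure. *)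
Lemma small_positive (f : Z -> R) (e : R) : measurable_fun setT f -> 0 < e ->
  exists2 a, 0 < a & forall a', a' <= a ->
    fine (mu ([set z | 0 < f z < a'] `&` D)) <= e.
Proof.
move=> mf e0.
have mS (a : R) : measurable ([set z | 0 < f z < a] `&` D).
  apply: measurableI => //; rewrite -[X in measurable X]setTI.
  rewrite (_ : [set z | _] = (fun z => (0 < f z) && (f z < a)) @^-1` [set true]) //.
  have : measurable_fun setT (fun z => (0 < f z) && (f z < a)).
    by apply: measurable_and; apply: measurable_fun_ltr => //; exact: measurable_cst.
  exact.
have fmu (a : R) : mu ([set z | 0 < f z < a] `&` D) \is a fin_num.
  rewrite ge0_fin_numE//; apply: le_lt_trans muD.
  by apply: le_measure; rewrite ?inE//; exact: mS.
pose F (i : nat) := [set z | 0 < f z < i.+1%:R^-1] `&` D.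
have F0 : \bigcap_i F i = set0.
  rewrite -subset0 => z Fz; have [/andP[f0 _] _] := Fz 0%N I.
  have [i _ /(_ i (leqnn _)) hi] := cvgr_lt _ (@cvg_harmonic R) _ f0.
  by have [/andP[_ fi] _] := Fz i I; have := lt_trans fi hi; rewrite ltxx.
have : mu \o F @ \oo --> mu (\bigcap_i F i).
  apply: nonincreasing_cvg_mu.
  - by rewrite -ge0_fin_numE//; exact: fmu.
  - by move=> i; exact: mS.
  - by rewrite F0; exact: measurable0.
  - move=> i j ij; apply/subsetPset => z [/andP[f0 fj] Dz]; split=> //.
    by rewrite /= f0 (lt_le_trans fj)// lef_pV2 ?posrE ?ltr0n// ler_nat ltnS.
rewrite F0 measure0 => /fine_cvg /(cvgr_le _) /(_ e e0) [i _ /(_ i (leqnn _)) /= hi].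
exists i.+1%:R^-1; first by rewrite invr_gt0 ltr0n.
move=> a' ha; apply: le_trans hi; apply: fine_le; [exact: fmu|exact: fmu|].
apply: le_measure; rewrite ?inE; [exact: mS|exact: mS|].
by move=> z [/= /andP[f0 fa] Dz]; split=> //=; rewrite f0 (lt_le_trans fa).
Qed.

(** A lower bound for the coercive term (p' - u p'') kap P, on the range of u where the profile is a
    pure ramp. *)
Let well_bound A c (ga : 'I_n -> R) (kap : E -> R) d' eta eps a x : R :=
  if awayb A d' x && ((4 * a <= lin ga x) && (lin ga x < eta / 4)) then
    Num.min (4^-1 * (eps^-1 * lin ga x) ^+ 2) 1 * (c * (kap x * pot A x)) else 0.

Let measurable_well A c ga kap d' eta eps a : continuous kap ->
  measurable_fun setT (fun z => well_bound A c ga kap d' eta eps a (X z)).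
Proof.
move=> ck; apply: measurable_fun_ifT.
- apply: measurable_and; first exact: measurable_awayX.
  apply: measurable_and.
    by apply: measurable_fun_ler; [exact: measurable_cst|exact: measurable_linX].
  by apply: measurable_fun_ltr; [exact: measurable_linX|exact: measurable_cst].
- apply: measurable_funM.
    apply: measurable_minr; last exact: measurable_cst.
    apply: measurable_funM; first exact: measurable_cst.
    apply: measurable_funX; apply: measurable_funM; first exact: measurable_cst.
    exact: measurable_linX.
  apply: measurable_funM; first exact: measurable_cst.
  by apply: measurable_funM; [exact: mX|exact: measurable_potX].
- exact: measurable_cst.
Qed.

(** The singular terms of p' a1 and p'' a2 combine into -(p' - u p'') kap P, at most -q kap P. Here
    [p2] stands for [ramp2] and [iu] for 1 / eps. *)
Let mid_bound (p p1 p2 a0 a1 a2 kP K eta t q iu u cp : R) :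
  0 <= p <= eta -> `|a0| <= K -> 0 <= p1 <= 1 -> a1 <= - kP + K -> 0 <= p2 ->
  0 <= a2 <= u * kP -> q <= p1 - t * p2 -> t = iu * u -> 0 <= iu -> 0 <= q -> cp <= kP ->
  0 <= kP -> 0 <= K ->
  p * a0 + p1 * a1 + iu * p2 * a2 <= K * eta + K - q * cp.
Proof.
move=> /andP[h0 h1] h2 /andP[h3 h4] h5 h6 /andP[h7 h8] h9 te h10 h11 h12 h13 K0.
rewrite te in h9.
have e1 : p * a0 <= eta * K.
  rewrite (le_trans (ler_norm _))// normrM; apply: ler_pM => //.
  by rewrite ger0_norm.
have e2 : p1 * a1 <= p1 * (- kP + K) by rewrite ler_wpM2l.
have e3 : iu * p2 * a2 <= iu * p2 * (u * kP) by rewrite ler_wpM2l// mulr_ge0.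
have e4 : q * cp <= q * kP by rewrite ler_wpM2l.
have e5 : q * kP <= (p1 - iu * u * p2) * kP by rewrite ler_wpM2r.
have e6 : p1 * K <= K by rewrite ler_piMl.
have -> : K * eta + K - q * cp = eta * K + (K - q * cp) by ring.
rewrite -addrA; apply: lerD => //.
apply: le_trans (lerD e2 e3) _.
have -> : p1 * (- kP + K) + iu * p2 * (u * kP) = p1 * K - (p1 - iu * u * p2) * kP by ring.
by apply: lerB => //; exact: le_trans e4 e5.
Qed.

(** Four ranges of u: the profile vanishes up to a; between a and 4 a the cost is 17 K / eps; from
    there to eta / 4 the ramp is coercive; above, [heavy] dominates. Integrating, the lower bound -
    2 eta for the integral of [L] turns into an upper bound for that of [well], uniform in eps. *)
Lemma integrable_local_pot A e : A != finset.setT -> 0 < e ->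
  mu.-integrable D (EFin \o (fun z => local_pot A e (X z))).
Proof.
have [k] := ubnP #|A|; elim: k A e => // k IHk A e; rewrite ltnS => Ak AT e0.
have IH j e' : j \in A -> 0 < e' ->
    mu.-integrable D (EFin \o (fun z => local_pot (A :\ j) e' (X z))).
  move=> jA e'0; apply: IHk => //; first by rewrite (cardsD1 j A) jA in Ak.
  apply/eqP => /setP /(_ j); rewrite !inE eqxx //.
have [ga [kap [a0 [a1 [a2 [P [eta [K [c [d' [[[n0 K0 c0 /andP[d'0 d'e]] [gaK gaA gac] [ck kap01] H] H5]]]]]]]]]]] :=
  limit_test r0 irr stm b1 AT e0.
have heavyI a : 0 < a -> mu.-integrable D (EFin \o (fun z => heavy A ga d' a (X z))).
  by move=> a'0; exact: integrable_heavy IH gaK gaA K0 d'0 a'0.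
have u0 x : simplex x -> 0 <= lin ga x.
  by move=> sx; apply: lin_ge0 => // i; case/andP: (gaK i).
(* [C0] bounds p a0 and p' a1 by p <= eta and p' <= 5; [C1] comes from the bound of the profile for
   u >= eta / 4. *)
pose C0 := K * eta + 5 * K.
pose C1 := K * (eta + 5 + 24 / eta).
have C00 : 0 <= C0 by rewrite addr_ge0 ?mulr_ge0 ?(ltW n0) ?(ltW K0).
have C10 : 0 <= C1 by rewrite mulr_ge0 ?addr_ge0 ?divr_ge0 ?(ltW n0) ?(ltW K0).
pose B0 z := C0 + C1 * heavy A ga d' (eta / 4) (X z).
have iB0 : mu.-integrable D (EFin \o B0).
  apply: integrable_add => //; first exact: integrable_cst.
  by apply: integrable_scale => //; apply: heavyI; rewrite divr_gt0.
pose well := well_bound A c ga kap d' eta.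
have well_ge0 eps a x : simplex x -> 0 <= well eps a x.
  move=> sx; rewrite /well /well_bound; case: ifPn => // _.
  have [/andP[k0 _] _] := kap01 x sx.
  by rewrite !mulr_ge0 ?pot_ge0 ?(ltW c0)// le_min ler01 mulr_ge0// sqr_ge0.
(* The last condition makes the measure of {0 < u < 4 a} compensate the cost 17 K / eps of switching
   the profile on. *)
have key eps a : 0 < eps <= eta / 8 -> 0 < a <= eta / 16 ->
    17 * K / eps * fine (mu ([set z | 0 < lin ga (X z) < 4 * a] `&` D)) <= 1 ->
    mu.-integrable D (EFin \o (fun z => well eps a (X z))) /\
    \int[mu]_(z in D) well eps a (X z) <= \int[mu]_(z in D) B0 z + 1 + 2 * eta.
  move=> /[dup] he /andP[eps0 _] /[dup] ha /andP[a'0 a16] hm.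
  have [p [p1 [p2 [M [Cp PM pz Plow [Pmid Phigh]]]]]] := profile n0 he ha.
  have pv w : eta <= w -> [/\ p w = 0, p1 w = 0 & p2 w = 0] by move=> h; apply: pz; right.
  (* With precision a / 2, a nonzero profile means y > a, hence u >= a / 2: the sequence is
     dominated by [heavy], integrable by induction. *)
  have a2'0 : 0 < a / 2 by rewrite divr_gt0.
  have [F [G [L [HFG HFb HFl Lb LE]]]] := H5 p p1 p2 Cp pv (a / 2) a2'0.
  have M0 : 0 <= M by have [_] := PM 0 (lexx _); apply: le_trans; rewrite !addr_ge0.
  have [||||iL bL] := @limit_occupation F G L (fun x => K * M * heavy A ga d' (a / 2) x) eta HFG.
  - move=> i x sx; have [y /andP[y1 y2] [h _ _]] := HFb i x sx.
    have y0 : 0 <= y by rewrite (le_trans _ y1)// u0.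
    by apply: le_trans h _; have [/andP[h1 h2] _] := PM y y0; rewrite ger0_norm.
  - by move=> x sx; have [] := HFl x sx.
  - move=> i x sx; have [y /andP[y1 y2] [_ h h']] := HFb i x sx.
    have y0 : 0 <= y by rewrite (le_trans _ y1)// u0.
    have [_ yM] := PM y y0.
    have H0 : 0 <= K * M * heavy A ga d' (a / 2) x.
      by apply: mulr_ge0; [apply: mulr_ge0 => //; exact: ltW|exact: heavy_ge0].
    case: h' => [/awayP aw|[_ ->]]; last by rewrite normr0.
    have [ya|ya] := leP y a.
      apply: le_trans h _; have [|-> -> ->] := pz y; first by left.
      by rewrite !normr0 !addr0 mulr0 mul0r.
    have ua : a / 2 <= lin ga x by move: (lin ga x) y2 ya => v; lra.
    rewrite /heavy aw ua /=; apply: le_trans h _.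
    rewrite ler_wpM2r ?addr_ge0 ?pot_ge0// ler_wpM2l// ltW//.
  - by apply: integrable_scale => //; exact: heavyI.
  pose S := [set z | 0 < lin ga (X z) < 4 * a].
  pose T := 17 * K / eps.
  have T0 : 0 <= T by rewrite divr_ge0 ?mulr_ge0 ?(ltW K0) ?(ltW eps0).
  have mS : measurable S.
    rewrite -[X in measurable X]setTI.
    rewrite (_ : S = (fun z => (0 < lin ga (X z)) && (lin ga (X z) < 4 * a)) @^-1` [set true]) //.
    have : measurable_fun setT (fun z => (0 < lin ga (X z)) && (lin ga (X z) < 4 * a)).
      by apply: measurable_and; apply: measurable_fun_ltr; try exact: measurable_cst; exact: measurable_linX.
    exact.
  have iS : mu.-integrable D (EFin \o (\1_S : Z -> R)).
    apply: (@integrable_le _ _ _ _ _ mD _ (fun=> 1)).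
    - by apply: mDf; exact: measurable_indic.
    - by move=> z _; rewrite /indic; case: (z \in S); rewrite ?normr1 ?normr0.
    - exact: integrable_cst.
  have ST : T * \int[mu]_(z in D) (\1_S z : R) <= 1.
    by rewrite /Rintegral integral_indic.
  pose B z := B0 z + T * (\1_S z : R).
  have iB : mu.-integrable D (EFin \o B).
    by apply: integrable_add => //; exact: integrable_scale.
  have WLB z : well eps a (X z) + L (X z) <= B z.
    have -> : B z = B0 z + T * (0 < lin ga (X z) < 4 * a)%R%:R.
      by rewrite /B indicE; congr (_ + _ * (nat_of_bool _)%:R); apply/idP/idP => [/set_mem|h]; last exact/mem_set.
    rewrite /B0; move: (X z) (sX z) => x sx.
    have ux := u0 x sx; set s : R := _%:R.
    have s0 : 0 <= T * s by rewrite mulr_ge0// ler0n.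
    have H0 : 0 <= C1 * heavy A ga d' (eta / 4) x by rewrite mulr_ge0// heavy_ge0.
    rewrite /well /well_bound LE.
    have Rx : 0 <= C0 + C1 * heavy A ga d' (eta / 4) x + T * s.
      exact: addr_ge0 (addr_ge0 C00 H0) s0.
    have [aw|naw] := boolP (awayb A d' x); last by rewrite /= addr0.
    have [q1 q2 q3 q4 [q5 q6]] := H x sx (elimT (awayP _ _ _) aw).
    have [k01 _] := kap01 x sx; have [/andP[pu0 pun] _] := PM _ ux.
    have [ua|ua] := leP (lin ga x) a.
      have [|-> -> ->] := pz (lin ga x); first by left.
      have -> : (4 * a <= lin ga x) = false by apply/negbTE; rewrite -ltNge; move: (lin ga x) a'0 ua => v; lra.
      by rewrite /= !mul0r !addr0.
    have a2x : 0 <= a2 x by case/andP: q3.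
    have kP : 0 <= kap x * P x.
      have /andP[k0 _] := k01.
      by rewrite mulr_ge0// (le_trans _ q1)// mulr_ge0 ?(ltW c0)// pot_ge0.
    have [u4|u4] := ltP (lin ga x) (4 * a).
      rewrite /= add0r.
      have -> : T * s = T by rewrite /s u4 (lt_trans a'0 ua) mulr1.
      have [|/andP[l1 l2] l3] := Plow (lin ga x); first by rewrite ux ltW.
      apply: (@le_trans _ _ (C0 + T)); last by rewrite lerD2r lerDl.
      rewrite /C0; apply: lerD; first apply: lerD.
      - rewrite mulrC (le_trans (ler_norm _))// normrM; apply: ler_pM => //.
        by rewrite ger0_norm.
      - apply: (@le_trans _ _ (p1 (lin ga x) * K)); last by rewrite ler_wpM2r// ltW.
        by rewrite ler_wpM2l// (le_trans q2)// gerDr oppr_le0.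
      - apply: (@le_trans _ _ (17 / eps * a2 x)); first by rewrite ler_wpM2r.
        have -> : T = 17 / eps * K by rewrite /T; ring.
        by rewrite ler_wpM2l// divr_ge0// ltW.
    have [un|un] := leP (eta / 4) (lin ga x).
      rewrite /= add0r; have := Lb x sx; rewrite LE aw => /(le_trans (ler_norm _)) hL.
      apply: le_trans hL _; rewrite /heavy aw un /=.
      apply: (@le_trans _ _ (C1 * (1 + pot A x))).
        rewrite ler_wpM2r ?addr_ge0 ?pot_ge0// /C1 ler_wpM2l ?(ltW K0)//.
        exact: Phigh.
      by rewrite -addrA addrCA lerDl addr_ge0.
    rewrite /=; have [|-> ->] := Pmid (lin ga x); first by rewrite u4 ltW.
    have t0 : 0 <= eps^-1 * lin ga x by rewrite mulr_ge0// invr_ge0 ltW.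
    have [_ _ g1 _ [/andP[g2 _] g3]] := ramp_prop t0.
    have := @mid_bound (p (lin ga x)) _ _ (a0 x) (a1 x) (a2 x) (kap x * P x) K eta _ _ eps^-1
      (lin ga x) (c * (kap x * pot A x)) _ q5 g1 q2 g2 _ g3 erefl.
    rewrite pu0 pun (mulrCA (lin ga x)) => hmid.
    have /andP[k0 _] := k01.
    apply: (@le_trans _ _ (K * eta + K)).
      rewrite -lerBrDl hmid//.
      - by rewrite invr_ge0 ltW.
      - by rewrite le_min ler01 mulr_ge0// sqr_ge0.
      - by rewrite mulrCA ler_wpM2l.
      - exact: ltW.
    apply: (@le_trans _ _ C0); last by rewrite -addrA lerDl addr_ge0.
    by rewrite /C0 lerD2l ler_peMl ?(ltW K0)// ler1n.
  have iW : mu.-integrable D (EFin \o (fun z => well eps a (X z))).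
    apply: (@integrable_le _ _ _ _ _ mD _ (fun z => B z + -1 * L (X z))).
    - by apply: mDf; exact: measurable_well.
    - by move=> z _; rewrite ger0_norm ?well_ge0// mulN1r lerBrDr WLB.
    - by apply: integrable_add => //; exact: integrable_scale.
  split=> //.
  have h1 : \int[mu]_(z in D) (well eps a (X z) + L (X z)) <= \int[mu]_(z in D) B z.
    by apply: le_Rintegral => //; exact: integrable_add.
  rewrite RintegralD// in h1.
  have h2 : \int[mu]_(z in D) B z <= \int[mu]_(z in D) B0 z + 1.
    rewrite RintegralD//; last exact: integrable_scale.
    by rewrite lerD2l RintegralZl.
  have h3 : - (2 * eta) <= \int[mu]_(z in D) L (X z) by move: bL; rewrite ler_norml => /andP[].
  move: h1 h2 h3; move: (\int[mu]_(z in D) _) (\int[mu]_(z in D) L (X z)).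
  by move: (\int[mu]_(z in D) B z) (\int[mu]_(z in D) B0 z) => v1 v2 v3 v4; lra.
pose eps i := eta / 8 * i.+1%:R^-1.
have eps0 i : 0 < eps i by rewrite mulr_gt0 ?divr_gt0 ?invr_gt0 ?ltr0n.
have inv1 (i : nat) : i.+1%:R^-1 <= 1 :> R by rewrite invf_le1 ?ltr0n// ler1n.
(* [a i] is chosen after [eps i]; the factor 1 / (i + 1) makes it tend to 0 as well. *)
have exa i : exists a, 0 < a <= eta / 16 * i.+1%:R^-1 /\
    17 * K / eps i * fine (mu ([set z | 0 < lin ga (X z) < 4 * a] `&` D)) <= 1.
  have e'0 : 0 < (17 * K / eps i)^-1 by rewrite invr_gt0 divr_gt0 ?mulr_gt0.
  have [a' a'0 ha'] := small_positive (measurable_linX mX ga) e'0.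
  have b0 : 0 < eta / 16 * i.+1%:R^-1 by rewrite mulr_gt0 ?divr_gt0 ?invr_gt0 ?ltr0n.
  exists (Num.min (a' / 4) (eta / 16 * i.+1%:R^-1)); split.
    by rewrite lt_min divr_gt0//= b0 ge_min lexx orbT.
  rewrite -ler_pdivlMl ?divr_gt0 ?mulr_gt0// mulr1; apply: ha'.
  by rewrite -ler_pdivlMl// mulrC ge_min lexx.
have [a Ha] := @choice _ _ _ exa.
have epsn i : 0 < eps i <= eta / 8.
  by rewrite eps0 /eps ler_piMr ?divr_ge0 ?(ltW n0).
have an i : 0 < a i <= eta / 16.
  have [/andP[-> h] _] := Ha i; rewrite (le_trans h)// ler_piMr ?divr_ge0 ?(ltW n0)//.
(* Pointwise limit of [well]: for u > 0 the minimum is eventually 1 since [eps i] tends to 0, and at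
   u = 0 both sides vanish. *)
pose W x : R := if awayb A d' x && ((0 < lin ga x) && (lin ga x < eta / 4)) then
    c * (kap x * pot A x) else 0.
have iW : mu.-integrable D (EFin \o (fun z => W (X z))).
  apply: (@fatou_Rintegral _ _ _ mu D mD (fun i z => well (eps i) (a i) (X z)) _
    (\int[mu]_(z in D) B0 z + 1 + 2 * eta)).
  - by move=> i; have [] := key (eps i) (a i) (epsn i) (an i) (Ha i).2.
  - by move=> i z _; exact: well_ge0.
  - move=> z _; move: (X z) (sX z) => x sx.
    have [u00|u00] := eqVneq (lin ga x) 0.
      rewrite /W u00 ltxx andbF; apply: cvg_near_cst; near=> i.
      rewrite /well /well_bound u00; case: ifPn => // /and3P[_ h _].
      by have /andP[h' _] := an i; move: h h'; lra.
    have ux : 0 < lin ga x by rewrite lt_def u00 u0.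
    have [x1 x1P] : exists N : nat, forall i, (N <= i)%N -> eta * i.+1%:R^-1 <= lin ga x.
      have h : (fun i : nat => eta * i.+1%:R^-1) @ \oo --> eta * 0.
        by apply: cvgM; [exact: cvg_cst|exact: cvg_harmonic].
      rewrite mulr0 in h; have [N _ hN] := cvgr_le _ h _ ux.
      by exists N => i; exact: hN.
    apply: cvg_near_cst; exists x1 => // i /= /x1P hi.
    have [/andP[_ h] _] := Ha i.
    rewrite /well /well_bound /W ux.
    have -> : 4 * a i <= lin ga x.
      have h0 : 0 <= eta * i.+1%:R^-1 by rewrite mulr_ge0 ?invr_ge0 ?(ltW n0).
      by apply: le_trans hi; move: h h0; rewrite [eta / 16 * _]mulrAC; move: (eta * _) (a i) => y v; lra.
    have -> : Num.min (4^-1 * ((eps i)^-1 * lin ga x) ^+ 2) 1 = 1.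
      apply/min_idPr; have : 8 <= (eps i)^-1 * lin ga x.
        rewrite ler_pdivlMl// (le_trans _ hi)// /eps.
        by rewrite le_eqVlt; apply/orP; left; apply/eqP; field.
      by move: (_ * lin ga x) => y y8; nra.
    by rewrite mul1r.
  - by move=> i; have [] := key (eps i) (a i) (epsn i) (an i) (Ha i).2.
apply: (@integrable_le _ _ _ _ _ mD _ (fun z => c^-1 * W (X z) + heavy A ga d' (eta / 4) (X z))).
- by apply: mDf; exact: measurable_local_pot.
- move=> z _; rewrite ger0_norm ?local_pot_ge0//; move: (X z) (sX z) => x sx.
  have W0 : 0 <= W x.
    rewrite /W; case: ifP => // _; have [/andP[k0 _] _] := kap01 x sx.
    by rewrite !mulr_ge0 ?pot_ge0 ?(ltW c0).
  have W0' : 0 <= c^-1 * W x by rewrite mulr_ge0// invr_ge0 ltW.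
  rewrite /local_pot; case: ifPn => [/awayP aw|_]; last by rewrite addr_ge0// heavy_ge0.
  have aw' : awayb A d' x by apply/awayP => j /aw; exact: le_trans.
  have [un|un] := leP (eta / 4) (lin ga x).
    by rewrite /heavy aw' un /= ler_wpDl// lerDr.
  (* At u = 0 the sites of [A] are empty, and [pot] is 0 because [0^-1 = 0]. *)
  have [u00|u00] := eqVneq (lin ga x) 0.
    suff -> : pot A x = 0 by rewrite addr_ge0// heavy_ge0.
    apply: big1 => j jA; have [x0 _] := sx.
    have : ga j * x ord0 j = 0.
      apply/eqP; rewrite eq_le mulr_ge0 ?x0 ?andbT//; last by case/andP: (gaK j).
      by rewrite -u00; apply: lin_ge_term => // i; case/andP: (gaK i).
    move/eqP; rewrite mulf_eq0 gt_eqF ?(lt_le_trans c0) ?gac//= => /eqP ->.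
    exact: invr0.
  have ux : 0 < lin ga x by rewrite lt_def u00 u0.
  rewrite /W aw' ux un /= (kap01 x sx).2// mul1r mulKf ?gt_eqF// lerDl.
  exact: heavy_ge0.
- apply: integrable_add => //; first exact: integrable_scale.
  by apply: heavyI; rewrite divr_gt0.
Unshelve. all: by end_near. Qed.

End Integrability.

(** * Path space and occupation measure *)

Section Paths.
Context {R : realType} {n : nat}.
Local Notation E := 'rV[R]_n.+1.
Local Notation Om := (path_space R n.+1).
Local Notation Borel := (g_sigma_algebraType (@open E)).
Implicit Types (w : trajectory R n.+1) (g : E -> R).

Lemma path_max w t : w t = w (Num.max t 0).
Proof. by have [t0|] := leP t 0; [exact: position_before|]. Qed.

Lemma path_simplex w t : simplex (w t).
Proof. by rewrite path_max; apply: position_simplex; rewrite le_max lexx orbT. Qed.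

Lemma path_continuous w : continuous (w : R -> E).
Proof.
move=> t; rewrite (_ : (w : R -> E) = (w : R -> E) \o (fun t => Num.max t 0)); last first.
  by apply/funext => s /=; exact: path_max.
have /subspace_continuousP H := @position_continuous _ _ w.
have h0 (s : R) : 0 <= Num.max s 0 by rewrite le_max lexx orbT.
apply: (@cvg_comp _ _ _ (fun t : R => Num.max t 0) (w : R -> E) _ (within `[0, +oo[ (nbhs (Num.max t 0)))).
  have c : continuous (fun t : R => Num.max t 0).
    by apply: cts_max; [move=> x; exact: cvg_id|exact: cts_cst].
  move=> B HB; have := c t _ HB.
  by apply: (@filterS _ (nbhs t)) => s /= h; apply: h; rewrite /= in_itv/= h0.
by apply: H; rewrite /= in_itv/= h0.
Qed.

Lemma path_comp_continuous w g : continuous g -> continuous (fun t => g (w t)).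
Proof. by move=> cg t; apply: continuous_comp; [exact: path_continuous|exact: cg]. Qed.

Lemma measurable_continuous_rV g : continuous g -> measurable_fun setT (g : Borel -> R).
Proof.
move=> /continuousP cg; apply: (measurability _ (RGenOpens.measurableE R)).
move=> _ [_ [a [b' ->] <-]]; rewrite setTI; apply: sub_sigma_algebra.
exact/cg/interval_open.
Qed.

Lemma measurable_coord_path (C : set (set (trajectory R n.+1))) (s : R) g :
  sigma_coord s `<=` C -> continuous g ->
  measurable_fun setT (fun w : g_sigma_algebraType C => g (position w s)).
Proof.
move=> sC /measurable_continuous_rV mg _ B mB; rewrite setTI.
apply: sub_sigma_algebra; apply: sC; rewrite /sigma_coord /preimage_set_system /=.
exists (g @^-1` B); last by rewrite setTI.
by rewrite -[X in borel_rV X]setTI; exact: (mg _ B mB).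
Qed.

Lemma measurable_path (s : R) g : continuous g ->
  measurable_fun setT (fun w : Om => g (position w s)).
Proof.
move=> cg; rewrite (_ : (fun _ => _) = (fun w : Om => g (position w (Num.max s 0)))).
  apply: measurable_coord_path => // B hB; exists (Num.max s 0) => //=.
  by rewrite in_itv/= andbT le_max lexx orbT.
by apply/funext => w; rewrite path_max.
Qed.

Lemma past_path (s t : R) g (c : R -> bool) : s <= t -> 0 <= t -> continuous g ->
  measurable_fun setT c -> past t [set w : trajectory R n.+1 | c (g (w s))].
Proof.
move=> st t0 cg mc.
pose C : set (set (trajectory R n.+1)) := \bigcup_(s in `[0, t]) sigma_coord s.
have mg : measurable_fun setT (fun w : g_sigma_algebraType C => g (position w (Num.max s 0))).
  apply: measurable_coord_path => // B hB; exists (Num.max s 0) => //=.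
  by rewrite in_itv/= le_max lexx orbT/= ge_max st t0.
have := measurableT_comp mc mg; move=> /(_ measurableT [set true] I); rewrite setTI.
rewrite /past -/C; congr (<<s _ >> _); apply/seteqP.
by split => w /=; rewrite -path_max.
Qed.

Lemma past_measurable (t : R) (B : set (trajectory R n.+1)) :
  past t B -> measurable (B : set Om).
Proof.
apply: sub_sigma_algebra2 => {}B [s /=]; rewrite in_itv/= => /andP[s0 st] hB.
by exists s => //=; rewrite in_itv/= s0.
Qed.

Lemma pastI (t : R) (B C : set (trajectory R n.+1)) : past t B -> past t C -> past t (B `&` C).
Proof. exact: (@measurableI _ (g_sigma_algebraType (\bigcup_(s in `[0, t]) sigma_coord s))). Qed.

Lemma pastU (t : R) (B C : set (trajectory R n.+1)) : past t B -> past t C -> past t (B `|` C).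
Proof. exact: (@measurableU _ (g_sigma_algebraType (\bigcup_(s in `[0, t]) sigma_coord s))). Qed.

Lemma past_mono (s t : R) (B : set (trajectory R n.+1)) : s <= t -> past s B -> past t B.
Proof.
move=> st; apply: sub_sigma_algebra2 => {}B [u /=]; rewrite in_itv/= => /andP[u0 us] hB.
by exists u => //=; rewrite in_itv/= u0 (le_trans us).
Qed.

Lemma truncn_grid_cvg (s : R) :
  (fun k : nat => (Num.truncn (k.+1%:R * s))%:R / k.+1%:R) @ \oo --> Num.max s 0.
Proof.
apply: (@squeeze_cvgr _ _ _ _ (fun k : nat => Num.max s 0 - k.+1%:R^-1) (fun=> Num.max s 0)).
- near=> k; have k0 : 0 < k.+1%:R :> R by rewrite ltr0n.
  have [s0|s0] := leP s 0.
    have -> : Num.truncn (k.+1%:R * s) = 0%N.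
      by apply/truncn0Pn; rewrite -ltNge (le_lt_trans _ ltr01)// pmulr_rle0.
    by rewrite mul0r lexx andbT sub0r oppr_le0 invr_ge0 ler0n.
  have /truncn_itv /andP[h1 h2] : 0 <= k.+1%:R * s by rewrite mulr_ge0 ?ler0n ?(ltW s0).
  rewrite ler_pdivrMr// [s * _]mulrC h1 andbT.
  rewrite lerBlDr -[X in _ + X]mul1r -mulrDl ler_pdivlMr// mulrC -[X in _ + X]/(1%:R) -natrD addn1.
  exact: ltW.
- rewrite -[X in _ --> X](subr0 (Num.max s 0)).
  by apply: cvgB; [exact: cvg_cst|exact: cvg_harmonic].
- exact: cvg_cst.
Unshelve. all: by end_near. Qed.

(** Evaluation at the grid time just before s glues countably many measurable maps, and converges by
    continuity of the paths. *)
Lemma measurable_joint g : continuous g ->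
  measurable_fun setT (fun z : measurableTypeR R * Om => g (position z.2 z.1)).
Proof.
move=> cg; apply: (@measurable_fun_cvg _ _ _ _ (fun (k : nat) (z : measurableTypeR R * Om) =>
  g (position z.2 ((Num.truncn (k.+1%:R * z.1))%:R / k.+1%:R)))).
  move=> k _ B mB; rewrite setTI.
  rewrite (_ : _ @^-1` _ = \bigcup_(j : nat)
    ([set s : measurableTypeR R | Num.truncn (k.+1%:R * s) = j] `*`
     [set w : Om | B (g (position w (j%:R / k.+1%:R)))])); last first.
    apply/seteqP; split=> [[s w] /= h|[s w] [j _ [/= <-]]//].
    by exists (Num.truncn (k.+1%:R * s)).
  apply: bigcup_measurable => j _; apply: measurableX.
    (* [truncn] is 0 on negative numbers, so the cell of index 0 has no lower bound. *)
    have -> : [set s : measurableTypeR R | Num.truncn (k.+1%:R * s) = j] =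
       [set s : measurableTypeR R | (k.+1%:R * s < j.+1%:R) && ((j == 0%N) || (j%:R <= k.+1%:R * s))].
      apply/seteqP; split=> s /=.
        move=> <-; rewrite -truncn_le_nat leqnn /=; case: eqVneq => //= h.
        by rewrite truncn_le -(pmulr_rge0 _ (ltr0n _ 1%N)) mul1r; apply: contraNT h; rewrite -ltNge => h;
          apply/eqP/truncn0Pn; rewrite -ltNge (lt_trans h).
      move=> /andP[h1 /orP[/eqP j0|h2]].
        by rewrite j0; apply/truncn0Pn; rewrite -ltNge; move: h1; rewrite j0.
      by apply: truncn_def; rewrite h2.
    have : measurable_fun setT (fun s : R => (k.+1%:R * s < j.+1%:R) && ((j == 0%N) || (j%:R <= k.+1%:R * s))).
      have mk : measurable_fun setT (fun s : R => k.+1%:R * s) by exact: measurable_funM.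
      apply: measurable_and; first exact: measurable_fun_ltr.
      by apply: measurable_or => //; exact: measurable_fun_ler.
    by move=> /(_ measurableT [set true] I); rewrite setTI.
  by have := measurable_path (j%:R / k.+1%:R) cg measurableT mB; rewrite setTI.
move=> [s w] _ /=; rewrite [in X in _ --> X]path_max.
apply: (@cvg_comp _ _ _ (fun k : nat => (Num.truncn (k.+1%:R * s))%:R / k.+1%:R)
   (fun t => g (position w t))); first exact: truncn_grid_cvg.
exact: path_comp_continuous.
Qed.

End Paths.

Section Occupation.
Context {R : realType} {n : nat}.
Local Notation E := 'rV[R]_n.+1.
Local Notation Om := (path_space R n.+1).
Variables (r : 'I_n.+1 -> 'I_n.+1 -> R) (m : 'I_n.+1 -> R) (b : R).
Variable P : probability Om R.
Hypothesis hP : solves_martingale_problem r m b P.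
Implicit Types (F G : E -> R).

Definition occ := (@lebesgue_measure R \x P)%E.
Definition state (z : measurableTypeR R * Om) : E := position z.2 z.1.

Lemma occ_slab (s t : R) (B : set Om) : measurable B ->
  (occ (`]s, t] `*` B) < +oo)%E.
Proof.
move=> mB; rewrite /occ product_measure1E//.
have h : (@lebesgue_measure R `]s, t] < +oo)%E.
  by rewrite lebesgue_measure_itv/=; case: ifP => _; rewrite -?EFinD ltry.
apply: lte_mul_pinfty => //; first by rewrite ge0_fin_numE.
by rewrite (le_lt_trans (probability_le1 P mB))// ltry.
Qed.

Lemma measurable_slab (s t : R) (B : set Om) : measurable B ->
  measurable (`]s, t] `*` B : set (measurableTypeR R * Om)).
Proof. by move=> mB; apply: measurableX => //; exact: measurable_itv. Qed.

Lemma measurable_state G : continuous G -> measurable_fun setT (G \o state).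
Proof. exact: measurable_joint. Qed.

Lemma state_simplex z : simplex (state z).
Proof. exact: path_simplex. Qed.

Lemma integrable_bounded d (T : measurableType d) (mu : {measure set T -> \bar R}) (D : set T)
  (f : T -> R) (M : R) : measurable D -> (mu D < +oo)%E -> measurable_fun D f ->
  (forall x, D x -> `|f x| <= M) -> mu.-integrable D (EFin \o f).
Proof.
by move=> mD muD mf fM; apply: (integrable_le mD mf fM); exact: integrable_cst.
Qed.

Lemma probability_lty (B : set Om) : measurable B -> (P B < +oo)%E.
Proof. by move=> mB; rewrite (le_lt_trans (probability_le1 P mB))// ltry. Qed.

Lemma integrable_path G (t : R) (B : set Om) : continuous G -> measurable B ->
  P.-integrable B (EFin \o (fun w : Om => G (position w t))).
Proof.
move=> cG mB; have [M M0 HM] := continuous_bounded_simplex cG.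
apply: (@integrable_bounded _ _ _ _ _ M) => //; first exact: probability_lty.
  by apply: measurable_funTS; exact: measurable_path.
by move=> w _; apply: HM; exact: path_simplex.
Qed.

Lemma integrable_path_time G (w : trajectory R n.+1) (s t : R) : continuous G ->
  (@lebesgue_measure R).-integrable `[s, t] (EFin \o (fun u => G (w u))).
Proof.
move=> cG; apply: continuous_compact_integrable; first exact: segment_compact.
by apply: continuous_subspaceT; exact: path_comp_continuous.
Qed.

Lemma path_integral_diff G (w : trajectory R n.+1) (s t : R) : continuous G -> 0 <= s -> s <= t ->
  \int[lebesgue_measure]_(v in `[0, t]) G (w v) - \int[lebesgue_measure]_(v in `[0, s]) G (w v) =
  \int[lebesgue_measure]_(v in `]s, t]) G (w v).
Proof.
move=> cG s0 st; have i0 := integrable_path_time w 0 t cG.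
by rewrite Rintegral_itvB ?bnd_simp.
Qed.

Lemma slab_integral G (s t : R) (B : set Om) : continuous G -> s <= t -> measurable B ->
  \int[P]_(w in B) (\int[lebesgue_measure]_(v in `]s, t]) G (position w v)) =
  \int[occ]_(z in `]s, t] `*` B) G (state z).
Proof.
move=> cG st mB.
have [C C0 HC] := continuous_bounded_simplex cG.
pose D : set (measurableTypeR R * Om) := `]s, t] `*` B.
have mD : measurable D by exact: measurable_slab.
have iG : occ.-integrable D (EFin \o (G \o state)).
  apply: (@integrable_bounded _ _ _ _ _ C) => //.
  - exact: occ_slab.
  - apply: measurable_funTS; exact: measurable_state.
  - by move=> z _; exact: HC (state_simplex z).
rewrite [RHS]Rintegral_mkcond [LHS]Rintegral_mkcond /Rintegral; congr fine.
rewrite -(@integral21_prod_meas1 _ _ _ _ _ _ _ (EFin \o ((G \o state) \_ D))); last first.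
  by have := (integrable_mkcond (EFin \o (G \o state)) mD).1 iG; rewrite restrict_EFin.
apply: eq_integral => w _.
have [Bw|nBw] := boolP (w \in (B : set Om)); last first.
  rewrite /patch (negbTE nBw); apply/esym; apply: integral0_eq => v _ /=.
  by rewrite /patch in_setX/= (negbTE nBw) andbF.
rewrite {1}/patch Bw /Rintegral fineK; last first.
  apply: integrable_fin_num => //; apply: integrableS (integrable_path_time w s t cG) => //.
  exact: subset_itv_oc_cc.
rewrite /fubini_G integral_mkcond; apply: eq_integral => v _ /=.
by rewrite /patch in_setX/= Bw andbT /state /=; case: (_ \in _).
Qed.

Let subr_swap (a1 a2 a3 a4 : R) : a1 - a2 = a3 - a4 -> a1 - a3 = a2 - a4.
Proof. by move=> h; rewrite -[a1](subrK a2) h; ring. Qed.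

(** The martingale identity tested on an event of the past, with Fubini for the time integral. Slabs
    are half-open so that consecutive ones tile. *)
Lemma occupation F G (s t : R) (B : set (trajectory R n.+1)) :
  dom_S r m b F -> continuous F -> continuous G ->
  (forall x, simplex x -> gen r m b F x = G x) -> 0 <= s -> s <= t -> past s B ->
  \int[P]_(w in (B : set Om)) F (position w t) - \int[P]_(w in (B : set Om)) F (position w s) =
  \int[occ]_(z in `]s, t] `*` B) G (state z).
Proof.
move=> dF cF cG FG s0 st pB.
have mB := past_measurable pB.
pose I (u : R) (w : Om) : R := \int[lebesgue_measure]_(v in `[0, u]) G (position w v).
pose M (u : R) (w : Om) : R := F (position w u) - I u w.
pose N (u : R) (w : Om) : R :=
  F (position w u) - \int[lebesgue_measure]_(v in `[0, u]) gen r m b F (position w v).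
have ME u : N u = M u.
  apply/funext => w; congr (_ - _); apply: eq_Rintegral => v _.
  by rewrite FG//; exact: path_simplex.
have [_ iN eN] : is_martingale P past N := hP dF.
have iMB u : 0 <= u -> P.-integrable B (EFin \o M u).
  move=> u0; apply: (@integrableS _ _ _ P setT) => //.
  by rewrite -ME; exact: iN.
have iI u : 0 <= u -> P.-integrable B (EFin \o I u).
  move=> u0; have := integrable_add mB (integrable_path u cF mB) (integrable_scale mB (-1) (iMB u u0)).
  by congr (P.-integrable _ _); apply/funext => w /=; rewrite /M mulN1r opprB addrC subrK.
have eMB : \int[P]_(w in (B : set Om)) M t w = \int[P]_(w in (B : set Om)) M s w.
  by rewrite -!ME; exact: (congr1 fine (eN s t s0 st B pB)).
have t0 := le_trans s0 st.
have e1 := RintegralB mB (integrable_path t cF mB) (iI t t0).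
have e2 := RintegralB mB (integrable_path s cF mB) (iI s s0).
rewrite (subr_swap (etrans (esym e1) (etrans eMB e2))).
rewrite -(RintegralB mB (iI t t0) (iI s s0)).
have e3 : \int[P]_(w in (B : set Om)) (I t w - I s w) =
  \int[P]_(w in (B : set Om)) (\int[lebesgue_measure]_(v in `]s, t]) G (position w v)).
  by apply: eq_Rintegral => w _; exact: path_integral_diff.
exact: etrans e3 (slab_integral cG st mB).
Qed.

End Occupation.

(** * Absorption by the faces *)

Lemma negligible_Rintegral0 d (T : measurableType d) (R : realType)
  (mu : {measure set T -> \bar R}) (f : T -> R) :
  mu.-integrable setT (EFin \o f) -> (forall x, 0 <= f x) ->
  \int[mu]_x f x <= 0 -> mu.-negligible [set x | 0 < f x].
Proof.
move=> If f0 h.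
have e : (\int[mu]_x `|(EFin \o f) x| = 0)%E.
  rewrite (eq_integral (EFin \o f)); last by move=> x _; rewrite gee0_abs// lee_fin.
  have h0 : \int[mu]_x f x = 0 by apply/eqP; rewrite eq_le h Rintegral_ge0.
  by rewrite -(fineK (integrable_fin_num measurableT If)); congr EFin.
have /integrableP[mf _] := If.
have := (ae_eq_integral_abs mu measurableT mf).1 e.
apply: negligibleS => x /= fx /(_ I) [] h1; move: fx; rewrite h1 ltxx //.
Qed.

Lemma Rintegral_sum_ord d (T : measurableType d) (R : realType) (mu : {measure set T -> \bar R})
  (D : set T) (k : nat) (f : nat -> T -> R) : measurable D ->
  (forall i, mu.-integrable D (EFin \o f i)) ->
  \int[mu]_(x in D) (\sum_(i < k) f i x) = \sum_(i < k) \int[mu]_(x in D) f i x.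
Proof.
move=> mD If; elim: k => [|k IH].
  by rewrite big_ord0; under eq_Rintegral do rewrite big_ord0; rewrite Rintegral_cst// mul0r.
rewrite [RHS]big_ord_recr /= -IH -RintegralD//; last exact: integrable_bigsum.
by apply: eq_Rintegral => x _; rewrite big_ord_recr.
Qed.

(** * A local supermartingale argument along time grids *)

Section Grid.
Context {R : realType} {n : nat}.
Local Notation E := 'rV[R]_n.+1.
Local Notation Om := (path_space R n.+1).
Local Notation path := (trajectory R n.+1).
Variable P : probability Om R.
Variables (g u F H : E -> R).
Hypotheses (cg : continuous g) (cu : continuous u) (cF : continuous F).
Hypothesis F0 : forall x, simplex x -> 0 <= F x.
Hypothesis Fu : forall x, simplex x -> g x <= 0 -> F x = u x.
Hypothesis H0 : forall x, simplex x -> 0 <= H x.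
Hypothesis mH : measurable_fun setT (H \o @state R n).
Hypothesis iH : forall T, (occ P).-integrable (`]0, T] `*` setT) (EFin \o (H \o @state R n)).
(** A bound on the drift of F: F behaves as a supermartingale where g <= 0, and elsewhere its drift
    is merely dominated by an integrable H. *)
Let V x : R := if g x <= 0 then 0 else H x.
Hypothesis step : forall s t (B : set path), 0 <= s -> s <= t -> past s B ->
  \int[P]_(w in (B : set Om)) F (position w t) <= \int[P]_(w in (B : set Om)) F (position w s) +
  \int[occ P]_(z in `]s, t] `*` B) V (state z).

Variables (q t : R).
Hypotheses (q0 : 0 <= q) (qt : q < t).

Section Threshold.
Variable e : R.
Hypothesis e0 : 0 < e.

Let grid (k i : nat) : R := q + (t - q) * (i%:R / k.+1%:R).

Let grid_ge k i : q <= grid k i.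
Proof. by rewrite lerDl mulr_ge0 ?divr_ge0 ?subr_ge0 ?ler0n ?(ltW qt). Qed.

Let grid_ge0 k i : 0 <= grid k i.
Proof. exact: le_trans q0 (grid_ge k i). Qed.

Let grid_mono k i j : (i <= j)%N -> grid k i <= grid k j.
Proof.
move=> ij; rewrite lerD2l ler_wpM2l ?subr_ge0 ?(ltW qt)//.
by rewrite ler_wpM2r ?invr_ge0 ?ler0n// ler_nat.
Qed.

Let gridn k : grid k k.+1 = t.
Proof. by rewrite /grid divff ?pnatr_eq0// mulr1 addrC subrK. Qed.

Let grid_le k i : (i <= k.+1)%N -> grid k i <= t.
Proof. by move=> /(grid_mono k); rewrite gridn. Qed.

Let gridS k i : grid k i.+1 = grid k i + (t - q) * k.+1%:R^-1.
Proof.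
rewrite /grid; have -> : i.+1%:R = i%:R + 1 :> R by rewrite -natr1.
by rewrite [(_ + 1) / _]mulrDl mul1r mulrDr addrA.
Qed.

(** These events look at grid times only, which places them in the past; an exit from g <= 0 between
    two grid times is paid for by [slabV]. *)
Let good (k i : nat) : set path := [set w : path | forall j, (j <= i)%N -> g (w (grid k j)) <= 0].
Let reached (k i : nat) : set path := [set w : path | exists2 j, (j <= i)%N & u (w (grid k j)) < e].
Let Q (k i : nat) : set path := good k i `&` reached k i.

Let past_good k i : past (grid k i) (good k i).
Proof.
have p1 j : past (grid k j) [set w : path | g (w (grid k j)) <= 0].
  apply: (past_path (c := fun x => x <= 0)) => //.
  by apply: measurable_fun_ler => //; exact: measurable_cst.
elim: i => [|i IH].
  have -> : good k 0 = [set w : path | g (w (grid k 0)) <= 0].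
    by apply/seteqP; split=> w /= h; [exact: h|case].
  exact: p1.
have -> : good k i.+1 = good k i `&` [set w : path | g (w (grid k i.+1)) <= 0].
  apply/seteqP; split=> w /=.
    by move=> h; split=> [j ji|]; apply: h => //; rewrite (leq_trans ji).
  by move=> [h1 h2] j; rewrite leq_eqVlt => /predU1P[->//|]; exact: h1.
by apply: pastI => //; apply: past_mono IH; exact: grid_mono.
Qed.

Let past_reached k i : past (grid k i) (reached k i).
Proof.
have p1 j : past (grid k j) [set w : path | u (w (grid k j)) < e].
  apply: (past_path (c := fun x => x < e)) => //.
  by apply: measurable_fun_ltr => //; exact: measurable_cst.
elim: i => [|i IH].
  have -> : reached k 0 = [set w : path | u (w (grid k 0)) < e].
    by apply/seteqP; split=> w /=; [move=> [[|//]]|exists 0%N].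
  exact: p1.
have -> : reached k i.+1 = reached k i `|` [set w : path | u (w (grid k i.+1)) < e].
  apply/seteqP; split=> w /=.
    move=> [j]; rewrite leq_eqVlt => /predU1P[->|]; first by right.
    by move=> ji uj; left; exists j.
  by move=> [[j ji uj]|]; [exists j => //; exact: leqW|exists i.+1].
by apply: pastU => //; apply: past_mono IH; exact: grid_mono.
Qed.

Let past_Q k i : past (grid k i) (Q k i).
Proof. by apply: pastI; [exact: past_good|exact: past_reached]. Qed.

Let mQ k i : measurable (Q k i : set Om). Proof. exact: (@past_measurable R n _ _ (@past_Q k i)). Qed.
Let mreached k i : measurable (reached k i : set Om).
Proof. exact: (@past_measurable R n _ _ (@past_reached k i)). Qed.

Let integrableI (B : set Om) (f : Om -> R) : measurable B ->
  P.-integrable setT (EFin \o f) -> P.-integrable setT (EFin \o (fun w => f w * \1_B w)).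
Proof.
move=> mB If.
have : P.-integrable setT ((EFin \o f) \_ B).
  by apply: (integrable_mkcond (EFin \o f) mB).1; exact: integrableS If.
by rewrite restrict_EFin patch_indic.
Qed.

Let iF (s : R) : P.-integrable setT (EFin \o (fun w : Om => F (position w s))).
Proof. exact: integrable_path. Qed.

Let RintegralI (B : set Om) (f : Om -> R) :
  \int[P]_(w in B) f w = \int[P]_w (f w * \1_B w).
Proof. by rewrite Rintegral_mkcond patch_indic. Qed.

Let slabV k j : R := \int[occ P]_(z in `]grid k j, grid k j.+1] `*` (Q k j : set Om)) V (state z).

Let i1 (B : set Om) : measurable B -> P.-integrable setT (EFin \o (\1_B : Om -> R)).
Proof. by move=> mB; exact: integrable_indic. Qed.

Let chain (a4 a5 a3 a2 a1 a0 b4 b3 c1 c0 : R) : b4 = a4 -> a4 <= a5 -> a5 = a3 + a2 ->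
  b3 = a3 -> a2 = a1 - a0 -> a1 = c1 -> a0 = c0 -> b4 <= b3 + (c1 - c0).
Proof. by move=> -> h e1 -> e2 <- <-; rewrite -e2 -e1. Qed.

(* Decomposition along the first grid time at which [u < e]: [F] is below [e]
   there, and evolves afterwards with a drift at most [V]. *)
Let grid_bound k i :
  \int[P]_(w in (Q k i : set Om)) F (position w (grid k i)) <=
  e * \int[P]_w (\1_(reached k i : set Om) w : R) + \sum_(j < i) slabV k j.
Proof.
have Fx (w : Om) s : 0 <= F (position w s) by apply: F0; exact: path_simplex.
have Fe (w : Om) s : g (position w s) <= 0 -> u (position w s) < e -> F (position w s) <= e.
  by move=> gs /ltW us; rewrite Fu//; exact: path_simplex.
have Qin k' i' w : w \in (Q k' i' : set Om) =
    (w \in (good k' i' : set Om)) && (w \in (reached k' i' : set Om)).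
  by rewrite in_setI.
elim: i => [|i IH].
  have z := RintegralZl e measurableT (i1 (@mreached k 0)).
  rewrite big_ord0 addr0 RintegralI -z {z}.
  apply: (le_Rintegral measurableT (integrableI (@mQ k 0) (iF (grid k 0)))
    (integrable_scale measurableT e (i1 (@mreached k 0)))).
  move=> w _; rewrite !indicE Qin.
  case: (boolP (w \in _)) => [/set_mem gw|_] /=; last by rewrite mulr0 mulr_ge0 ?(ltW e0)// ler0n.
  case: (boolP (w \in _)) => [/set_mem [j]|_]; last by rewrite !mulr0.
  by rewrite leqn0 => /eqP -> uw; rewrite !mulr1; apply: Fe => //; exact: gw.
rewrite big_ord_recr /= addrA.
have st := step (grid_ge0 k i) (grid_mono k (leqnSn i)) (@past_Q k i).
apply: (@le_trans _ _ (\int[P]_(w in (Q k i : set Om)) F (position w (grid k i.+1)) +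
   (e * \int[P]_w (\1_(reached k i.+1 : set Om) w : R) - e * \int[P]_w (\1_(reached k i : set Om) w : R)))).
  pose h1 (w : Om) : R := \1_(reached k i.+1 : set Om) w.
  pose h0 (w : Om) : R := \1_(reached k i : set Om) w.
  (* If u < e was seen before, only [good] shrinks; if it is seen for the first time at index i + 1,
     then F <= e there and the increment of [reached] pays. *)
  have pw (w : Om) : F (position w (grid k i.+1)) * \1_(Q k i.+1 : set Om) w <=
      F (position w (grid k i.+1)) * \1_(Q k i : set Om) w + (e * h1 w - e * h0 w).
    rewrite /h1 /h0 !indicE !Qin.
    have hs : (w \in (reached k i : set Om)) -> (w \in (reached k i.+1 : set Om)).
      by move=> /set_mem [j ji uj]; apply/mem_set; exists j => //; exact: leqW.
    have gs : (w \in (good k i.+1 : set Om)) -> (w \in (good k i : set Om)).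
      by move=> /set_mem h; apply/mem_set => j ji; apply: h; exact: leqW.
    case: (boolP (w \in (reached k i : set Om))) hs => [hin /(_ isT) ->|nh1 _].
      rewrite subrr addr0 !andbT ler_wpM2l//.
      by case: (boolP (w \in _)) gs => [_ /(_ isT) ->|_ _] //; rewrite ler0n.
    rewrite andbF !mulr0 subr0 add0r.
    case: (boolP (w \in _)) => [/set_mem gw|_] /=; last by rewrite mulr0 mulr_ge0 ?(ltW e0)// ler0n.
    case: (boolP (w \in _)) => [/set_mem [j]|_]; last by rewrite !mulr0.
    rewrite leq_eqVlt => /predU1P[-> uw|ji uw].
      by rewrite !mulr1; apply: Fe => //; exact: gw.
    by exfalso; move/negP: nh1; apply; apply/mem_set; exists j.
  have I1 : P.-integrable setT (EFin \o (fun w => e * h1 w)).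
    exact: (integrable_scale measurableT e (i1 (@mreached k i.+1))).
  have I0 : P.-integrable setT (EFin \o (fun w => e * h0 w)).
    exact: (integrable_scale measurableT e (i1 (@mreached k i))).
  have I2 : P.-integrable setT (EFin \o (fun w => e * h1 w - e * h0 w)).
    have := integrable_add measurableT I1 (integrable_scale measurableT (-1) I0).
    by congr (P.-integrable _ _); apply/funext => w /=; rewrite mulN1r.
  have I3 := integrableI (@mQ k i) (iF (grid k i.+1)).
  have I4 := integrableI (@mQ k i.+1) (iF (grid k i.+1)).
  have I5 := integrable_add measurableT I3 I2.
  have z1 := RintegralZl e measurableT (i1 (@mreached k i.+1)).
  have z0 := RintegralZl e measurableT (i1 (@mreached k i)).
  exact: (chain (RintegralI _ _) (le_Rintegral measurableT I4 I5 (fun w _ => pw w))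
    (RintegralD measurableT I3 I2) (RintegralI _ _) (RintegralB measurableT I1 I0) z1 z0).
have := lerD (le_trans st (lerD IH (lexx _)))
  (lexx (e * \int[P]_w (\1_(reached k i.+1 : set Om) w : R) -
         e * \int[P]_w (\1_(reached k i : set Om) w : R))).
move=> /le_trans; apply.
rewrite -/(slabV k i) le_eqVlt; apply/orP; left; apply/eqP; ring.
Qed.

Let D : set (measurableTypeR R * Om) := `]q, t] `*` setT.
Let S (k j : nat) : set (measurableTypeR R * Om) := `]grid k j, grid k j.+1] `*` (Q k j : set Om).

Let mD : measurable D. Proof. exact: measurable_slab. Qed.

Let mS k j : measurable (S k j).
Proof. by apply: measurable_slab; exact: (@mQ k j). Qed.

Let iHD : (occ P).-integrable D (EFin \o (H \o @state R n)).
Proof.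
apply: (integrableS _ _ _ (iH t)) => //; first exact: measurable_slab.
move=> [s w] [/=]; rewrite !in_itv/= => /andP[h1 h2] _.
by rewrite /= ?in_itv/= h2 (le_lt_trans q0 h1).
Qed.

Let V_ge0 x : simplex x -> 0 <= V x.
Proof. by move=> sx; rewrite /V; case: ifP => // _; exact: H0. Qed.

Let V_leH x : simplex x -> V x <= H x.
Proof. by move=> sx; rewrite /V; case: ifP => // _; exact: H0. Qed.

Let mV : measurable_fun setT (V \o @state R n).
Proof.
rewrite /comp /V; apply: measurable_fun_ifT.
- by apply: measurable_fun_ler; [exact: measurable_state|exact: measurable_cst].
- exact: measurable_cst.
- exact: mH.
Qed.

(** The time intervals are disjoint, so [z] lies in at most one slab. *)
Let slab_sum (k l : nat) (z : measurableTypeR R * Om) : 0 <= \sum_(j < l) (\1_(S k j) z : R) <= 1.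
Proof.
have h : \sum_(j < l) (\1_(S k j) z : R) <= (q < z.1 <= grid k l)%R%:R.
  elim: l => [|l IH]; first by rewrite big_ord0 ler0n.
  rewrite big_ord_recr /=; apply: le_trans (lerD IH (lexx _)) _.
  have h1 : (\1_(S k l) z : R) <= (grid k l < z.1 <= grid k l.+1)%R%:R.
    rewrite indicE; case: (boolP (z \in _)) => [/set_mem [/=]|_]; last by rewrite ler0n.
    by rewrite in_itv/= => ->.
  apply: le_trans (lerD (lexx _) h1) _.
  have h2 := grid_mono k (leqnSn l); have h3 := grid_ge k l.
  rewrite -natrD ler_nat.
  have [zl|zl] := leP z.1 (grid k l).
    by rewrite andbT /= addn0 (le_trans zl h2) andbT.
  by rewrite andbF /= (le_lt_trans h3 zl).
rewrite sumr_ge0/= => [|j _]; last by rewrite indicE ler0n.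
by apply: le_trans h _; rewrite lern1 leq_b1.
Qed.

Let W (k : nat) (z : measurableTypeR R * Om) : R := \sum_(j < k.+1) (V (state z) * \1_(S k j) z).

Let iVS k j : (occ P).-integrable D (EFin \o (fun z => V (state z) * (\1_(S k j) z : R))).
Proof.
apply: (integrable_le mD _ _ iHD).
  apply: measurable_funTS; apply: measurable_funM; first exact: mV.
  by apply: measurable_indic; exact: mS.
move=> z _; have sz := @state_simplex R n z.
rewrite indicE ger0_norm ?mulr_ge0 ?ler0n ?V_ge0//.
by apply: le_trans (V_leH sz); rewrite ler_piMr ?V_ge0// lern1 leq_b1.
Qed.

Let W_sum k : \int[occ P]_(z in D) W k z = \sum_(j < k.+1) slabV k j.
Proof.
rewrite (Rintegral_sum_ord k.+1 mD (@iVS k)); apply: eq_bigr => j _.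
rewrite /slabV; have -> : `]grid k j, grid k j.+1] `*` (Q k j : set Om) = D `&` S k j.
  apply/esym/setIidPr => -[s w] [/=]; rewrite !in_itv/= => /andP[h1 h2] _.
  split=> //=; rewrite in_itv/= (le_lt_trans (grid_ge k j) h1) (le_trans h2)//.
  exact: grid_le.
by rewrite [RHS]Rintegral_mkcondr patch_indic.
Qed.

(** Where g <= 0, V is 0. If g > 0 at time [z.1], then by continuity g > 0 at the preceding grid
    time once the mesh is fine, which excludes the path from [Q] there. *)
Let W_cvg z : D z -> W^~ z @ \oo --> (0 : R).
Proof.
move=> Dz; apply: cvg_near_cst.
have [gz|gz] := leP (g (state z)) 0.
  by near=> k; apply: big1 => j _; rewrite /V gz mul0r.
have cgz : continuous (fun s => g (position z.2 s)) by exact: path_comp_continuous.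
have := cvgr_gt _ (cgz z.1) 0 gz; rewrite -nbhs_ballE => -[d /= d0 hd].
have mesh : \forall k \near \oo, (t - q) * k.+1%:R^-1 < d.
  have h : (fun k : nat => (t - q) * k.+1%:R^-1) @ \oo --> (t - q) * 0.
    by apply: cvgM; [exact: cvg_cst|exact: cvg_harmonic].
  by rewrite mulr0 in h; exact: (cvgr_lt _ h).
near=> k; apply: big1 => j _.
rewrite indicE; case: (boolP (z \in _)) => [/set_mem [/= h1 [h2 _]]|_]; last by rewrite mulr0.
move: h1; rewrite in_itv/= => /andP[h3 h4]; exfalso.
have := h2 j (leqnn _); rewrite leNgt => /negP; apply.
apply: hd; rewrite /ball/= ltr_norml.
have hm : (t - q) * k.+1%:R^-1 < d by near: k.
move: h4; rewrite gridS => h4.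
apply/andP; split; first by rewrite (lt_trans (_ : - d < 0)) ?oppr_lt0// subr_gt0.
by rewrite ltrBlDl (le_lt_trans h4)// ltrD2l.
Unshelve. all: by end_near. Qed.

Let err_cvg : (fun k => \sum_(j < k.+1) slabV k j) @ \oo --> (0 : R).
Proof.
have [||||_] := @dominated_Rintegral _ _ _ (occ P) D mD W (fun=> 0) (H \o @state R n).
- move=> k; rewrite /W; apply: measurable_sum => j.
  exact: integrable_measurable (@iVS k j).
- exact: W_cvg.
- move=> k z _; have sz := @state_simplex R n z.
  rewrite /W -mulr_sumr; have /andP[h1 h2] := slab_sum k k.+1 z.
  rewrite ger0_norm ?mulr_ge0 ?V_ge0//.
  by apply: le_trans (V_leH sz); rewrite ler_piMr ?V_ge0.
- exact: iHD.
rewrite Rintegral_cst// mul0r => cW.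
suff -> : (fun k => \sum_(j < k.+1) slabV k j) = (fun k => \int[occ P]_(z in D) W k z) by exact: cW.
by apply/funext => k; rewrite W_sum.
Qed.

Lemma grid_limit : exists N : set Om, [/\ measurable N,
  [set w : path | [/\ forall s, q <= s <= t -> g (w s) <= 0,
     exists2 s, q <= s <= t & u (w s) = 0 & 0 < u (w t)]] `<=` N &
  \int[P]_w (F (position w t) * \1_N w) <= e].
Proof.
(* The covering set is a lower limit: the paths that belong to [Q k k.+1] for all large k. A path on
   which u vanishes is seen below [e] by every fine enough grid. *)
pose S_ (M : nat) : set Om := \bigcap_(k in [set k | (M <= k)%N]) (Q k k.+1 : set Om).
have mS_ M : measurable (S_ M).
  by apply: bigcap_measurable => [|k _]; [exists M => /=|exact: (@mQ k k.+1)].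
have mN : measurable (\bigcup_M S_ M) by exact: bigcup_measurable.
exists (\bigcup_M S_ M); split=> //.
- move=> w [wg [s /andP[qs st] us] _].
  have cuw : continuous (fun s => u (w s)) by exact: path_comp_continuous.
  have ue : u (w s) < e by rewrite us.
  have := cvgr_lt _ (cuw s) e ue; rewrite -nbhs_ballE => -[d /= d0 hd].
  have h : (fun k : nat => (t - q) * k.+1%:R^-1) @ \oo --> (t - q) * 0.
    by apply: cvgM; [exact: cvg_cst|exact: cvg_harmonic].
  rewrite mulr0 in h; have [M _ hM] := cvgr_lt _ h _ d0.
  exists M => // k /= Mk; split=> [j jk|].
    by apply: wg; rewrite grid_ge; exact: grid_le.
  have mk := hM k Mk.
  have [i ik hi] : exists2 i, (i <= k.+1)%N & grid k i <= s <= grid k i + (t - q) * k.+1%:R^-1.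
    have k0 : 0 < k.+1%:R :> R by rewrite ltr0n.
    have tq : 0 < t - q by rewrite subr_gt0.
    pose y := k.+1%:R * ((s - q) / (t - q)).
    have sq : 0 <= s - q by rewrite subr_ge0.
    have y0 : 0 <= y := mulr_ge0 (ltW k0) (divr_ge0 sq (ltW tq)).
    have sE : s = q + (t - q) * (y / k.+1%:R).
      by rewrite /y; field; rewrite !gt_eqF.
    have /truncn_itv/andP[h1 h2] := y0.
    exists (Num.truncn y).
      rewrite -ltnS ltnS -(ler_nat R) (le_trans h1)// /y.
      by rewrite (ler_piMr (ltW k0))// ler_pdivrMr// mul1r lerD2r.
    rewrite -gridS /grid sE !lerD2l !(ler_pM2l tq) !ler_pM2r ?invr_gt0//.
    by rewrite h1 ltW.
  exists i => //; apply: hd; rewrite /ball /= ltr_norml.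
  move: hi => /andP[h1 h2]; apply/andP; split.
    by rewrite (lt_le_trans (_ : - d < 0)) ?subr_ge0// oppr_lt0.
  by rewrite ltrBlDl (le_lt_trans h2)// ltrD2l.
- pose FS (A : set Om) (w : Om) : R := F (position w t) * \1_A w.
  have Fx (w : Om) s : 0 <= F (position w s) by apply: F0; exact: path_simplex.
  have iFS (A : set Om) : measurable A -> P.-integrable setT (EFin \o FS A).
    by move=> mA; exact: (integrableI mA (iF t)).
  have SQ M k : (M <= k)%N -> \int[P]_w FS (S_ M) w <= e + \sum_(j < k.+1) slabV k j.
    move=> Mk; have := grid_bound k k.+1; rewrite gridn RintegralI => gb.
    have reached1 : e * \int[P]_w (\1_(reached k k.+1 : set Om) w : R) <= e.
      rewrite ler_piMr ?(ltW e0)//.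
      have c1 : P.-integrable setT (EFin \o (fun=> 1 : R)).
        by apply: integrable_cst => //; exact: probability_lty.
      apply: (@le_trans _ _ (\int[P]_(w in setT) 1)).
        apply: (le_Rintegral measurableT (i1 (@mreached k k.+1)) c1) => w _.
        by rewrite indicE lern1 leq_b1.
      have P1 : fine (P setT) = 1 by rewrite probability_setT.
      by rewrite (Rintegral_cst P measurableT) mul1r le_eqVlt; apply/orP; left; apply/eqP; exact: P1.
    apply: le_trans (le_trans gb (lerD reached1 (lexx _))).
    apply: (le_Rintegral measurableT (iFS _ (mS_ M)) (iFS _ (@mQ k k.+1))).
    move=> w _; rewrite /FS ler_wpM2l// !indicE ler_nat.
    case: (boolP (w \in S_ M)) => // /set_mem h.
    by rewrite (mem_set (h k Mk)).
  have Se M : \int[P]_w FS (S_ M) w <= e.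
    rewrite -[leRHS]addr0.
    apply: (@cvgr_to_ge _ \oo _ _ (fun k => e + \sum_(j < k.+1) slabV k j)).
      by apply: cvgD; [exact: cvg_cst|exact: err_cvg].
    by near=> k; apply: SQ; near: k; exact: nbhs_infty_ge.
  have [||||_ cN] := @dominated_Rintegral _ _ _ P setT measurableT (fun M => FS (S_ M))
    (FS (\bigcup_M S_ M)) (fun w => F (position w t)).
  + by move=> M; exact: integrable_measurable (iFS _ (mS_ M)).
  + move=> w _; apply: cvg_near_cst.
    have [[M _ hM]|nh] := pselect ((\bigcup_M S_ M) w).
      exists M => // M' /= MM'; rewrite /FS !indicE mem_set ?mem_set//; first by exists M.
      by move=> k /= kM; apply: hM => /=; exact: leq_trans kM.
    near=> M; rewrite /FS !indicE !memNset// => h.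
    by apply: nh; exists M.
  + move=> M w _; rewrite /FS indicE ger0_norm ?mulr_ge0 ?ler0n//.
    by rewrite ler_piMr// lern1 leq_b1.
  + exact: iF.
  by apply: (@cvgr_to_le _ _ _ _ _ _ _ cN); near=> M; exact: Se.
Unshelve. all: by end_near. Qed.

End Threshold.

(** Intersecting the covering sets for e = 1 / (k + 1) gives a set on which F at time t has integral
    0, whereas F = u > 0 on the event. *)
Lemma grid_null : P.-negligible
  [set w : path | [/\ forall s, q <= s <= t -> g (w s) <= 0,
     exists2 s, q <= s <= t & u (w s) = 0 & 0 < u (w t)]].
Proof.
have ex (k : nat) : exists N : set Om, [/\ measurable N,
  [set w : path | [/\ forall s, q <= s <= t -> g (w s) <= 0,
     exists2 s, q <= s <= t & u (w s) = 0 & 0 < u (w t)]] `<=` N &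
  \int[P]_w (F (position w t) * \1_N w) <= k.+1%:R^-1].
  by apply: grid_limit; rewrite invr_gt0 ltr0n.
have [N HN] := @choice _ _ _ ex.
have Fx (w : Om) s : 0 <= F (position w s) by apply: F0; exact: path_simplex.
pose f (w : Om) : R := F (position w t) * \1_(\bigcap_k N k) w.
have mN : measurable (\bigcap_k N k).
  by apply: bigcap_measurable => [|k _]; [exists 0%N|have [] := HN k].
have iFt : P.-integrable setT (EFin \o (fun w : Om => F (position w t))) by exact: integrable_path.
have iFN (A : set Om) : measurable A ->
    P.-integrable setT (EFin \o (fun w : Om => F (position w t) * \1_A w)).
  move=> mA; have : P.-integrable setT ((EFin \o (fun w : Om => F (position w t))) \_ A).
    apply: (integrable_mkcond (EFin \o (fun w : Om => F (position w t))) mA).1.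
    exact: integrableS iFt.
  by rewrite restrict_EFin patch_indic.
have f0 : \int[P]_w f w <= 0.
  apply: (@cvgr_to_ge _ \oo _ _ (fun k : nat => k.+1%:R^-1)); first exact: cvg_harmonic.
  near=> k; have [mk _ hk] := HN k; apply: le_trans hk.
  apply: (le_Rintegral measurableT (iFN _ mN) (iFN _ mk)).
  move=> w _; rewrite ler_wpM2l// !indicE ler_nat.
  by case: (boolP (w \in \bigcap_k N k)) => // /set_mem h; rewrite mem_set//; exact: h.
apply: negligibleS (negligible_Rintegral0 (iFN _ mN) _ f0); last first.
  by move=> w; rewrite mulr_ge0// indicE ler0n.
move=> w hw; have [h1 h2 h3] := hw.
have wN : (\bigcap_k N k) w by move=> k _; have [_ + _] := HN k; apply.
rewrite /= indicE mem_set// mulr1 Fu//; first exact: path_simplex.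
by apply: h1; rewrite lexx (ltW qt).
Unshelve. all: by end_near. Qed.

End Grid.

Lemma linear_profile (R : realType) (eta : R) : 0 < eta -> exists (p p1 p2 : R -> R) (M : R),
  [/\ C2R p p1 p2, forall w, eta <= w -> [/\ p w = 0, p1 w = 0 & p2 w = 0],
    forall w, 0 <= w -> 0 <= p w /\ `|p w| + `|p1 w| + `|p2 w| <= M
  & forall w, w <= eta / 4 -> [/\ p w = w, p1 w = 1 & p2 w = 0]].
Proof.
move=> n0.
have [z [z1 [z2 [Cz sz0 sz1 bz]]]] := cutoff n0.
have := C2R_mul C2R_id Cz.
set p := (fun t => id t * z t).
set p1 := (X in C2R _ X _); set p2 := (X in C2R _ _ X) => Cp.
have pv w : eta <= w -> [/\ p w = 0, p1 w = 0 & p2 w = 0].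
  by move=> /sz0[h1 h2 h3]; rewrite /p /p1 /p2 h1 h2 h3; split; ring.
have p0 w : 0 <= w -> 0 <= p w by move=> w0; have [/andP[z0 _] _ _] := bz w; exact: mulr_ge0.
exists p, p1, p2, (eta + (1 + 4) + (2 * (4 / eta) + 16 / eta)); split=> //; last first.
  by move=> w /sz1[h1 h2 h3]; rewrite /p /p1 /p2 h1 h2 h3; split => /=; ring.
move=> w w0; split; first exact: p0.
have n4 : 0 <= 4 / eta by rewrite divr_ge0 ?(ltW n0).
have n16 : 0 <= 16 / eta by rewrite divr_ge0 ?(ltW n0).
have [wn|wn] := leP eta w.
  have [-> -> ->] := pv w wn; rewrite !normr0 !addr0.
  have : 0 < eta by []. 
  by move: n4 n16; move: (4 / eta) (16 / eta) => v4 v16; lra.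
have [/andP[h1 h2] h3 h4] := bz w.
rewrite (ger0_norm (p0 w w0)) /p1 /p2 /p /=.
apply: lerD; first apply: lerD.
- by rewrite (le_trans _ (ltW wn))// ler_piMr.
- rewrite mul1r (le_trans (ler_normD _ _))//; apply: lerD; first by rewrite ger0_norm.
  rewrite normrM (ger0_norm w0) (le_trans (ler_wpM2l w0 h3))//.
  by rewrite mulrCA ler_piMr// ler_pdivrMr// mul1r ltW.
- rewrite mul0r add0r mul1r (le_trans (ler_normD _ _))//; apply: lerD.
    by rewrite normrM ger0_norm// ler_wpM2l.
  rewrite normrM (ger0_norm w0) (le_trans (ler_wpM2l w0 h4))//.
  have -> : w * (16 / eta ^+ 2) = (16 / eta) * (w / eta) by field; rewrite gt_eqF.
  by rewrite ler_piMr// ler_pdivrMr// mul1r ltW.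
Qed.

Section Absorption.
Context {R : realType} {n : nat}.
Local Notation E := 'rV[R]_n.+1.
Local Notation Om := (path_space R n.+1).
Local Notation path := (trajectory R n.+1).
Variables (r : 'I_n.+1 -> 'I_n.+1 -> R) (m : 'I_n.+1 -> R) (b : R).
Hypothesis r0 : forall i j, 0 <= r i j.
Hypothesis irr : irreducible_rate r.
Hypothesis stm : is_stationary r m.
Hypothesis b1 : 1 <= b.
Variable P : probability Om R.
Hypothesis hP : solves_martingale_problem r m b P.
Implicit Types (A : {set 'I_n.+1}) (x : E).

Let norm_path_integral (f : E -> R) (M s : R) : continuous f ->
  (forall x, simplex x -> `|f x| <= M) -> `|\int[P]_w f (position w s)| <= M.
Proof.
move=> cf fM; have If := integrable_path P s cf measurableT.
have c1 : P.-integrable setT (EFin \o (fun=> M)).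
  by apply: integrable_cst => //; exact: probability_lty.
apply: le_trans (le_normr_Rintegral measurableT If) _.
apply: (@le_trans _ _ (\int[P]_(w in setT) M)).
  apply: (le_Rintegral measurableT _ c1); last by move=> w _; apply: fM; exact: path_simplex.
  apply: (integrable_le measurableT _ _ c1).
    by apply: measurableT_comp => //; exact: measurable_path.
  by move=> w _; rewrite normr_id; apply: fM; exact: path_simplex.
have P1 : fine (P setT) = 1 by rewrite probability_setT.
have -> : M = M * fine (P setT) by rewrite P1 mulr1.
by rewrite (Rintegral_cst P measurableT) P1 mulr1.
Qed.

Let past_setT (s : R) : past s (setT : set path).
Proof.
exact: (@measurableT _ (g_sigma_algebraType (\bigcup_(s in `[0, s]) @sigma_coord R n.+1 s))).
Qed.

Lemma integrable_local_pot_path A (e T : R) : A != finset.setT -> 0 < e ->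
  (occ P).-integrable (`]0, T] `*` setT) (EFin \o (fun z => local_pot A e (@state R n z))).
Proof.
move=> AT e0.
have [T0|T0] := leP 0 T; last first.
  have -> : `]0, T] `*` (setT : set Om) = set0 :> set (measurableTypeR R * Om).
    rewrite -subset0 => -[s w] [/=]; rewrite in_itv/= => /andP[h1 h2].
    by have := lt_le_trans h1 h2; rewrite ltNge ltW.
  exact: integrable_set0.
apply: (integrable_local_pot r0 irr stm b1 (mu := occ P) (X := @state R n)) => //.
- exact: measurable_slab.
- exact: occ_slab.
- exact: state_simplex.
- exact: measurable_state.
- move=> F G M dF cF cG FG FM.
  rewrite -(occupation hP dF cF cG FG (lexx 0) T0 (@past_setT 0)).
  rewrite (le_trans (ler_normB _ _))// mulr2n mulrDl mul1r.
  by apply: lerD; exact: norm_path_integral.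
Qed.

(** Dominated convergence on both sides extends the occupation identity to the limit p(u) kap, which
    need not lie in the domain. *)
Lemma occupation_limit (F G : nat -> E -> R) (f L H : E -> R) (M T : R) :
  (forall i, [/\ dom_S r m b (F i), continuous (F i), continuous (G i)
            & forall x, simplex x -> gen r m b (F i) x = G i x]) ->
  (forall i x, simplex x -> `|F i x| <= M) ->
  (forall x, simplex x -> F^~ x @ \oo --> f x /\ G^~ x @ \oo --> L x) ->
  (forall i x, simplex x -> `|G i x| <= H x) ->
  (occ P).-integrable (`]0, T] `*` setT) (EFin \o (fun z => H (@state R n z))) ->
  forall s t (B : set path), 0 <= s -> s <= t -> t <= T -> past s B ->
  (occ P).-integrable (`]s, t] `*` B) (EFin \o (fun z => L (@state R n z))) /\
  \int[P]_(w in (B : set Om)) f (position w t) - \int[P]_(w in (B : set Om)) f (position w s) =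
  \int[occ P]_(z in `]s, t] `*` B) L (state z).
Proof.
move=> HFG FM FGL GH iH s t B s0 st tT pB.
have mB := past_measurable pB.
have mD := @measurable_slab R n s t _ mB.
have [||||iL cL] := @dominated_Rintegral _ _ _ (occ P) _ mD (fun i z => G i (state z))
  (fun z => L (state z)) (fun z => H (state z)).
- by move=> i; apply: measurable_funTS; apply: measurable_state; have [] := HFG i.
- by move=> z _; have [] := FGL _ (state_simplex z).
- by move=> i z _; exact: GH (state_simplex z).
- apply: (integrableS _ mD _ iH); first exact: measurable_slab.
  move=> [v w] [/=]; rewrite !in_itv/= => /andP[h1 h2] _.
  by rewrite (le_lt_trans s0 h1) (le_trans h2 tT).
split=> //.
have Fc v : (fun i => \int[P]_(w in (B : set Om)) F i (position w v)) @ \oo -->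
    \int[P]_(w in (B : set Om)) f (position w v).
  have [||||//] := @dominated_Rintegral _ _ _ P _ mB (fun i w => F i (position w v))
    (fun w => f (position w v)) (fun=> M).
  - by move=> i; apply: measurable_funTS; apply: measurable_path; have [] := HFG i.
  - by move=> w _; have [] := FGL _ (path_simplex w v).
  - by move=> i w _; exact: FM (path_simplex w v).
  - by apply: integrable_cst => //; exact: probability_lty.
have cD : (fun i => \int[occ P]_(z in `]s, t] `*` B) G i (state z)) @ \oo -->
    \int[P]_(w in (B : set Om)) f (position w t) - \int[P]_(w in (B : set Om)) f (position w s).
  suff -> : (fun i => \int[occ P]_(z in `]s, t] `*` B) G i (state z)) =
    (fun i => \int[P]_(w in (B : set Om)) F i (position w t) - \int[P]_(w in (B : set Om)) F i (position w s)).
    by apply: cvgB; exact: Fc.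
  apply/funext => i; have [h1 h2 h3 h4] := HFG i.
  exact/esym/(occupation hP h1 h2 h3 h4 s0 st pB).
exact: (norm_cvg_unique cD cL).
Qed.

Lemma absorbing_null A (de : R) : A != finset.setT -> 0 < de ->
  exists2 th, 0 < th & forall q t, 0 <= q -> q < t -> P.-negligible
    [set w : path | [/\ forall s, q <= s <= t ->
        away A de (w s) /\ (forall k, k \in A -> w s ord0 k <= th),
      exists2 s, q <= s <= t & (forall k, k \in A -> w s ord0 k = 0)
    & exists2 k, k \in A & 0 < w t ord0 k]].
Proof.
move=> AT de0.
have [ga [kap [a0 [a1 [a2 [Q [eta [K [c [d' [[[n0 K0 c0 /andP[d'0 d'e]] [gaK gaA gac] [ck kap01] Hb] H5]]]]]]]]]]] :=
  limit_test r0 irr stm b1 AT de0.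
have [p [p1 [p2 [M [Cp pv pM plow]]]]] := linear_profile n0.
have [F [G [L [HFG HFb HFl Lb LE]]]] := H5 p p1 p2 Cp pv 1 ltr01.
have M0 : 0 <= M by have [_] := pM 0 (lexx _); apply: le_trans; rewrite !addr_ge0.
have u0 x : simplex x -> 0 <= lin ga x.
  by move=> sx; apply: lin_ge0 => // i; case/andP: (gaK i).
(* eta / 4 makes p the identity and 1 gives u a0 <= K. With c^2 / (2 K), a positive u forces an
   occupied site of [A] of mass at most c / (2 K), so P >= 2 K, and the drift u a0 + a1 <= 2 K - P
   is nonpositive. *)
pose eta2 := Num.min (Num.min (eta / 4) 1) (c * c / (2 * K)).
have eta20 : 0 < eta2 by rewrite !lt_min ltr01 !divr_gt0 ?mulr_gt0.
pose th := eta2 / (K * n.+1%:R).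
have th0 : 0 < th by rewrite divr_gt0// mulr_gt0// ltr0n.
exists th => // q t q0 qt.
(* One continuous function whose sign encodes the region u <= eta2 with masses at least [de] outside
   [A]. *)
pose g x : R := Num.max (lin ga x - eta2) 0 + \sum_k (if k \in A then 0 else Num.max (de - x ord0 k) 0).
have s0 x : 0 <= \sum_k (if k \in A then 0 else Num.max (de - x ord0 k) 0).
  by apply: sumr_ge0 => k _; case: ifP => // _; rewrite le_max lexx orbT.
have gP x : g x <= 0 <-> lin ga x <= eta2 /\ away A de x.
  split=> [gx|[ux aw]].
    have m0 : 0 <= Num.max (lin ga x - eta2) 0 by rewrite le_max lexx orbT.
    have m1 : Num.max (lin ga x - eta2) 0 <= 0 by apply: le_trans gx; rewrite lerDl.
    have sx : \sum_k (if k \in A then 0 else Num.max (de - x ord0 k) 0) <= 0.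
      by apply: le_trans gx; rewrite lerDr.
    split; first by move: m1; rewrite ge_max lexx andbT subr_le0.
    move=> k kA; have : Num.max (de - x ord0 k) 0 <= 0.
      apply: le_trans sx; rewrite (bigD1 k)//= (negbTE kA) lerDl.
      by apply: sumr_ge0 => i _; case: ifP => // _; rewrite le_max lexx orbT.
    by rewrite ge_max lexx andbT subr_le0.
  rewrite /g big1 => [|k _].
    by rewrite addr0 ge_max lexx andbT subr_le0.
  by case: ifPn => // kA; apply/max_idPr; rewrite subr_le0; exact: aw.
have cg : continuous g.
  apply: ctsD.
    apply: cts_max; last exact: cts_cst.
    by apply: ctsD; [exact: continuous_lin|exact: cts_cst].
  apply: continuous_bigsum => k; case: (k \in A); first exact: cts_cst.
  apply: cts_max; last exact: cts_cst.
  apply: ctsD; first exact: cts_cst.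
  by move=> x; exact: (cvgN (@cts_coord R n.+1 k x)).
pose f x : R := p (lin ga x) * kap x.
pose H x : R := K * M * (1 + local_pot A d' x).
have [cp _ _] := C2R_continuous Cp.
have cf : continuous f.
  apply: ctsM => // x; apply: continuous_comp; first exact: continuous_lin.
  exact: cp.
have f0 x : simplex x -> 0 <= f x.
  move=> sx; have [/andP[k0 _] _] := kap01 x sx.
  by have [p0 _] := pM _ (u0 x sx); exact: mulr_ge0.
have fu x : simplex x -> g x <= 0 -> f x = lin ga x.
  move=> sx /gP[ux aw]; rewrite /f (kap01 x sx).2// mulr1.
  by have [|//] := plow (lin ga x); rewrite (le_trans ux)// /eta2 !ge_min lexx.
have KM0 : 0 <= K * M by rewrite mulr_ge0// ltW.
have H0 x : simplex x -> 0 <= H x.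
  by move=> sx; rewrite mulr_ge0// addr_ge0// local_pot_ge0.
have mH : measurable_fun setT (H \o @state R n).
  rewrite /comp /H; apply: measurable_funM; first exact: measurable_cst.
  apply: measurable_funD; first exact: measurable_cst.
  by apply: measurable_local_pot; exact: measurable_state.
have iH T : (occ P).-integrable (`]0, T] `*` setT) (EFin \o (H \o @state R n)).
  have mD : measurable (`]0, T] `*` setT : set (measurableTypeR R * Om)) by exact: measurable_slab.
  apply: (integrable_scale mD (K * M)); apply: (integrable_add mD).
    by apply: integrable_cst => //; exact: occ_slab.
  exact: integrable_local_pot_path.
have KMpot x y : simplex x -> `|p y| + `|p1 y| + `|p2 y| <= M ->
    K * (`|p y| + `|p1 y| + `|p2 y|) * (1 + pot A x) <= K * M * (1 + pot A x).
  by move=> sx yM; rewrite ler_wpM2r ?addr_ge0 ?pot_ge0// ler_wpM2l// ltW.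
have GH i x : simplex x -> `|G i x| <= H x.
  move=> sx; have [y /andP[y1 y2] [_ h h']] := HFb i x sx.
  have y0 : 0 <= y by rewrite (le_trans _ y1)// u0.
  have [_ yM] := pM y y0.
  case: h' => [/awayP aw|[_ ->]]; last by rewrite normr0 H0.
  rewrite /H /local_pot aw; exact: le_trans h (KMpot _ _ sx yM).
have FM i x : simplex x -> `|F i x| <= M.
  move=> sx; have [y /andP[y1 y2] [h _ _]] := HFb i x sx.
  have y0 : 0 <= y by rewrite (le_trans _ y1)// u0.
  have [_ yM] := pM y y0; apply: le_trans h _; apply: le_trans yM.
  by rewrite -addrA lerDl addr_ge0.
have LV x : simplex x -> L x <= if g x <= 0 then 0 else H x.
  move=> sx; case: ifPn => [/gP[ux aw]|_]; last first.
    have [_ yM] := pM _ (u0 x sx).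
    have LH := Lb x sx; move: LH; rewrite LE /H /local_pot; case: ifPn => [aw|_] LH.
      by apply: le_trans (ler_norm _) _; exact: le_trans LH (KMpot _ _ sx yM).
    by rewrite addr0 mulr1.
  have aw' : away A d' x by move=> k /aw; exact: le_trans.
  have [q1 q2 _ _ [q5 q6]] := Hb x sx aw'.
  have u4 : lin ga x <= eta / 4 by rewrite (le_trans ux)// /eta2 !ge_min lexx.
  have uu1 : lin ga x <= 1 by rewrite (le_trans ux)// /eta2 !ge_min lexx orbT.
  have uc : lin ga x <= c * c / (2 * K) by rewrite (le_trans ux)// /eta2 !ge_min lexx !orbT.
  rewrite LE; have /awayP -> := aw'.
  have [-> -> ->] := plow _ u4; rewrite mul1r mul0r addr0.
  have [uz|uz] := eqVneq (lin ga x) 0; first by rewrite uz mul0r add0r (q6 uz).1.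
  have up : 0 < lin ga x by rewrite lt_def uz u0.
  have [x0 _] := sx.
  have [k kA xk] : exists2 k, k \in A & 0 < x ord0 k.
    apply: contrapT => nk; move/eqP: uz; apply; apply: big1 => k _.
    have [kA|/gaA ->] := boolP (k \in A); last by rewrite mul0r.
    suff -> : x ord0 k = 0 by rewrite mulr0.
    apply/eqP; rewrite eq_le x0 andbT leNgt; apply/negP => xk.
    by apply: nk; exists k.
  have kx : c * x ord0 k <= lin ga x.
    apply: (@le_trans _ _ (ga k * x ord0 k)); first by rewrite ler_wpM2r// gac.
    by apply: lin_ge_term => // i; case/andP: (gaK i).
  have Q2 : 2 * K <= Q x.
    apply: le_trans q1; apply: (@le_trans _ _ (c * (x ord0 k)^-1)); last first.
      by rewrite ler_wpM2l ?(ltW c0)//; exact: inv_le_pot.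
    rewrite ler_pdivlMr// -ler_pdivlMl ?mulr_gt0// mulrC.
    have : c * x ord0 k <= c * (c / (2 * K)) by rewrite mulrA (le_trans kx).
    by rewrite ler_pM2l.
  rewrite (kap01 x sx).2// mul1r in q2.
  have ua : lin ga x * a0 x <= K.
    rewrite (le_trans (ler_norm _))// normrM ger0_norm ?u0//.
    by apply: le_trans q5; rewrite ler_piMl.
  by move: (lin ga x * a0 x) (a1 x) (Q x) ua q2 Q2 => v1 v2 v3; lra.
have step s v (B : set path) : 0 <= s -> s <= v -> past s B ->
    \int[P]_(w in (B : set Om)) f (position w v) <= \int[P]_(w in (B : set Om)) f (position w s) +
    \int[occ P]_(z in `]s, v] `*` B) (if g (state z) <= 0 then 0 else H (state z)).
  move=> s00 sv pB; have mB := past_measurable pB.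
  have mD := @measurable_slab R n s v _ mB.
  have [iL eL] := occupation_limit HFG FM HFl GH (iH v) s00 sv (lexx v) pB.
  have iV : (occ P).-integrable (`]s, v] `*` B)
      (EFin \o (fun z => if g (@state R n z) <= 0 then 0 else H (state z))).
    apply: (integrable_le mD (g := H \o @state R n)).
    - apply: measurable_funTS; apply: measurable_fun_ifT.
      + by apply: measurable_fun_ler; [exact: measurable_state|exact: measurable_cst].
      + exact: measurable_cst.
      + exact: mH.
    - move=> z _; have sz := @state_simplex R n z.
      by case: ifP => _; rewrite ?normr0 ?ger0_norm //; exact: H0.
    - apply: (integrableS _ mD _ (iH v)); first exact: measurable_slab.
      move=> [y w] [/=]; rewrite !in_itv/= => /andP[h1 h2] _.
      by rewrite (le_lt_trans s00 h1) h2.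
  rewrite -lerBlDl eL.
  by apply: (le_Rintegral mD iL iV) => z _; exact: LV (state_simplex z).
have := grid_null cg (@continuous_lin R n.+1 ga) cf f0 fu H0 mH iH step q0 qt.
apply: negligibleS => w [h1 [s hs h2] [k kA h3]].
have wx v := path_simplex w v.
split.
- move=> v hv; apply/gP; have [aw h] := h1 v hv; split=> //.
  apply: (@le_trans _ _ (\sum_(i < n.+1) K * th)).
    apply: ler_sum => i _; have /andP[g0 g1] := gaK i; have [x0 _] := wx v.
    have [iA|/gaA ->] := boolP (i \in A); last by rewrite mul0r mulr_ge0 ?ltW.
    by apply: ler_pM => //; exact: h.
  rewrite sumr_const card_ord -mulr_natr /th.
  by rewrite le_eqVlt; apply/orP; left; apply/eqP; field; rewrite !gt_eqF//= ltr0n.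
- exists s => //; apply: big1 => i _.
  by have [iA|/gaA ->] := boolP (i \in A); [rewrite h2// mulr0|rewrite mul0r].
- apply: lt_le_trans (lin_ge_term k (wx t) _); last by move=> i; case/andP: (gaK i).
  by rewrite mulr_gt0// (lt_le_trans c0)// gac.
Qed.

End Absorption.

(** * From countably many null events to the persistence of zeros *)

Section ZerosPersist.
Context {R : realType} {n : nat}.
Local Notation E := 'rV[R]_n.+1.
Local Notation Om := (path_space R n.+1).
Local Notation path := (trajectory R n.+1).
Implicit Types (A : {set 'I_n.+1}) (w : path).

(** The null event of [absorbing_null], indexed so that, with rational q and t, countably many
    instances are enough. *)
Definition revival (th : {set 'I_n.+1} -> nat -> R) A (k : nat) (q t : R) : set path :=
  [set w : path | [/\ forall s, q <= s <= t ->
        away A k.+1%:R^-1 (w s) /\ (forall i, i \in A -> w s ord0 i <= th A k),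
      exists2 s, q <= s <= t & (forall i, i \in A -> w s ord0 i = 0)
    & exists2 i, i \in A & 0 < w t ord0 i]].

(** If coordinate j revives, let c be its last zero and A the set of all sites empty at time c. Near
    c the other sites stay away from 0 and the sites of A stay below the threshold, so a revival
    happens between rational times q <= c < t. *)
Lemma zeros_persist (th : {set 'I_n.+1} -> nat -> R) w :
  (forall A k, A != finset.setT -> 0 < th A k) ->
  (forall A k (q t : rat), A != finset.setT -> 0 <= (ratr q : R) -> (ratr q : R) < ratr t ->
     ~ revival th A k (ratr q) (ratr t) w) ->
  forall j s t, 0 <= s -> s <= t -> w s ord0 j = 0 -> w t ord0 j = 0.
Proof.
move=> th0 nr j s t0 s0 st ws; apply: contrapT => wt.
have wx v k : 0 <= w v ord0 k by have [h _] := path_simplex w v.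
have cw k : continuous (fun v => w v ord0 k) by exact: path_comp_continuous (@cts_coord R n.+1 k).
pose Z : set R := [set v | s <= v <= t0 /\ w v ord0 j = 0].
have Zs : Z s by split=> //; rewrite lexx.
have supZ : has_sup Z by split; [exists s|exists t0 => v [/andP[]]].
pose c := sup Z.
have sc : s <= c by apply: sup_upper_bound.
have ct : c <= t0 by apply: ge_sup; [exists s|move=> v [/andP[]]].
have c0 : 0 <= c := le_trans s0 sc.
have wc : w c ord0 j = 0.
  apply/eqP; apply: contrapT => /negP h.
  have wc0 : 0 < w c ord0 j by rewrite lt_def h wx.
  have := cvgr_gt _ (cw j c) 0 wc0; rewrite -nbhs_ballE => -[d /= d0 hd].
  have [v [/andP[sv vt] wv] cv] := sup_adherent d0 supZ.
  have vc : v <= c by apply: sup_upper_bound => //; split=> //; rewrite sv.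
  have : 0 < w v ord0 j.
    apply: hd; rewrite /ball/= ger0_norm ?subr_ge0//.
    by rewrite ltrBlDr addrC -ltrBlDr.
  by rewrite wv ltxx.
have ct' : c < t0 by rewrite lt_neqAle ct andbT; apply/eqP => e; apply: wt; rewrite -e.
have after v : c < v -> v <= t0 -> 0 < w v ord0 j.
  move=> cv vt; rewrite lt_def wx andbT; apply/eqP => wv.
  suff : v <= c by rewrite leNgt cv.
  by apply: sup_upper_bound => //; split=> //; rewrite (le_trans sc (ltW cv)).
pose A := [set k | w c ord0 k == 0]%SET.
have AP k : (k \in A) = (w c ord0 k == 0) by rewrite inE.
have jA : j \in A by rewrite AP wc.
have AT : A != finset.setT.
  apply/eqP => AT; have [_] := path_simplex w c.
  rewrite big1 => [/esym/eqP|k _]; first by rewrite oner_eq0.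
  by apply/eqP; rewrite -AP AT inE.
have [k hk] : exists k : nat, forall i, i \notin A -> k.+1%:R^-1 < w c ord0 i.
  have h (i : 'I_n.+1) : \forall k \near \oo, i \notin A -> k.+1%:R^-1 < w c ord0 i.
    have [iA|iA] := boolP (i \in A); first by near=> k.
    have : 0 < w c ord0 i by rewrite lt_def -AP iA wx.
    move=> h; near=> k => _; near: k; exact: (cvgr_lt _ (@cvg_harmonic R)).
  have := @filter_forall nat 'I_n.+1 (fun i k => i \notin A -> k.+1%:R^-1 < w c ord0 i) _ _ h.
  by move=> [k _ /(_ k (leqnn _)) hk]; exists k.
have hloc : \forall v \near c, forall i,
    (i \notin A -> k.+1%:R^-1 <= w v ord0 i) /\ (i \in A -> w v ord0 i <= th A k).
  apply: (@filter_forall R 'I_n.+1 (fun i v => (i \notin A -> k.+1%:R^-1 <= w v ord0 i) /\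
     (i \in A -> w v ord0 i <= th A k)) (nbhs c) _) => i.
  have [iA|iA] := boolP (i \in A).
    have h : w c ord0 i < th A k by move: iA; rewrite AP => /eqP ->; exact: th0.
    near=> v; split=> // _; near: v; exact: (cvgr_le _ (cw i c)).
  near=> v; split=> // _; near: v; exact: (cvgr_ge _ (cw i c) _ (hk i iA)).
have [d /= d0 hd] := (nbhs_ballP _ _).1 hloc.
have [t] : exists t, ratr t \in `]c, Num.min (c + d) t0[.
  by apply: rat_in_itvoo; rewrite lt_min ltrDl d0.
rewrite in_itv/= lt_min => /andP[tc /andP[td tt]].
(* As q must be nonnegative, q = 0 itself is taken when c = 0; this is why q <= c is not strict. *)
have [q [q0 qd qc]] : exists q : rat, [/\ 0 <= ratr q :> R, c - d < ratr q & ratr q <= c].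
  move: c0; rewrite le_eqVlt => /predU1P[<-|c0].
    by exists 0; rewrite rmorph0 lexx sub0r oppr_lt0.
  have [q] : exists q, ratr q \in `]Num.max 0 (c - d), c[.
    by apply: rat_in_itvoo; rewrite gt_max c0 gtrBl.
  rewrite in_itv/= gt_max => /andP[/andP[q0 qd] qc].
  by exists q; split=> //; exact: ltW.
apply: (nr A k q t AT q0 (le_lt_trans qc tc)); split.
- move=> v /andP[qv vt].
  have bv : ball c d v.
    rewrite /ball/= ltr_norml; apply/andP; split.
      by rewrite ltrBrDl ltrBlDr (le_lt_trans vt).
    by rewrite ltrBlDr -ltrBlDl (lt_le_trans qd).
  by split=> i iA; have [h1 h2] := hd v bv i; [exact: h1|exact: h2].
- exists c; first by rewrite qc ltW.
  by move=> i; rewrite AP => /eqP.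
- by exists j => //; apply: after => //; exact: ltW.
Unshelve. all: by end_near. Qed.

Variables (r : 'I_n.+1 -> 'I_n.+1 -> R) (m : 'I_n.+1 -> R) (b : R).
Hypothesis r0 : forall i j, 0 <= r i j.
Hypothesis irr : irreducible_rate r.
Hypothesis stm : is_stationary r m.
Hypothesis b1 : 1 <= b.
Variable P : probability Om R.
Hypothesis hP : solves_martingale_problem r m b P.

Lemma negligible_countable (I : countType) (F : I -> set Om) :
  (forall i, P.-negligible (F i)) -> P.-negligible (\bigcup_i F i).
Proof.
move=> HF; apply: (@negligibleS _ _ _ _ (\bigcup_k (if unpickle k is Some i then F i else set0))).
  by move=> w [i _ Fi]; exists (pickle i) => //; rewrite pickleK.
apply: negligible_bigcup => k; case: (unpickle k) => // *; exact: negligible_set0.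
Qed.

Lemma zeros_persist_ae : P.-negligible [set w : path |
  ~ forall j s t, 0 <= s -> s <= t -> w s ord0 j = 0 -> w t ord0 j = 0].
Proof.
have exth (Ak : {set 'I_n.+1} * nat) : exists th : R, Ak.1 != finset.setT -> 0 < th /\
   forall q t, 0 <= q -> q < t -> P.-negligible (revival (fun _ _ => th) Ak.1 Ak.2 q t).
  case: (pselect (Ak.1 != finset.setT)) => [AT|nAT]; last by exists 0 => /nAT.
  have k0 : 0 < Ak.2.+1%:R^-1 :> R by rewrite invr_gt0 ltr0n.
  have [th th0 hth] := absorbing_null r0 irr stm b1 hP AT k0.
  by exists th => _; split=> // q t q0 qt; exact: hth.
have [th Hth] := @choice _ _ _ exth.
pose th' A k := th (A, k).
pose F (i : {set 'I_n.+1} * nat * (rat * rat)) : set Om :=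
  if [&& i.1.1 != finset.setT, 0 <= (ratr i.2.1 : R) & (ratr i.2.1 : R) < ratr i.2.2] then
    revival th' i.1.1 i.1.2 (ratr i.2.1) (ratr i.2.2) else set0.
apply: (@negligibleS _ _ _ _ (\bigcup_i F i)); last first.
  apply: negligible_countable => -[[A k] [q t]]; rewrite /F /=.
  case: ifPn => [/and3P[AT q0 qt]|_]; last exact: negligible_set0.
  by have [_] := Hth (A, k) AT; apply.
move=> w hw; apply: contrapT => nF; apply: hw; apply: (@zeros_persist th').
  by move=> A k AT; have [] := Hth (A, k) AT.
move=> A k q t AT q0 qt hr; apply: nF; exists (A, k, (q, t)) => //.
by rewrite /F /= AT q0 qt.
Qed.

End ZerosPersist.

(** * Measurability of the absorption times *)

Section HittingTimes.
Context {R : realType} {n : nat}.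
Implicit Types (w : R -> 'rV[R]_n).

Lemma sigma_timeS k w : sigma_time k.+1 w =
  if sigma_time k w is u%:E then (u%:E + hit (live_set k w) (shift_time u w))%E else +oo%E.
Proof. by rewrite /sigma_time /live_set /=; case: (absorption k w) => -[]. Qed.

Lemma live_setE k w v : sigma_time k w = v%:E -> live_set k w = pos_sites (w v).
Proof.
case: k => [[<-]//|k]; rewrite /sigma_time /live_set /=.
case: (absorption k w) => -[u| |] B //=.
by case: (u%:E + _)%E => // x [->].
Qed.

Lemma hit_ge0 (B : {set 'I_n}) w : (0 <= hit B w)%E.
Proof. by apply: le_ereal_inf_tmp => _ [t [t0 _] <-]; rewrite lee_fin. Qed.

Lemma sigma_time_ge0 k w : (0 <= sigma_time k w)%E.
Proof.
elim: k => [|k IH]; first by [].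
rewrite sigma_timeS; case: (sigma_time k w) IH => [u| |] // u0.
by rewrite adde_ge0// hit_ge0.
Qed.

Lemma sigma_time_fin k w (t : \bar R) : (sigma_time k w < t)%E ->
  exists v, sigma_time k w = v%:E.
Proof.
have := sigma_time_ge0 k w; case: (sigma_time k w) => [v| |] // _; first by exists v.
by rewrite ltNge leey.
Qed.

(** A strict inequality on an infimum yields a witness, so no attainment of the hitting time is
    involved. *)
Lemma sigma_time_lt k w (rho : R) : (sigma_time k.+1 w < rho%:E)%E <->
  exists u t, [/\ sigma_time k w = u%:E, u <= t < rho
    & \prod_(j in pos_sites (w u)) w t ord0 j = 0].
Proof.
rewrite sigma_timeS; split.
  case e : (sigma_time k w) => [u| |] /=; try by rewrite ltNge leey.
  rewrite (live_setE e) => h.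
  have : (hit (pos_sites (w u)) (shift_time u w) < (rho - u)%:E)%E by rewrite EFinB lteBrDl.
  move=> /ereal_inf_lt[_ [v [v0 hv] <-]]; rewrite lte_fin => vr.
  exists u, (u + v); split=> //.
  by rewrite lerDl v0/= -ltrBrDl.
move=> [u [t [e /andP[ut tr] pt]]]; rewrite e (live_setE e).
apply: (@le_lt_trans _ _ t%:E); last by rewrite lte_fin.
have -> : t%:E = (u%:E + (t - u)%:E)%E by rewrite -EFinD addrC subrK.
apply: leeD2l; apply: ereal_inf_lbound; exists (t - u) => //.
by split; [rewrite subr_ge0|rewrite /shift_time addrC subrK].
Qed.

End HittingTimes.

Section EventMeasurability.
Context {R : realType} {n : nat}.
Local Notation Om := (path_space R n.+1).
Local Notation path := (trajectory R n.+1).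

Lemma measurable_path_at (tau : Om -> R) (g : 'rV[R]_n.+1 -> R) : continuous g ->
  measurable_fun setT tau -> measurable_fun setT (fun w : Om => g (position w (tau w))).
Proof.
move=> cg mt; have mp : measurable_fun setT (fun w : Om => ((tau w : measurableTypeR R), w)).
  by apply: measurable_fun_pair => //; exact: measurable_id.
exact: (measurableT_comp (measurable_joint cg) mp).
Qed.

Lemma measurable_bool_set (c : Om -> bool) : measurable_fun setT c -> measurable [set w : Om | c w].
Proof. by move=> /(_ measurableT [set true] I); rewrite setTI. Qed.

(** By compactness, the product over the live sites has a zero between [sigma_time k] and a rational
    rh < rho if and only if, for every i, it is below 1 / (i + 1) at some point of a countable dense
    set. That random segment is parametrized by [0, 1], where rationals can be used. *)
Lemma measurable_sigma_time k : measurable_fun setT (fun w : Om => sigma_time k (position w)).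
Proof.
elim: k => [|k IH]; first exact: measurable_cst.
(* [fine] sends +oo to 0; this value is discarded below by intersecting with the event that
   [sigma_time k] is finite. *)
pose tau (w : Om) : R := fine (sigma_time k (position w)).
have mtau : measurable_fun setT tau by apply: (measurableT_comp _ IH); exact: fine_measurable.
(* Sites that are empty at time [tau w] contribute the factor 1, so that the index set of the
   product does not depend on the path. *)
pose h (th rho : R) (w : Om) : R := \prod_(j < n.+1)
  (if 0 < position w (tau w) ord0 j then position w (tau w + th * (rho - tau w)) ord0 j else 1).
have mh th rho : measurable_fun setT (h th rho).
  apply: measurable_prod => j _; apply: measurable_fun_ifT.
  - apply: measurable_fun_ltr; first exact: measurable_cst.
    by apply: (measurable_path_at (g := fun x => x ord0 j)) => //; exact: cts_coord.
  - apply: (measurable_path_at (tau := fun w => tau w + th * (rho - tau w))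
      (g := fun x => x ord0 j)); first exact: cts_coord.
    apply: measurable_funD => //; apply: measurable_funM; first exact: measurable_cst.
    by apply: measurable_funB => //; exact: measurable_cst.
  - exact: measurable_cst.
pose T (rho : R) (i : nat) (th : rat) : set Om :=
  if 0 <= (ratr th : R) <= 1 then [set w : Om | h (ratr th) rho w < i.+1%:R^-1] else set0.
have mT rho i th : measurable (T rho i th).
  rewrite /T; case: ifP => // _; apply: measurable_bool_set.
  by apply: measurable_fun_ltr; [exact: mh|exact: measurable_cst].
apply: (measurability _ (ErealGenInftyO.measurableE R)).
move=> _ [_ [rho ->] <-]; rewrite setTI.
rewrite (_ : _ @^-1` _ = [set w : Om | (sigma_time k (position w) < +oo)%E] `&`
  \bigcup_(rh : rat) (if (ratr rh : R) < rho then
    [set w : Om | tau w <= ratr rh] `&` \bigcap_i \bigcup_th T (ratr rh) i th else set0)).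
  apply: measurableI.
    by have := emeasurable_fun_infty_o measurableT IH (+oo)%E; rewrite setTI.
  apply: bigcupT_measurable_rat => rh; case: ifP => // _.
  apply: measurableI.
    by apply: measurable_bool_set; apply: measurable_fun_ler => //; exact: measurable_cst.
  apply: bigcapT_measurable => i; exact: bigcupT_measurable_rat.
have hE w th rh u : sigma_time k (position w) = u%:E ->
    h th rh w = \prod_(j in pos_sites (position w u)) position w (u + th * (rh - u)) ord0 j.
  move=> e; rewrite /h /tau e /= [RHS]big_mkcond; apply: eq_bigr => j _.
  by rewrite inE.
have ch (w : path) (B : {set 'I_n.+1}) (u v : R) :
    continuous (fun th : R => \prod_(j in B) w (u + th * v) ord0 j).
  have cj (j : 'I_n.+1) : continuous (fun th : R => w (u + th * v) ord0 j).
    have ca : continuous (fun th : R => u + th * v).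
      by apply: ctsD; [exact: cts_cst|apply: ctsM; [move=> ?; exact: cvg_id|exact: cts_cst]].
    have cf : continuous (fun s => w s ord0 j) := path_comp_continuous (@cts_coord R n.+1 j).
    by move=> th; exact: (continuous_comp (ca th) (cf _)).
  have gen (l : seq 'I_n.+1) : continuous (fun th : R => \prod_(j <- l) w (u + th * v) ord0 j).
    elim: l => [|j l IHl].
      by rewrite (_ : (fun _ => _) = (fun=> 1)); [exact: cts_cst|apply/funext => th; rewrite big_nil].
    rewrite (_ : (fun _ => _) = (fun th : R => w (u + th * v) ord0 j * \prod_(i <- l) w (u + th * v) ord0 i)).
      exact: ctsM.
    by apply/funext => th; rewrite big_cons.
  rewrite (_ : (fun _ => _) = (fun th : R => \prod_(j <- enum B) w (u + th * v) ord0 j)); first exact: gen.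
  by apply/funext => th; rewrite big_enum.
apply/seteqP; split=> w /=.
  rewrite in_itv/= => /sigma_time_lt[u [t [e /andP[ut tr] pt]]].
  have [rh] := rat_in_itvoo tr; rewrite in_itv/= => /andP[trh rhr].
  split; first by rewrite e ltry.
  exists rh => //; rewrite rhr; split.
    by rewrite /tau /= e /= (le_trans ut (ltW trh)).
  move=> i _; have uv : 0 < ratr rh - u by rewrite subr_gt0 (le_lt_trans ut).
  pose th0 := (t - u) / (ratr rh - u).
  have tu : 0 <= t - u by rewrite subr_ge0.
  have th00 : 0 <= th0 := divr_ge0 tu (ltW uv).
  have th01 : th0 < 1 by rewrite ltr_pdivrMr// mul1r ltrD2r.
  have hth0 : \prod_(j in pos_sites (w u)) w (u + th0 * (ratr rh - u)) ord0 j < i.+1%:R^-1.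
    have -> : u + th0 * (ratr rh - u) = t by rewrite /th0 divfK ?gt_eqF// addrC subrK.
    by rewrite pt invr_gt0 ltr0n.
  have hj : \forall th \near th0, \prod_(j in pos_sites (w u)) w (u + th * (ratr rh - u)) ord0 j < i.+1%:R^-1.
    exact: (cvgr_lt _ (ch w (pos_sites (w u)) u (ratr rh - u) th0)).
  have [d /= d0 hd] := (nbhs_ballP _ _).1 hj.
  have [th] : exists th, ratr th \in `]th0, Num.min 1 (th0 + d)[.
    by apply: rat_in_itvoo; rewrite lt_min th01 ltrDl d0.
  rewrite in_itv/= lt_min => /andP[h1 /andP[h2 h3]].
  exists th => //; rewrite /T (le_trans th00 (ltW h1)) (ltW h2) /= (hE _ _ _ _ e).
  apply: hd; rewrite /ball/= ltr_norml; apply/andP; split.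
    by rewrite ltrBrDl ltrBlDr.
  by rewrite (lt_trans _ d0)// subr_lt0.
move=> [sf [rh _]]; case: ifP => // rhr [taurh Hi].
have [u e] := sigma_time_fin sf; rewrite in_itv/=; apply/sigma_time_lt.
rewrite /tau /= e /= in taurh.
have c := ch w (pos_sites (w u)) u (ratr rh - u).
have [th0] := @EVT_min R _ 0 1 ler01 (continuous_subspaceT c).
rewrite in_itv/= => /andP[th00 th01] hmin.
exists u, (u + th0 * (ratr rh - u)); split=> //.
  rewrite lerDl mulr_ge0 ?subr_ge0//= (le_lt_trans _ rhr)//.
  by rewrite -lerBrDl ler_piMl// subr_ge0.
apply/eqP; rewrite eq_le; apply/andP; split; last first.
  by apply: prodr_ge0 => j _; have [h0 _] := path_simplex w (u + th0 * (ratr rh - u)).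
apply: (@cvgr_to_ge _ \oo _ _ (fun i : nat => i.+1%:R^-1 : R)); first exact: cvg_harmonic.
near=> i; have [th _] := Hi i I; rewrite /T; case: ifP => // /andP[h1 h2].
rewrite /= (hE _ _ _ _ e) => h3; apply: le_trans (ltW h3); apply: hmin.
by rewrite in_itv/= h1.
Unshelve. all: by end_near. Qed.

(* A measure is a total function with junk values on the non-measurable sets. *)
Lemma measurable_absorbed k : measurable [set w : Om |
  forall t : R, (sigma_time k (position w) <= t%:E)%E ->
    pos_sites (position w t) \subset live_set k (position w)].
Proof.
pose tau (w : Om) : R := fine (sigma_time k (position w)).
have mtau : measurable_fun setT tau.
  by apply: (measurableT_comp _ (measurable_sigma_time k)); exact: fine_measurable.
rewrite -[X in measurable X]setCK; apply: measurableC.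
(* A site occupied at some t > sigma_k is occupied shortly before t as well, so a violation is
   always visible at a rational time. *)
rewrite (_ : ~` _ = \bigcup_(i : 'I_n.+1 * rat)
  ([set w : Om | (sigma_time k (position w) < (ratr i.2)%:E)%E] `&`
   [set w : Om | 0 < position w (ratr i.2) ord0 i.1] `&`
   [set w : Om | ~~ (0 < position w (tau w) ord0 i.1)])).
  apply: countable_bigcupT_measurable => [|i]; first exact: countableP.
  apply: measurableI; first apply: measurableI.
  - by have := emeasurable_fun_infty_o measurableT (measurable_sigma_time k) (ratr i.2)%:E; rewrite setTI.
  - apply: measurable_bool_set; apply: measurable_fun_ltr; first exact: measurable_cst.
    by apply: (@measurable_path R n _ (fun x => x ord0 i.1)); exact: cts_coord.
  - apply: measurable_bool_set; apply: measurable_neg; apply: measurable_fun_ltr; first exact: measurable_cst.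
    by apply: (measurable_path_at (g := fun x => x ord0 i.1)) => //; exact: cts_coord.
apply/seteqP; split=> w /=.
  move=> /existsNP[t /not_implyP[st /negP /fintype.subsetPn[j]]]; rewrite inE => wtj.
  have [v e] : exists v, sigma_time k (position w) = v%:E.
    by apply: (@sigma_time_fin _ _ _ _ +oo%E); rewrite (le_lt_trans st)// ltry.
  rewrite (live_setE e) inE => wvj.
  have vt : v < t.
    by rewrite e lee_fin in st; rewrite lt_neqAle st andbT; apply: contraNneq wvj => ->.
  have cj : continuous (fun s => position w s ord0 j) := path_comp_continuous (@cts_coord R n.+1 j).
  have hj : \forall s \near t, 0 < position w s ord0 j by exact: (cvgr_gt _ (cj t)).
  have [d /= d0 hd] := (nbhs_ballP _ _).1 hj.
  have [rh] : exists rh, ratr rh \in `]Num.max v (t - d), t[.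
    by apply: rat_in_itvoo; rewrite gt_max vt gtrBl.
  rewrite in_itv/= gt_max => /andP[/andP[h1 h2] h3].
  exists (j, rh) => //=; rewrite /tau e /= lte_fin h1; split=> //; split=> //.
  apply: hd; rewrite /ball/= ger0_norm ?subr_ge0 ?(ltW h3)//.
  by rewrite ltrBlDr addrC -ltrBlDr.
move=> [[j rh] _ /= [[sr wr] wt]] H.
have [v e] := sigma_time_fin sr.
have /fintype.subsetP/(_ j) := H (ratr rh) (ltW sr).
by rewrite inE (live_setE e) inE => /(_ wr); move: wt; rewrite /tau e /= => /negbTE ->.
Qed.

End EventMeasurability.

Unset Implicit Arguments.
Set Strict Implicit.
Set Printing Implicit Defensive.

Theorem theorem2p6 (R : realType) (p : nat)
  (r : 'I_p.+2 -> 'I_p.+2 -> R) (m : 'I_p.+2 -> R) (b : R)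
  (hr : is_jump_rate r) (hirr : irreducible_rate r) (hm : is_stationary r m)
  (hb : 1 <= b)
  (x : 'rV[R]_p.+2) (hx : simplex x)
  (P : probability (path_space R p.+2) R)
  (hP : solves_martingale_problem r m b P) (hPx : starts_at P x) (n : nat) :
  P [set w : trajectory R p.+2 |
      forall t : R, (sigma_time n w <= t%:E)%E ->
        pos_sites (w t) \subset live_set n w] = 1%E.
Proof.
have [r0 _] := hr.
have mE := @measurable_absorbed R p.+1 n.
set B := [set w : trajectory R p.+2 | _].
have nB : P (~` (B : set (path_space R p.+2))) = 0%E.
  apply: measure_negligible; first exact: measurableC.
  (* On a path whose zeros persist, a site occupied at t >= sigma_n cannot have been empty at
     sigma_n, so it belongs to the live set. *)
  apply: negligibleS (zeros_persist_ae r0 hirr hm hb hP) => w nw zw; apply: nw => t st.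
  have [v e] : exists v, sigma_time n w = v%:E.
    by apply: (@sigma_time_fin _ _ _ _ +oo%E); rewrite (le_lt_trans st)// ltry.
  have v0 : 0 <= v by have := sigma_time_ge0 n w; rewrite e lee_fin.
  rewrite (live_setE e); apply/fintype.subsetP => j; rewrite !inE => wt.
  have [h _] := path_simplex w v.
  rewrite lt_def h andbT; apply: contraTneq wt => wv.
  by rewrite (zw j v t v0 _ wv) ?ltxx//; rewrite e lee_fin in st.
have PB : P B \is a fin_num by rewrite ge0_fin_numE//; exact: probability_lty.
have := probability_setC P mE; rewrite -/B nB => /esym/eqP.
by rewrite sube_eq// add0e => /eqP <-.
Qed.
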